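(* Let $a$ be a classical amplitude and let $A$ be the corresponding pseudo-differential operator on $\mathcal{G}_{\tau,\mathcal{S}}(\mathbb{R}^n)$, regarded as an operator on the factor $\mathcal{G}_{\tau,\mathcal{S}}(\mathbb{R}^n)/{=_{g.t.d.}}$. Then $A$ is an extension of the classical pseudo-differential operator with amplitude $a$ defined on $\mathcal{S}'(\mathbb{R}^n)$, i.e. for every $w\in\mathcal{S}'(\mathbb{R}^n)$ $$A(\imath(w))=_{g.t.d.}\imath(Aw),$$ where on the right-hand side $A$ denotes the classical operator on $\mathcal{S}'(\mathbb{R}^n)$.
   Context: Notation: $\langle x\rangle=(1+|x|^2)^{1/2}$, $\hat f(\xi)=\int e^{-ix\xi}f(x)\,dx$. $f(z)\prec g(z)$ on a set means $f\le c\,g$ there with a constant $c>0$ independent of $z$; $f\sim g$ means both $f\prec g$ and $g\prec f$. $\mathcal{E}[\mathbb{R}^n]$ is the algebra of all nets $(u_\epsilon)_{\epsilon\in(0,1]}$ with $u_\epsilon\in\mathcal{C}^\infty(\mathbb{R}^n)$. $\mathcal{E}_\tau(\mathbb{R}^n)$ is the set of $(u_\epsilon)_\epsilon\in\mathcal{E}[\mathbb{R}^n]$ such that for all $\alpha$ there is $N\in\mathbb{N}$ with $\sup_\epsilon\epsilon^N\|\langle x\rangle^{-N}\partial^\alpha u_\epsilon\|_{L^\infty}<\infty$; $\mathcal{N}_{\mathcal{S}}(\mathbb{R}^n)$ is the set of those such that for all $\alpha,\beta$, $q\in\mathbb{N}$, $\sup_\epsilon\epsilon^{-q}\|x^\alpha\partial^\beta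 u_\epsilon\|_{L^\infty}<\infty$; $\mathcal{G}_{\tau,\mathcal{S}}(\mathbb{R}^n)=\mathcal{E}_\tau(\mathbb{R}^n)/\mathcal{N}_{\mathcal{S}}(\mathbb{R}^n)$. Mollifier: $\varphi\in\mathcal{S}(\mathbb{R}^n)$ is fixed with $\int\varphi\,dx=1$ and $\int x^\alpha\varphi\,dx=0$ for all $\alpha\neq0$; $\varphi_\epsilon(x)=\epsilon^{-n}\varphi(x/\epsilon)$, so $\widehat{\varphi_\epsilon}(y)=\hat\varphi(\epsilon y)$. Embedding: $\imath(w)=(w\ast\varphi_\epsilon)_\epsilon+\mathcal{N}_{\mathcal{S}}(\mathbb{R}^n)$ for $w\in\mathcal{S}'(\mathbb{R}^n)$. Generalized numbers, integral, weak equality: $\overline{\mathbb{C}}=\mathcal{E}_{o,M}/\mathcal{N}_o$, where $\mathcal{E}_{o,M}$ consists of nets $(h_\epsilon)_\epsilon\in\mathbb{C}^{(0,1]}$ with $\sup_\epsilon\epsilon^N|h_\epsilon|<\infty$ for some $N\in\mathbb{N}$ and $\mathcal{N}_o$ of those with $\sup_\epsilon\epsilon^{-q}|h_\epsilon|<\infty$ for all $q\in\mathbb{N}$. For $u\in\mathcal{G}_{\tau,\mathcal{S}}(\mathbb{R}^n)$, $\int u(x)\,dx:=\big(\int u_\epsilon(x)\widehat{\varphi_\epsilon}(x)\,dx\big)_\epsilon+\mathcal{N}_o\in\overline{\mathbb{C}}$. $u=_{g.t.d.}v$ means $\int(u-v)(x)\imath(f)(x)\,dx=0$ in $\overline{\mathbb{C}}$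 for all $f\in\mathcal{S}(\mathbb{R}^n)$. Weight function: a continuous real function $\Lambda$ on $\mathbb{R}^{2n}$ such that (i) there is $\mu>0$ with $\langle z\rangle^\mu\prec\Lambda(z)\prec\langle z\rangle$; (ii) $\Lambda(z)\sim\Lambda(\zeta)$ on $\{|\zeta-z|\le\mu\Lambda(z)\}$; (iii) for all $t\in\mathbb{R}^{2n}$, $\Lambda(t_1z_1,\dots,t_{2n}z_{2n})\prec\Lambda(z)$. Classical amplitude: a function $a\in\mathcal{C}^\infty(\mathbb{R}^{3n})$ for which there are a weight function $\Lambda$, $m\in\mathbb{R}$, $\rho\in(0,1]$ and $m'\in\mathbb{R}$ such that for all $\alpha,\beta,\gamma\in\mathbb{N}^n$ there is $c>0$ with $|\partial_\xi^\alpha\partial_x^\beta\partial_y^\gamma a(x,y,\xi)|\le c\,\Lambda(x,\xi)^m\langle x-y\rangle^{m'}\big(1+\Lambda(x,\xi)\langle x-y\rangle^{-m'}\big)^{-\rho|\alpha+\beta+\gamma|}$ on $\mathbb{R}^{3n}$. Operators: on $\mathcal{G}_{\tau,\mathcal{S}}(\mathbb{R}^n)$, $A$ sends the class of $(u_\epsilon)_\epsilon$ to the class of $A_\epsilon u_\epsilon(x)=(2\pi)^{-n}\int e^{i(x-y)\xi}a(x,y,\xi)u_\epsilon(y)\widehat{\varphi_\epsilon}(y)\,dy\,d\xi$; this operator respects $=_{g.t.d.}$. On $\mathcal{S}'(\mathbb{R}^n)$ the classical operator is given by $\langle Aw,f\rangle=\langle w,{}^tAf\rangle$ for $f\in\mathcal{S}(\mathbb{R}^n)$,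 with ${}^tAf(y)=(2\pi)^{-n}\int e^{i(x-y)\xi}a(x,y,\xi)f(x)\,dx\,d\xi\in\mathcal{S}(\mathbb{R}^n)$. All integrals over $\mathbb{R}^{2n}$ are oscillatory: the limit as $h\to0^+$ after inserting a factor $\psi(h\,\cdot)$ in the integration variables, $\psi\in\mathcal{S}(\mathbb{R}^{2n})$, $\psi(0)=1$. *)

(* Defs.v *)
From HB Require Import structures.
From mathcomp Require Import all_boot all_order all_algebra.
From mathcomp Require Import complex.
From mathcomp Require Import all_classical all_reals all_analysis.

Set Implicit Arguments.
Unset Strict Implicit.
Unset Printing Implicit Defensive.

Import Order.TTheory GRing.Theory Num.Theory.
Import numFieldNormedType.Exports.

Local Open Scope classical_set_scope.
Local Open Scope complex_scope.
Local Open Scope ring_scope.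

(* The canonical norm of R[i] takes values in R[i], and that of 'rV[R]_n is the
   sup norm: [cabs] is the real-valued modulus, [enorm] the Euclidean norm. *)
Notation cabs := Normc.normc.

Definition expi (R : realType) (t : R) : R[i] := cos t +i* sin t.

Definition dot (R : realType) (n : nat) (x y : 'rV[R]_n) : R :=
  \sum_(i < n) x 0 i * y 0 i.

Definition enorm (R : realType) (n : nat) (x : 'rV[R]_n) : R :=
  Num.sqrt (dot x x).

Definition jbracket (R : realType) (n : nat) (x : 'rV[R]_n) : R :=
  Num.sqrt (1 + enorm x ^+ 2).

Definition pderiv (R : realType) (n : nat) (i : 'I_n) (f : 'rV[R]_n -> R[i])
    (x : 'rV[R]_n) : R[i] :=
  'D_(delta_mx 0 i) (fun y => complex.Re (f y)) x +i*
  'D_(delta_mx 0 i) (fun y => complex.Im (f y)) x.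

Definition pderivs (R : realType) (n : nat) (s : seq 'I_n)
    (f : 'rV[R]_n -> R[i]) : 'rV[R]_n -> R[i] :=
  foldr (@pderiv R n) f s.

(* C^oo: the iterated partial derivatives of all orders are Frechet
   differentiable at every point. *)
Definition smooth (R : realType) (n : nat) (f : 'rV[R]_n -> R[i]) : Prop :=
  forall (s : seq 'I_n) (x : 'rV[R]_n),
    differentiable (fun y => complex.Re (pderivs s f y)) x /\
    differentiable (fun y => complex.Im (pderivs s f y)) x.

(* Multi-indices are row vectors of natural numbers. *)
Definition mlength (n : nat) (alpha : 'rV[nat]_n) : nat :=
  (\sum_(i < n) alpha ord0 i)%N.

Definition mpow (R : realType) (n : nat) (x : 'rV[R]_n) (alpha : 'rV[nat]_n) :
  R := \prod_(i < n) x 0 i ^+ alpha 0 i.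

Definition mderiv (R : realType) (n : nat) (alpha : 'rV[nat]_n)
    (f : 'rV[R]_n -> R[i]) : 'rV[R]_n -> R[i] :=
  pderivs (flatten [seq nseq (alpha 0 i) i | i <- enum 'I_n]) f.

(* As a measure space R^n is the product R * (R * ( ... * unit)) with the
   n-fold product of Lebesgue measure; [rn_vec] identifies it with 'rV[R]_n. *)
Fixpoint rn_display (R : realType) (n : nat) : measure_display :=
  if n is n'.+1
  then measure_prod_display
         (sigma_display (R.-ocitv.-measurable), rn_display R n')
  else default_measure_display.

Fixpoint rn (R : realType) (n : nat) : measurableType (rn_display R n) :=
  match n with
  | 0 => unit : measurableType _
  | n'.+1 => (measurableTypeR R * rn R n')%type : measurableType _
  end.

(* A copy of the library's product measure: the canonical sigma-finite structure
   on [m1 \x m2] itself is the one for subprobabilities. *)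
Definition prod_measure d1 d2 (T1 : measurableType d1) (T2 : measurableType d2)
    (R : realType) (m1 : {sigma_finite_measure set T1 -> \bar R})
    (m2 : {sigma_finite_measure set T2 -> \bar R}) : set (T1 * T2) -> \bar R :=
  (m1 \x m2)%E.

Section ProdMeasure.
Context d1 d2 (T1 : measurableType d1) (T2 : measurableType d2) (R : realType).
Variables (m1 : {sigma_finite_measure set T1 -> \bar R})
  (m2 : {sigma_finite_measure set T2 -> \bar R}).

HB.instance Definition _ := Measure.copy (prod_measure m1 m2) (m1 \x m2)%E.

Lemma prod_measure_sigma_finite : sigma_finite setT (prod_measure m1 m2).
Proof.
have /sigma_finiteP[F [TF ndF Foo]] := sigma_finiteT m1.
have /sigma_finiteP[G [TG ndG Goo]] := sigma_finiteT m2.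
exists (fun n => F n `*` G n).
  rewrite -setXTT TF TG predeqE => -[x y]; split.
    move=> [/= [n _ Fnx] [k _ Gky]]; exists (maxn n k) => //; split.
    - by move: x Fnx; exact/subsetPset/ndF/leq_maxl.
    - by move: y Gky; exact/subsetPset/ndG/leq_maxr.
  by move=> [n _ []/= ? ?]; split; exists n.
move=> k; have [? ?] := Foo k; have [? ?] := Goo k.
split; first exact: measurableX.
by rewrite /prod_measure product_measure1E// lte_mul_pinfty// ge0_fin_numE.
Qed.

HB.instance Definition _ :=
  Measure_isSigmaFinite.Build _ _ _ (prod_measure m1 m2)
    prod_measure_sigma_finite.
End ProdMeasure.

Fixpoint rn_lebesgue (R : realType) (n : nat) :
    {sigma_finite_measure set (rn R n) -> \bar R} :=
  match n return {sigma_finite_measure set (rn R n) -> \bar R} with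
  | 0 => dirac tt : {sigma_finite_measure set unit -> \bar R}
  | n'.+1 => prod_measure (@lebesgue_measure R) (rn_lebesgue R n')
  end.

Fixpoint rn_vec (R : realType) (n : nat) : rn R n -> 'rV[R]_n :=
  match n return rn R n -> 'rV[R]_n with
  | 0 => fun=> 0
  | n'.+1 => fun p => row_mx (p.1 : R)%:M (rn_vec p.2) : 'rV[R]_(1 + n')
  end.

Definition rintegral (R : realType) (n : nat) (f : 'rV[R]_n -> R) : R :=
  Rintegral (rn_lebesgue R n) setT (fun p => f (rn_vec p)).

Definition cintegral (R : realType) (n : nat) (f : 'rV[R]_n -> R[i]) : R[i] :=
  rintegral (fun x => complex.Re (f x)) +i*
  rintegral (fun x => complex.Im (f x)).

Definition fourier (R : realType) (n : nat) (f : 'rV[R]_n -> R[i])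
    (xi : 'rV[R]_n) : R[i] :=
  cintegral (fun x => expi (- dot x xi) * f x).

Definition schwartz (R : realType) (n : nat) (f : 'rV[R]_n -> R[i]) : Prop :=
  smooth f /\
  forall alpha beta : 'rV[nat]_n,
    exists C : R, forall x, `|mpow x alpha| * cabs (mderiv beta f x) <= C.

(* An element of S'(R^n) is a functional of which only the values on Schwartz
   functions matter; on these it is linear and bounded by finitely many of the
   seminorms sup_x |x^alpha d^beta f(x)| (here M bounds the seminorms of order
   at most N, so the estimate reads |w(f)| <= C * max of these seminorms). *)
Definition tempered (R : realType) (n : nat)
    (w : ('rV[R]_n -> R[i]) -> R[i]) : Prop :=
  (forall (c : R[i]) f g, schwartz f -> schwartz g ->
     w (fun x => c * f x + g x) = c * w f + w g) /\
  exists (N : nat) (C : R), forall f (M : R), schwartz f ->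
    (forall alpha beta : 'rV[nat]_n,
       (mlength alpha <= N)%N -> (mlength beta <= N)%N ->
       forall x, `|mpow x alpha| * cabs (mderiv beta f x) <= M) ->
    cabs (w f) <= C * M.

Definition distr_of (R : realType) (n : nat) (f : 'rV[R]_n -> R[i]) :
  ('rV[R]_n -> R[i]) -> R[i] := fun g => cintegral (fun x => f x * g x).

Definition eps_index (R : realType) := {e : R | 0 < e <= 1}.

Definition net (R : realType) (n : nat) :=
  eps_index R -> 'rV[R]_n -> R[i].

Definition E_tau (R : realType) (n : nat) : set (net R n) :=
  [set u | (forall e, smooth (u e)) /\
    forall alpha : 'rV[nat]_n, exists (N : nat) (C : R), forall e x,
      val e ^+ N * (jbracket x ^- N * cabs (mderiv alpha (u e) x)) <= C].

Definition N_S (R : realType) (n : nat) : set (net R n) :=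
  [set u | (forall e, smooth (u e)) /\
    forall (alpha beta : 'rV[nat]_n) (q : nat), exists C : R, forall e x,
      val e ^- q * (`|mpow x alpha| * cabs (mderiv beta (u e) x)) <= C].

Definition E_oM (R : realType) : set (eps_index R -> R[i]) :=
  [set h | exists (N : nat) (C : R), forall e, val e ^+ N * cabs (h e) <= C].

Definition N_o (R : realType) : set (eps_index R -> R[i]) :=
  [set h | forall q : nat, exists C : R,
     forall e, val e ^- q * cabs (h e) <= C].

(* The elements of a quotient M / N are its cosets, as subsets of M. For u
   outside M (and N contained in M) the set [coset M N u] is empty. *)
Definition coset (V : zmodType) (M N : set V) (u : V) : set V :=
  [set v | M v /\ N (v - u)].

(* The operations induced on cosets by operations on representatives: the
   union of the cosets of op u for u in U (of op u v for u in U and v in V),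
   which is a single coset when the operation is well defined. *)
Definition lift1 (V W : zmodType) (M N : set W) (op : V -> W) (U : set V) :
    set W :=
  [set w | exists2 u, U u & coset M N (op u) w].

Definition lift2 (V1 V2 W : zmodType) (M N : set W) (op : V1 -> V2 -> W)
    (U1 : set V1) (U2 : set V2) : set W :=
  [set w | exists u1 u2, [/\ U1 u1, U2 u2 & coset M N (op u1 u2) w]].

Definition gclass (R : realType) (n : nat) (u : net R n) : set (net R n) :=
  coset (@E_tau R n) (@N_S R n) u.

Definition gsub (R : realType) (n : nat) : set (net R n) -> set (net R n) ->
    set (net R n) :=
  lift2 (@E_tau R n) (@N_S R n) (fun u v e x => u e x - v e x).

Definition gmul (R : realType) (n : nat) : set (net R n) -> set (net R n) ->
    set (net R n) :=
  lift2 (@E_tau R n) (@N_S R n) (fun u v e x => u e x * v e x).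

Definition gnum0 (R : realType) : set (eps_index R -> R[i]) :=
  coset (@E_oM R) (@N_o R) (fun=> 0).

Definition mollifier (R : realType) (n : nat) (phi : 'rV[R]_n -> R[i]) : Prop :=
  [/\ schwartz phi, cintegral phi = 1
    & forall alpha : 'rV[nat]_n, alpha != 0 ->
        cintegral (fun x => (mpow x alpha)%:C * phi x) = 0].

Definition moll (R : realType) (n : nat) (phi : 'rV[R]_n -> R[i]) (e : R)
    (x : 'rV[R]_n) : R[i] :=
  (e ^- n)%:C * phi (e^-1 *: x).

Definition embed (R : realType) (n : nat) (phi : 'rV[R]_n -> R[i])
    (w : ('rV[R]_n -> R[i]) -> R[i]) : set (net R n) :=
  gclass (fun e x => w (fun y => moll phi (val e) (x - y))).

Definition gintegral (R : realType) (n : nat) (phi : 'rV[R]_n -> R[i]) :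
    set (net R n) -> set (eps_index R -> R[i]) :=
  lift1 (@E_oM R) (@N_o R)
    (fun (u : net R n) e =>
       cintegral (fun x => u e x * fourier (moll phi (val e)) x)).

Definition gtd_eq (R : realType) (n : nat) (phi : 'rV[R]_n -> R[i])
    (U V : set (net R n)) : Prop :=
  forall f : 'rV[R]_n -> R[i], schwartz f ->
    gintegral phi (gmul (gsub U V) (embed phi (distr_of f))) = @gnum0 R.

Definition prec_on (R : realType) (T : Type) (A : set T) (f g : T -> R) :
    Prop :=
  exists2 c : R, 0 < c & forall z, A z -> f z <= c * g z.

Definition sim_on (R : realType) (T : Type) (A : set T) (f g : T -> R) :
    Prop :=
  prec_on A f g /\ prec_on A g f.

Definition weight (R : realType) (k : nat) (Lambda : 'rV[R]_k -> R) : Prop :=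
  [/\ continuous Lambda,
      exists2 mu : R, 0 < mu &
        [/\ prec_on setT (fun z => jbracket z `^ mu) Lambda,
            prec_on setT Lambda (@jbracket R k)
          & sim_on [set p : 'rV[R]_k * 'rV[R]_k |
                      enorm (p.2 - p.1) <= mu * Lambda p.1]
              (fun p => Lambda p.1) (fun p => Lambda p.2)]
    & forall t : 'rV[R]_k,
        prec_on setT
          (fun z : 'rV[R]_k => Lambda (\row_i (t 0 i * z 0 i))) Lambda].

(* A function on R^{3n} is applied to the concatenation of x, y and xi; in
   the same way the derivative of order alpha in xi, beta in x and gamma in y
   has the concatenation of beta, gamma and alpha as its multi-index. *)
Definition cat3 (T : Type) (n : nat) (x y xi : 'rV[T]_n) : 'rV[T]_(n + n + n) :=
  row_mx (row_mx x y) xi.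

Definition classical_amplitude (R : realType) (n : nat)
    (a : 'rV[R]_(n + n + n) -> R[i]) : Prop :=
  smooth a /\
  exists (Lambda : 'rV[R]_(n + n) -> R) (m rho m' : R),
    [/\ weight Lambda, 0 < rho <= 1 &
      forall alpha beta gamma : 'rV[nat]_n, exists2 c : R, 0 < c &
        forall x y xi : 'rV[R]_n,
          cabs (mderiv (cat3 beta gamma alpha) a (cat3 x y xi)) <=
          c * Lambda (row_mx x xi) `^ m * jbracket (x - y) `^ m' *
          (1 + Lambda (row_mx x xi) * jbracket (x - y) `^ (- m'))
            `^ (- (rho * (mlength alpha + mlength beta + mlength gamma)%:R))].

Definition ccvg_at0r (R : realType) (F : R -> R[i]) (l : R[i]) : Prop :=
  (fun h => complex.Re (F h)) @ 0^'+ --> complex.Re l /\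
  (fun h => complex.Im (F h)) @ 0^'+ --> complex.Im l.

Definition is_oscillatory (R : realType) (k : nat) (F : 'rV[R]_k -> R[i])
    (l : R[i]) : Prop :=
  forall psi : 'rV[R]_k -> R[i], schwartz psi -> psi 0 = 1 ->
    ccvg_at0r (fun h => cintegral (fun z => F z * psi (h *: z))) l.

Definition oscillatory (R : realType) (k : nat) (F : 'rV[R]_k -> R[i]) : R[i] :=
  xget 0 [set l | is_oscillatory F l].

(* A_epsilon u_epsilon (x); the integration variable is z = (y, xi). *)
Definition psido_net (R : realType) (n : nat) (phi : 'rV[R]_n -> R[i])
    (a : 'rV[R]_(n + n + n) -> R[i]) (u : net R n) : net R n :=
  fun e x =>
    ((2 * pi) ^- n)%:C *
    oscillatory (fun z : 'rV[R]_(n + n) =>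
      let y := lsubmx z in
      let xi := rsubmx z in
      expi (dot (x - y) xi) * a (cat3 x y xi) * u e y *
      fourier (moll phi (val e)) y).

Definition psido_gen (R : realType) (n : nat) (phi : 'rV[R]_n -> R[i])
    (a : 'rV[R]_(n + n + n) -> R[i]) : set (net R n) -> set (net R n) :=
  lift1 (@E_tau R n) (@N_S R n) (psido_net phi a).

(* The transposed operator; the integration variable is z = (x, xi). *)
Definition psido_transpose (R : realType) (n : nat)
    (a : 'rV[R]_(n + n + n) -> R[i]) (f : 'rV[R]_n -> R[i]) :
    'rV[R]_n -> R[i] :=
  fun y =>
    ((2 * pi) ^- n)%:C *
    oscillatory (fun z : 'rV[R]_(n + n) =>
      let x := lsubmx z in
      let xi := rsubmx z in
      expi (dot (x - y) xi) * a (cat3 x y xi) * f x).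

Definition psido_distr (R : realType) (n : nat)
    (a : 'rV[R]_(n + n + n) -> R[i]) (w : ('rV[R]_n -> R[i]) -> R[i]) :
    ('rV[R]_n -> R[i]) -> R[i] :=
  fun f => w (psido_transpose a f).

(* Main.v *)
(* Let f be in S and g_eps = (f * phi_eps) phihat(eps .), bounded in S. By Fubini,
   the pairing of A_eps u_eps with g_eps equals the pairing of
   u_eps phihat(eps .) with tA g_eps, where tA maps bounded families in S to
   bounded families. If u_eps = w * phi_eps, then for every family k_eps bounded
   in S the pairing of w * phi_eps with k_eps is w applied to the average
   int phi(z) k_eps(. + eps z) dz, and this average differs from k_eps by
   O(eps^q) in S for every q because the higher moments of phi vanish; for the
   same reason (phihat(eps .) - 1) k_eps = O(eps^q). Hence, up to negligible
   terms, the pairings of A_eps (w * phi_eps) and of (Aw) * phi_eps with g_eps are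
   w(tA g_eps) and (Aw)(g_eps), which coincide by definition.
   Integrating by parts in the variable of the Schwartz function makes the inner
   integral of an oscillatory integral decay in xi, so that oscillatory integrals
   are absolutely convergent iterated integrals; only polynomial bounds on the
   derivatives of the amplitude are used. *)

From HB Require Import structures.
Require Import Defs.
From mathcomp Require Import all_boot all_order all_algebra.
From mathcomp Require Import complex ring lra zify.
From mathcomp Require Import all_classical all_reals all_analysis.
From mathcomp Require Import measurable_realfun.

Set Implicit Arguments.
Unset Strict Implicit.
Unset Printing Implicit Defensive.

Import Order.TTheory GRing.Theory Num.Theory.
Import numFieldNormedType.Exports.

Local Open Scope classical_set_scope.
Local Open Scope complex_scope.
Local Open Scope ring_scope.

(** * Modulus and Japanese bracket *)

(** Equality of generalized numbers is equality of cosets, so the estimates must hold for an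
    arbitrary representative [u] of the embedded [w], uniformly in epsilon. [gauge] and [symb] carry
    this uniformity: one natural number is both the constant of an estimate and the order of its
    dependence on epsilon, so that bounded, moderate and negligible families pass through the same
    lemmas. The same device gives the continuity of the transposed operator, with Schwartz functions
    as parameters, and the convergence of oscillatory integrals, with the cut-off scale as
    parameter. Limits are replaced by estimates with a rate: differentiation under an integral or
    under [w] is a quadratic Taylor remainder, and [w] is exchanged with an integral through Riemann
    sums whose error is O(1/p) in every seminorm. Integrations by parts must not raise the growth
    order [M] of the amplitude: multiplication by xi becomes a derivative in q, and multiplication
    by p becomes q plus a derivative in xi. Both keep [M], so that decay of arbitrary order beats a
    fixed growth. *)

Section Modulus.
Variable R : realType.
Implicit Types (x y : R[i]) (r : R).

Lemma cabs_ge0 x : 0 <= cabs x.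
Proof. by case: x => a b; exact: sqrtr_ge0. Qed.

Lemma cabsD x y : cabs (x + y) <= cabs x + cabs y.
Proof. exact: le_normcD. Qed.

Lemma cabsM x y : cabs (x * y) = cabs x * cabs y.
Proof. exact: Normc.normcM. Qed.

Lemma cabsN x : cabs (- x) = cabs x.
Proof. exact: normcN. Qed.

Lemma cabsB x y : cabs (x - y) <= cabs x + cabs y.
Proof. by rewrite -(cabsN y); exact: cabsD. Qed.

Lemma cabs0 : cabs (0 : R[i]) = 0.
Proof. exact: Normc.normc0. Qed.

Lemma cabs1 : cabs (1 : R[i]) = 1.
Proof. exact: Normc.normc1. Qed.

Lemma cabsR r : cabs r%:C = `|r|.
Proof. by rewrite /= expr0n /= addr0 sqrtr_sqr. Qed.

Lemma cabsi : cabs ('i : R[i]) = 1.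
Proof. by rewrite /= expr0n /= add0r expr1n sqrtr1. Qed.

Lemma cabs_expi r : cabs (expi r) = 1.
Proof. by rewrite /= cos2Dsin2 sqrtr1. Qed.

Lemma le_Re_cabs x : `|complex.Re x| <= cabs x.
Proof.
case: x => a b /=; rewrite -sqrtr_sqr ler_wsqrtr// lerDl sqr_ge0//.
Qed.

Lemma le_Im_cabs x : `|complex.Im x| <= cabs x.
Proof.
case: x => a b /=; rewrite -sqrtr_sqr ler_wsqrtr// lerDr sqr_ge0//.
Qed.

Lemma cabs_le_ReIm x : cabs x <= `|complex.Re x| + `|complex.Im x|.
Proof.
case: x => a b /=; rewrite -[leRHS]ger0_norm ?addr_ge0//.
rewrite -sqrtr_sqr ler_wsqrtr// sqrrD !real_normK ?num_real//.
by rewrite -addrA [_ *+ 2 + _]addrC addrA lerDl mulrn_wge0// mulr_ge0.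
Qed.

Lemma cabs_sum (I : Type) (r : seq I) (P : pred I) (F : I -> R[i]) :
  cabs (\sum_(i <- r | P i) F i) <= \sum_(i <- r | P i) cabs (F i).
Proof.
elim/big_rec2: _ => [|i y x _ h]; first by rewrite cabs0.
by apply: le_trans (cabsD _ _) _; rewrite lerD2l.
Qed.

Lemma cReD x y : complex.Re (x + y) = complex.Re x + complex.Re y.
Proof. by case: x; case: y. Qed.
Lemma cImD x y : complex.Im (x + y) = complex.Im x + complex.Im y.
Proof. by case: x; case: y. Qed.
Lemma cReM x y : complex.Re (x * y) =
  complex.Re x * complex.Re y - complex.Im x * complex.Im y.
Proof. by case: x; case: y. Qed.
Lemma cImM x y : complex.Im (x * y) =
  complex.Re x * complex.Im y + complex.Im x * complex.Re y.
Proof. by case: x; case: y. Qed.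
Lemma cReN x : complex.Re (- x) = - complex.Re x.
Proof. by case: x. Qed.
Lemma cImN x : complex.Im (- x) = - complex.Im x.
Proof. by case: x. Qed.
Lemma cRe_sum (I : Type) (r : seq I) (P : pred I) (F : I -> R[i]) :
  complex.Re (\sum_(i <- r | P i) F i) = \sum_(i <- r | P i) complex.Re (F i).
Proof. by elim/big_rec2: _ => // i y x _ <-; rewrite cReD. Qed.
Lemma cIm_sum (I : Type) (r : seq I) (P : pred I) (F : I -> R[i]) :
  complex.Im (\sum_(i <- r | P i) F i) = \sum_(i <- r | P i) complex.Im (F i).
Proof. by elim/big_rec2: _ => // i y x _ <-; rewrite cImD. Qed.
Lemma RCM (r s : R) : (r * s)%:C = r%:C * s%:C :> R[i].
Proof. by rewrite rmorphM. Qed.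
Lemma ceq x y : complex.Re x = complex.Re y -> complex.Im x = complex.Im y ->
  x = y.
Proof. by case: x => a b; case: y => c d /= -> ->. Qed.

Lemma expi0 : expi (0 : R) = 1.
Proof. by rewrite /expi cos0 sin0. Qed.
End Modulus.

Section Bracket.
Variable R : realType.

Lemma eq_ler (x y : R) : x = y -> x <= y.
Proof. by move=> ->. Qed.

Lemma dotE n (x : 'rV[R]_n) : dot x x = \sum_i x 0 i ^+ 2.
Proof. by apply: eq_bigr => i _; rewrite expr2. Qed.

Lemma dot_ge0 n (x : 'rV[R]_n) : 0 <= dot x x.
Proof. by rewrite dotE; apply: sumr_ge0 => i _; exact: sqr_ge0. Qed.

Lemma jb_sqr n (x : 'rV[R]_n) : jbracket x ^+ 2 = 1 + dot x x.
Proof.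
by rewrite sqr_sqrtr /enorm sqr_sqrtr ?dot_ge0// addr_ge0 ?dot_ge0.
Qed.

Lemma jb_ge1 n (x : 'rV[R]_n) : 1 <= jbracket x.
Proof.
rewrite -sqrtr1 /jbracket ler_wsqrtr// lerDl sqr_ge0//.
Qed.

Lemma jb_gt0 n (x : 'rV[R]_n) : 0 < jbracket x.
Proof. exact: lt_le_trans (jb_ge1 x). Qed.

Lemma jb_ge0 n (x : 'rV[R]_n) : 0 <= jbracket x.
Proof. exact/ltW/jb_gt0. Qed.

Lemma jbX_gt0 n (x : 'rV[R]_n) k : 0 < jbracket x ^+ k.
Proof. by rewrite exprn_gt0// jb_gt0. Qed.

Lemma jbVX_gt0 n (x : 'rV[R]_n) k : 0 < jbracket x ^- k.
Proof. by rewrite invr_gt0 jbX_gt0. Qed.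

Lemma jbX_ge0 n (x : 'rV[R]_n) k : 0 <= jbracket x ^+ k.
Proof. exact/ltW/jbX_gt0. Qed.

Lemma jbVX_ge0 n (x : 'rV[R]_n) k : 0 <= jbracket x ^- k.
Proof. exact/ltW/jbVX_gt0. Qed.

Lemma jbX_ge1 n (x : 'rV[R]_n) k : 1 <= jbracket x ^+ k.
Proof. by rewrite exprn_ege1// jb_ge1. Qed.

Lemma jbX_le n (x : 'rV[R]_n) k l : (k <= l)%N ->
  jbracket x ^+ k <= jbracket x ^+ l.
Proof. by move=> kl; rewrite ler_weXn2l// jb_ge1. Qed.

Lemma jbVX_le n (x : 'rV[R]_n) k l : (k <= l)%N ->
  jbracket x ^- l <= jbracket x ^- k.
Proof. by move=> kl; rewrite lef_pV2 ?posrE ?jbX_gt0// jbX_le. Qed.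

Lemma jbVX_le1 n (x : 'rV[R]_n) k : jbracket x ^- k <= 1.
Proof. by rewrite invf_le1 ?jbX_gt0// jbX_ge1. Qed.

Lemma jb_le n m (x : 'rV[R]_n) (y : 'rV[R]_m) :
  (jbracket x <= jbracket y) = (dot x x <= dot y y).
Proof.
by rewrite -(@ler_pXn2r _ 2) ?nnegrE ?jb_ge0// !jb_sqr lerD2l.
Qed.

Lemma jb_le_sqr n (x : 'rV[R]_n) (a : R) : 0 <= a ->
  1 + dot x x <= a ^+ 2 -> jbracket x <= a.
Proof. by move=> a0; rewrite -jb_sqr ler_pXn2r// nnegrE ?jb_ge0. Qed.

Lemma coord_jb n (x : 'rV[R]_n) i : `|x 0 i| <= jbracket x.
Proof.
rewrite -(@ler_pXn2r _ 2) ?nnegrE ?jb_ge0// jb_sqr real_normK ?num_real//.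
rewrite dotE (bigD1 i)//= addrCA lerDl addr_ge0// sumr_ge0// => j _.
exact: sqr_ge0.
Qed.

Lemma jb_le_sum n (x : 'rV[R]_n) : jbracket x <= 1 + \sum_i `|x 0 i|.
Proof.
have s0 : 0 <= \sum_i `|x 0 i| by apply: sumr_ge0.
apply: jb_le_sqr; first by rewrite addr_ge0.
suff : dot x x <= (\sum_i `|x 0 i|) ^+ 2 by move: s0; nra.
rewrite dotE expr2 mulr_suml; apply: ler_sum => i _.
rewrite -real_normK ?num_real// expr2 ler_wpM2l//.
by rewrite (bigD1 i)//= lerDl sumr_ge0.
Qed.

Lemma jbN n (x : 'rV[R]_n) : jbracket (- x) = jbracket x.
Proof.
rewrite /jbracket /enorm; congr (Num.sqrt (1 + Num.sqrt _ ^+ 2)).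
by rewrite !dotE; apply: eq_bigr => i _; rewrite mxE sqrrN.
Qed.

Lemma jbD n (x y : 'rV[R]_n) :
  jbracket (x + y) <= 2 * jbracket x * jbracket y.
Proof.
apply: jb_le_sqr; first by rewrite !mulr_ge0 ?jb_ge0.
rewrite !exprMn !jb_sqr.
have : dot (x + y) (x + y) <= 2 * dot x x + 2 * dot y y.
  rewrite !dotE !mulr_sumr -big_split/=; apply: ler_sum => i _.
  by rewrite mxE; have := sqr_ge0 (x 0 i - y 0 i); nra.
have := dot_ge0 x; have := dot_ge0 y; nra.
Qed.

Lemma jbZ n (t : R) (x : 'rV[R]_n) : `|t| <= 1 -> jbracket (t *: x) <= jbracket x.
Proof.
move=> t1; rewrite jb_le !dotE; apply: ler_sum => i _.
rewrite mxE exprMn ler_piMl ?sqr_ge0//.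
by rewrite -real_normK ?num_real// expr_le1.
Qed.

Lemma dot_row_mx n m (x x' : 'rV[R]_n) (y y' : 'rV[R]_m) :
  dot (row_mx x y) (row_mx x' y') = dot x x' + dot y y'.
Proof.
rewrite /dot big_split_ord /=; congr (_ + _); apply: eq_bigr => i _.
  by rewrite !row_mxEl.
by rewrite !row_mxEr.
Qed.

Lemma jb_row n m (x : 'rV[R]_n) (y : 'rV[R]_m) :
  jbracket (row_mx x y) <= jbracket x * jbracket y.
Proof.
apply: jb_le_sqr; first by rewrite mulr_ge0 ?jb_ge0.
rewrite exprMn !jb_sqr dot_row_mx; have := dot_ge0 x; have := dot_ge0 y; nra.
Qed.

Lemma jb_rowl n m (x : 'rV[R]_n) (y : 'rV[R]_m) :
  jbracket x <= jbracket (row_mx x y).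
Proof. by rewrite jb_le dot_row_mx lerDl dot_ge0. Qed.

Lemma jb_rowr n m (x : 'rV[R]_n) (y : 'rV[R]_m) :
  jbracket y <= jbracket (row_mx x y).
Proof. by rewrite jb_le dot_row_mx lerDr dot_ge0. Qed.

(** Peetre's inequality for negative powers: apply [jbD] to x = (x + y) - y. It prices the
    translations of weights below. *)
Lemma jbVX_shift n (x y : 'rV[R]_n) k :
  jbracket (x + y) ^- k <= 2 ^+ k * jbracket y ^+ k * jbracket x ^- k.
Proof.
rewrite -exprMn ler_pdivlMr ?jbX_gt0// ler_pdivrMl ?jbX_gt0// -exprMn.
apply: lerXn2r; rewrite ?nnegrE ?mulr_ge0 ?jb_ge0//.
rewrite mulrA [jbracket (x + y) * 2]mulrC -(jbN y).
by have := jbD (x + y) (- y); rewrite addrK.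
Qed.

Definition l1 n (x : 'rV[R]_n) : R := \sum_i `|x 0 i|.

Lemma l1_ge0 n (x : 'rV[R]_n) : 0 <= l1 x.
Proof. exact: sumr_ge0. Qed.

Lemma l1_jb n (x : 'rV[R]_n) : l1 x <= n%:R * jbracket x.
Proof.
apply: (@le_trans _ _ (\sum_(i < n) jbracket x)).
  by apply: ler_sum => i _; exact: coord_jb.
by rewrite sumr_const card_ord mulr_natl.
Qed.

Lemma coord_norm n (x : 'rV[R]_n) i : `|x 0 i| <= `|x|.
Proof.
have -> : `|x| = mx_norm x by [].
rewrite mx_normrE.
exact: (@le_bigmax _ _ _ 0 (fun ij : 'I_1 * 'I_n => `|x ij.1 ij.2|) (0, i)).
Qed.

Lemma l1_norm n (x : 'rV[R]_n) : l1 x <= n%:R * `|x|.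
Proof.
apply: (@le_trans _ _ (\sum_(i < n) `|x|)).
  by apply: ler_sum => i _; exact: coord_norm.
by rewrite sumr_const card_ord mulr_natl.
Qed.

Lemma l1Z n (t : R) (x : 'rV[R]_n) : l1 (t *: x) = `|t| * l1 x.
Proof. by rewrite /l1 mulr_sumr; apply: eq_bigr => i _; rewrite mxE normrM. Qed.

Lemma jb_l1 n (x : 'rV[R]_n) : jbracket x <= 1 + l1 x.
Proof. exact: jb_le_sum. Qed.

End Bracket.

(** * Derivatives of complex-valued functions *)

Section ComplexDeriv.
Variable R : realType.
Implicit Types V : normedModType R.

Definition cdiff V (f : V -> R[i]) (x : V) : Prop :=
  differentiable (fun y => complex.Re (f y)) x /\
  differentiable (fun y => complex.Im (f y)) x.

Definition cD V (v : V) (f : V -> R[i]) (x : V) : R[i] :=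
  'D_v (fun y => complex.Re (f y)) x +i* 'D_v (fun y => complex.Im (f y)) x.

Lemma cdiff_cst V (c : R[i]) (x : V) : cdiff (fun=> c) x.
Proof. by split; exact: differentiable_cst. Qed.

Lemma cdiffD V (f g : V -> R[i]) x :
  cdiff f x -> cdiff g x -> cdiff (fun y => f y + g y) x.
Proof.
move=> [f1 f2] [g1 g2]; split.
- under eq_fun do rewrite cReD; exact: differentiableD.
- under eq_fun do rewrite cImD; exact: differentiableD.
Qed.

Lemma cdiffM V (f g : V -> R[i]) x :
  cdiff f x -> cdiff g x -> cdiff (fun y => f y * g y) x.
Proof.
move=> [f1 f2] [g1 g2]; split.
- under eq_fun do rewrite cReM.
  by apply: differentiableB; exact: differentiableM.
- under eq_fun do rewrite cImM.
  by apply: differentiableD; exact: differentiableM.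
Qed.

Lemma cdiff_sum V (I : Type) (r : seq I) (F : I -> V -> R[i]) x :
  (forall i, cdiff (F i) x) -> cdiff (fun y => \sum_(i <- r) F i y) x.
Proof.
move=> h; elim: r => [|i r ih].
  by under eq_fun do rewrite big_nil; exact: cdiff_cst.
by under eq_fun do rewrite big_cons; apply: cdiffD.
Qed.

Lemma cD_cst V (c : R[i]) (v x : V) : cD v (fun=> c) x = 0.
Proof. by apply: ceq; rewrite /cD /= derive_cst. Qed.

Lemma cDD V v (f g : V -> R[i]) x : cdiff f x -> cdiff g x ->
  cD v (fun y => f y + g y) x = cD v f x + cD v g x.
Proof.
move=> [f1 f2] [g1 g2]; apply: ceq => /=.
- under eq_fun do rewrite cReD; apply: deriveD; exact: diff_derivable.
- under eq_fun do rewrite cImD; apply: deriveD; exact: diff_derivable.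
Qed.

Lemma cDM V v (f g : V -> R[i]) x : cdiff f x -> cdiff g x ->
  cD v (fun y => f y * g y) x = cD v f x * g x + f x * cD v g x.
Proof.
move=> [f1 f2] [g1 g2]; apply: ceq.
- rewrite /cD /= [RHS]cReD !cReM /=; under eq_fun do rewrite cReM.
  rewrite (@deriveB _ _ _ (fun y => complex.Re (f y) * complex.Re (g y))
    (fun y => complex.Im (f y) * complex.Im (g y)));
    try by apply: derivableM; exact: diff_derivable.
  rewrite !deriveM; try exact: diff_derivable.
  rewrite /GRing.scale /=.
  move: ('D_v (fun y => complex.Re (f y)) x) ('D_v (fun y => complex.Im (f y)) x)
    ('D_v (fun y => complex.Re (g y)) x) ('D_v (fun y => complex.Im (g y)) x).
  by move: (complex.Re (f x)) (complex.Im (f x)) (complex.Re (g x))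
    (complex.Im (g x)) => *; ring.
- rewrite /cD /= [RHS]cImD !cImM /=; under eq_fun do rewrite cImM.
  rewrite (@deriveD _ _ _ (fun y => complex.Re (f y) * complex.Im (g y))
    (fun y => complex.Im (f y) * complex.Re (g y)));
    try by apply: derivableM; exact: diff_derivable.
  rewrite !deriveM; try exact: diff_derivable.
  rewrite /GRing.scale /=.
  move: ('D_v (fun y => complex.Re (f y)) x) ('D_v (fun y => complex.Im (f y)) x)
    ('D_v (fun y => complex.Re (g y)) x) ('D_v (fun y => complex.Im (g y)) x).
  by move: (complex.Re (f x)) (complex.Im (f x)) (complex.Re (g x))
    (complex.Im (g x)) => *; ring.
Qed.

Lemma cD_sum V v (I : Type) (r : seq I) (F : I -> V -> R[i]) x :
  (forall i, cdiff (F i) x) ->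
  cD v (fun y => \sum_(i <- r) F i y) x = \sum_(i <- r) cD v (F i) x.
Proof.
move=> h; elim: r => [|i r ih].
  by under eq_fun do rewrite big_nil; rewrite cD_cst big_nil.
under eq_fun do rewrite big_cons.
by rewrite cDD ?big_cons ?ih//; exact: cdiff_sum.
Qed.

Lemma cDZ V v (c : R[i]) (f : V -> R[i]) x : cdiff f x ->
  cD v (fun y => c * f y) x = c * cD v f x.
Proof.
by move=> h; rewrite (cDM _ (cdiff_cst c x) h) cD_cst mul0r add0r.
Qed.

Lemma cdiff_continuous_Re V (f : V -> R[i]) : (forall x, cdiff f x) ->
  continuous (fun y => complex.Re (f y)).
Proof. by move=> h x; apply: differentiable_continuous; case: (h x). Qed.

Lemma cdiff_continuous_Im V (f : V -> R[i]) : (forall x, cdiff f x) ->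
  continuous (fun y => complex.Im (f y)).
Proof. by move=> h x; apply: differentiable_continuous; case: (h x). Qed.

(** The difference quotients agree before any limit is taken, so the equality holds even where the
    derivatives do not exist. *)
Lemma derive_transport V (W : normedModType R) (f : V -> R) (g : W -> R)
    (v x : V) (w y : W) :
  (forall t : R, f (t *: v + x) - f x = g (t *: w + y) - g y) ->
  'D_v f x = 'D_w g y.
Proof.
move=> h; rewrite /derive; set F := (fun _ => _); set G := (fun _ => _).
by have -> : F = G by apply/funext => t; rewrite /F /G /= h.
Qed.

Lemma derivable_transport V (W : normedModType R) (f : V -> R) (g : W -> R)
    (v x : V) (w y : W) :
  (forall t : R, f (t *: v + x) - f x = g (t *: w + y) - g y) ->
  derivable g y w -> derivable f x v.
Proof.
move=> h; rewrite /derivable; set F := (fun _ => _); set G := (fun _ => _).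
by have -> : F = G by apply/funext => t; rewrite /F /G /= h.
Qed.

Lemma cD_dir V (W : normedModType R) (L : V -> W) (v : V) (w : W) (f : W -> R[i])
    (x : V) :
  (forall t : R, L (t *: v + x) = t *: w + L x) ->
  cD v (fun y => f (L y)) x = cD w f (L x).
Proof.
by move=> hL; apply: ceq; apply: derive_transport => t /=; rewrite hL.
Qed.

Lemma cdiff_comp V (W : normedModType R) (L : V -> W) (f : W -> R[i]) (x : V) :
  differentiable L x -> cdiff f (L x) -> cdiff (fun y => f (L y)) x.
Proof. move=> hL [f1 f2]; split.
  exact: (@differentiable_comp _ _ _ _ L (fun y => complex.Re (f y)) x hL f1).
exact: (@differentiable_comp _ _ _ _ L (fun y => complex.Im (f y)) x hL f2). Qed.

Lemma derive_coord n (h : 'rV[R]_n) (f : 'rV[R]_n -> R) x :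
  differentiable f x ->
  'D_h f x = \sum_i h 0 i * 'D_(delta_mx 0 i) f x.
Proof.
move=> hf; rewrite {1}(row_sum_delta h) deriveE// linear_sum.
by apply: eq_bigr => i _; rewrite linearZ deriveE.
Qed.

Lemma cRe_real (c : R) (z : R[i]) : complex.Re (c%:C * z) = c * complex.Re z.
Proof. by rewrite cReM /= mul0r subr0. Qed.

Lemma cIm_real (c : R) (z : R[i]) : complex.Im (c%:C * z) = c * complex.Im z.
Proof. by rewrite cImM /= mul0r addr0. Qed.

Lemma cD_coord n (h : 'rV[R]_n) (f : 'rV[R]_n -> R[i]) x : cdiff f x ->
  cD h f x = \sum_i (h 0 i)%:C * pderiv i f x.
Proof.
move=> [f1 f2]; apply: ceq.
- rewrite cRe_sum; apply: (etrans (derive_coord h f1)).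
  by apply: eq_bigr => i _; rewrite cRe_real.
- rewrite cIm_sum; apply: (etrans (derive_coord h f2)).
  by apply: eq_bigr => i _; rewrite cIm_real.
Qed.

Lemma is_derive_line V (f : V -> R) (x h : V) (t : R) :
  differentiable f (x + t *: h) ->
  is_derive t 1 (fun s : R => f (x + s *: h)) ('D_h f (x + t *: h)).
Proof.
move=> /(@diff_derivable _ _ _ _ _ h) df.
have e (u : R) : f (x + (u *: 1 + t) *: h) - f (x + t *: h) =
    f (u *: h + (x + t *: h)) - f (x + t *: h).
  by rewrite [u%:A]mulr1 scalerDl addrCA.
apply: DeriveDef; last by apply: derive_transport => u; rewrite e.
by apply: derivable_transport df => u; rewrite e.
Qed.

End ComplexDeriv.

(** * Smooth functions and the Leibniz rule *)

Section Smooth.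
Variables (R : realType) (n : nat).
Implicit Types (f g : 'rV[R]_n -> R[i]) (s : seq 'I_n).

Lemma pderivE i f x : pderiv i f x = cD (delta_mx 0 i) f x.
Proof. by []. Qed.

Lemma pderivs_rcons s i f : pderivs (rcons s i) f = pderivs s (pderiv i f).
Proof. by rewrite /pderivs foldr_rcons. Qed.

Lemma pderivs_cat s s' f : pderivs (s ++ s') f = pderivs s (pderivs s' f).
Proof. by rewrite /pderivs foldr_cat. Qed.

Lemma smooth_pderiv f i : smooth f -> smooth (pderiv i f).
Proof. by move=> h s x; have := h (rcons s i) x; rewrite pderivs_rcons. Qed.

Lemma smooth_pderivs f s : smooth f -> smooth (pderivs s f).
Proof. by elim: s => [//|i s ih] /ih; exact: smooth_pderiv. Qed.

Lemma smooth_cdiff f x : smooth f -> cdiff f x.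
Proof. by move=> /(_ [::] x). Qed.

(** Finite orders open products to induction: the product rule lowers the order by one and leaves a
    sum of products. *)
Fixpoint Ck k f : Prop := (forall x, cdiff f x) /\
  if k is k'.+1 then forall i, Ck k' (pderiv i f) else True.

Lemma CkW k f : Ck k.+1 f -> Ck k f.
Proof.
elim: k f => [|k ih] f /= [f1 f2]; split => // i.
exact/ih/f2.
Qed.

Lemma smooth_Ck f : smooth f <-> forall k, Ck k f.
Proof.
split=> [h k|h s x].
  elim: k f h => [|k ih] f h; split => //; first by move=> x; exact: (h [::]).
    by move=> x; exact: (h [::]).
  by move=> i; apply: ih; exact: smooth_pderiv.
move: (h (size s)) => {h}.
elim/last_ind: s f => [|s i ih] f; first by move=> [h _]; exact: h.
by rewrite size_rcons pderivs_rcons => -[_ /(_ i)] /ih.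
Qed.

(** A coinduction principle, for functions whose derivatives keep one explicit form, such as
    parametric integrals, regularised distributions, or amplitudes times an oscillating factor. *)
Lemma smooth_coind (P : set ('rV[R]_n -> R[i])) :
  (forall f, P f -> (forall x, cdiff f x) /\ forall i, P (pderiv i f)) ->
  forall f, P f -> smooth f.
Proof.
move=> h f Pf s x; elim/last_ind: s f Pf => [|s i ih] f Pf.
  by case: (h f Pf) => + _; exact.
by rewrite pderivs_rcons; apply: ih; case: (h f Pf).
Qed.

Lemma smooth_cst (c : R[i]) : smooth (fun _ : 'rV[R]_n => c).
Proof.
apply: (@smooth_coind [set f | exists c, f = fun=> c]); last by exists c.
move=> _ [d ->]; split => [x|i]; first exact: cdiff_cst.
by exists 0; apply/funext => x; rewrite pderivE cD_cst.
Qed.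

Lemma pderivs0 s : pderivs s (fun _ : 'rV[R]_n => 0) = fun=> 0 :> R[i].
Proof.
elim: s => //= i s ->; by apply/funext => x; rewrite pderivE cD_cst.
Qed.

Lemma CkD k f g : Ck k f -> Ck k g -> Ck k (fun x => f x + g x).
Proof.
elim: k f g => [|k ih] f g /= [f1 f2] [g1 g2].
  by split => // x; exact: cdiffD.
split => [x|i]; first exact: cdiffD.
rewrite (_ : pderiv i _ = fun x => pderiv i f x + pderiv i g x).
  exact: ih.
by apply/funext => x; rewrite !pderivE cDD.
Qed.

Lemma CkM k f g : Ck k f -> Ck k g -> Ck k (fun x => f x * g x).
Proof.
elim: k f g => [|k ih] f g hf hg; have /= [f1 f2] := hf; have /= [g1 g2] := hg.
  by split => // x; exact: cdiffM.
split => [x|i]; first exact: cdiffM.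
rewrite (_ : pderiv i _ = fun x => pderiv i f x * g x + f x * pderiv i g x).
  by apply: CkD; apply: ih; rewrite //; exact: CkW.
by apply/funext => x; rewrite !pderivE cDM.
Qed.

Lemma smoothD f g : smooth f -> smooth g -> smooth (fun x => f x + g x).
Proof. by move=> /smooth_Ck hf /smooth_Ck hg; apply/smooth_Ck => k; exact: CkD. Qed.

Lemma smoothM f g : smooth f -> smooth g -> smooth (fun x => f x * g x).
Proof. by move=> /smooth_Ck hf /smooth_Ck hg; apply/smooth_Ck => k; exact: CkM. Qed.

Lemma smoothZ c f : smooth f -> smooth (fun x => c * f x).
Proof. by move=> h; apply: smoothM => //; exact: smooth_cst. Qed.

Lemma smoothN f : smooth f -> smooth (fun x => - f x).
Proof.
move=> h; rewrite (_ : (fun x => _) = fun x => (-1) * f x).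
  exact: smoothZ.
by apply/funext => x; rewrite mulN1r.
Qed.

Lemma smoothB f g : smooth f -> smooth g -> smooth (fun x => f x - g x).
Proof. by move=> hf hg; apply: smoothD => //; exact: smoothN. Qed.

Lemma smooth_sum (I : Type) (r : seq I) (F : I -> 'rV[R]_n -> R[i]) :
  (forall i, smooth (F i)) -> smooth (fun x => \sum_(i <- r) F i x).
Proof.
move=> h; elim: r => [|i r ih].
  by under eq_fun do rewrite big_nil; exact: smooth_cst.
by under eq_fun do rewrite big_cons; exact: smoothD.
Qed.

Lemma pderivD i f g : smooth f -> smooth g ->
  pderiv i (fun x => f x + g x) = fun x => pderiv i f x + pderiv i g x.
Proof.
move=> hf hg; apply/funext => x.
by rewrite !pderivE cDD//; exact: smooth_cdiff.
Qed.

Lemma pderivM i f g : smooth f -> smooth g ->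
  pderiv i (fun x => f x * g x) = fun x => pderiv i f x * g x + f x * pderiv i g x.
Proof.
move=> hf hg; apply/funext => x.
by rewrite !pderivE cDM//; exact: smooth_cdiff.
Qed.

Lemma pderivsD s f g : smooth f -> smooth g ->
  pderivs s (fun x => f x + g x) = fun x => pderivs s f x + pderivs s g x.
Proof.
move=> hf hg; elim: s => //= i s ->.
by rewrite pderivD//; exact: smooth_pderivs.
Qed.

Lemma pderivsZ s c f : smooth f ->
  pderivs s (fun x => c * f x) = fun x => c * pderivs s f x.
Proof.
move=> hf; elim: s => //= i s ->; apply/funext => x.
by rewrite pderivE cDZ//; exact/smooth_cdiff/smooth_pderivs.
Qed.

Lemma pderivsN s f : smooth f ->
  pderivs s (fun x => - f x) = fun x => - pderivs s f x.
Proof.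
move=> h; rewrite (_ : (fun x => - f x) = fun x => (-1) * f x).
  by rewrite pderivsZ//; apply/funext => x; rewrite mulN1r.
by apply/funext => x; rewrite mulN1r.
Qed.

Lemma pderivsB s f g : smooth f -> smooth g ->
  pderivs s (fun x => f x - g x) = fun x => pderivs s f x - pderivs s g x.
Proof.
by move=> hf hg; rewrite pderivsD ?pderivsN//; exact: smoothN.
Qed.

Lemma pderivs_sum (I : Type) (r : seq I) s (F : I -> 'rV[R]_n -> R[i]) :
  (forall i, smooth (F i)) ->
  pderivs s (fun x => \sum_(i <- r) F i x) =
  fun x => \sum_(i <- r) pderivs s (F i) x.
Proof.
move=> h; elim: r => [|i r ih].
  under eq_fun do rewrite big_nil; rewrite pderivs0.
  by apply/funext => x; rewrite big_nil.
under eq_fun do rewrite big_cons.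
rewrite pderivsD ?ih//; last exact: smooth_sum.
by apply/funext => x; rewrite big_cons.
Qed.

(** [2 ^+ size s] counts the terms of the Leibniz rule. The bounds are taken at the single point
    [x], so that [A] and [B] can carry weights evaluated there. *)
Lemma pderivsM_bound s f g x (A B : R) : smooth f -> smooth g ->
  (forall s1, (size s1 <= size s)%N -> cabs (pderivs s1 f x) <= A) ->
  (forall s1, (size s1 <= size s)%N -> cabs (pderivs s1 g x) <= B) ->
  cabs (pderivs s (fun y => f y * g y) x) <= 2 ^+ size s * (A * B).
Proof.
elim/last_ind: s f g => [|s i ih] f g hf hg hA hB.
  rewrite expr0 mul1r /= cabsM; apply: ler_pM; rewrite ?cabs_ge0//.
    exact: (hA [::]).
  exact: (hB [::]).
have hf' := smooth_pderiv i hf; have hg' := smooth_pderiv i hg.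
rewrite pderivs_rcons pderivM// pderivsD; [|exact: smoothM|exact: smoothM].
apply: le_trans (cabsD _ _) _.
rewrite size_rcons exprS -mulrA mulr2n mulrDl mul1r; apply: lerD.
  apply: ih => // s1 hs; last by apply: hB; rewrite size_rcons ltnW.
  by have := hA (rcons s1 i); rewrite !size_rcons ltnS pderivs_rcons; exact.
apply: ih => // s1 hs; first by apply: hA; rewrite size_rcons ltnW.
by have := hB (rcons s1 i); rewrite !size_rcons ltnS pderivs_rcons; exact.
Qed.

End Smooth.

(** * Composition with affine maps *)

Section AffineComp.
Variables (R : realType) (m n : nat) (L : 'rV[R]_m -> 'rV[R]_n).
Variable w : 'I_m -> 'rV[R]_n.
(** This makes [L] affine, with [w i] the image of the i-th basis vector under its linear part;
    stating it on increments covers scalings, translations, concatenations and blocks alike. *)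
Hypothesis hL : forall i (t : R) x, L (t *: delta_mx 0 i + x) = t *: w i + L x.

Lemma dirmapE x : L x = \sum_i x 0 i *: w i + L 0.
Proof.
rewrite -[in LHS](addr0 x) {1}(row_sum_delta x).
elim: (index_enum _) => [|i r ih]; first by rewrite !big_nil !add0r.
by rewrite !big_cons -!addrA hL ih.
Qed.

Lemma dirmap_differentiable x : differentiable L x.
Proof.
rewrite (_ : L = (\sum_i (fun x : 'rV[R]_m => x 0 i *: w i)) + cst (L 0)).
  apply: differentiableD; last exact: differentiable_cst.
  apply: differentiable_sum => i.
  exact/differentiableZl/differentiable_coord.
by apply/funext => y; rewrite fctE fct_sumE dirmapE.
Qed.

Lemma dirmap_continuous : continuous L.
Proof. by move=> x; exact/differentiable_continuous/dirmap_differentiable. Qed.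

Let dL := dirmap_differentiable.

Lemma pderiv_comp i f x : cdiff f (L x) ->
  pderiv i (fun y => f (L y)) x = \sum_j (w i 0 j)%:C * pderiv j f (L x).
Proof. by move=> h; rewrite pderivE (@cD_dir _ _ _ L _ (w i))// cD_coord. Qed.

Lemma smooth_comp f : smooth f -> smooth (fun x => f (L x)).
Proof.
move=> /smooth_Ck h; apply/smooth_Ck => k.
elim: k f {h}(h k) => [|k ih] f [f1 f2].
  by split => // x; exact: cdiff_comp.
split => [x|i]; first exact: cdiff_comp.
rewrite (_ : pderiv i _ =
  fun x => \sum_j (w i 0 j)%:C * pderiv j f (L x)); last first.
  by apply/funext => x; rewrite pderiv_comp.
elim: (index_enum _) => [|j r ihr].
  under eq_fun do rewrite big_nil.
  by move: k {ih f2}; apply/smooth_Ck; exact: smooth_cst.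
under eq_fun do rewrite big_cons.
apply: CkD => //; apply: CkM; last by apply: ih; exact: f2.
by move: k {ih f2 ihr}; apply/smooth_Ck; exact: smooth_cst.
Qed.

(** As [L] is affine, the chain rule creates no terms of lower order: only derivatives of order
    exactly [size s] occur, and each differentiation costs the l1 norm of a direction. *)
Lemma pderivs_comp_bound s f x (A B : R) : smooth f -> 
  (forall i, l1 (w i) <= A) -> 
  (forall s1, (size s1 = size s)%N -> cabs (pderivs s1 f (L x)) <= B) ->
  0 <= B -> cabs (pderivs s (fun y => f (L y)) x) <= A ^+ size s * B.
Proof.
move=> + hA + B0; elim/last_ind: s f => [|s i ih] f hf hB.
  by rewrite expr0 mul1r; exact: (hB [::]).
rewrite pderivs_rcons (_ : pderiv i _ =
  fun x => \sum_j (w i 0 j)%:C * pderiv j f (L x)); last first.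
  by apply/funext => y; rewrite pderiv_comp//; exact: smooth_cdiff.
have hsm j : smooth (fun y => pderiv j f (L y)).
  exact/smooth_comp/smooth_pderiv.
rewrite pderivs_sum; last by move=> j; exact: smoothZ.
apply: le_trans (cabs_sum _ _ _) _.
rewrite size_rcons exprS -mulrA.
have A0 : 0 <= A by apply: le_trans (hA i); exact: l1_ge0.
apply: (@le_trans _ _ (l1 (w i) * (A ^+ size s * B))); last first.
  by rewrite ler_wpM2r// mulr_ge0// exprn_ge0.
rewrite mulr_suml; apply: ler_sum => j _.
rewrite pderivsZ// cabsM cabsR ler_wpM2l//.
apply: ih; first exact: smooth_pderiv.
move=> s1 hs1; rewrite -pderivs_rcons.
by apply: hB; rewrite !size_rcons hs1.
Qed.
End AffineComp.

Lemma pderivs_dir (R : realType) (m n : nat) (L : 'rV[R]_m -> 'rV[R]_n)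
    (p : 'I_m -> 'I_n) (s : seq 'I_m) (f : 'rV[R]_n -> R[i]) :
  (forall i (t : R) x, L (t *: delta_mx 0 i + x) = t *: delta_mx 0 (p i) + L x) ->
  pderivs s (fun x => f (L x)) = fun x => pderivs (map p s) f (L x).
Proof.
move=> hL; elim: s => //= i s ->; apply/funext => x.
by rewrite pderivE (cD_dir (w := delta_mx 0 (p i))).
Qed.

(** * Symmetry of derivatives and Taylor expansion *)

Section MeanValue.
Variable R : realType.

Lemma mvt0 (g dg : R -> R) (h : R) : 0 <= h ->
  (forall t : R, is_derive t (1 : R) g (dg t)) ->
  exists2 c, 0 <= c <= h & g h - g 0 = dg c * h.
Proof.
move=> h0 hd.
have hc : {within `[0, h], continuous g}.
  by apply: derivable_within_continuous => x _; exact: ex_derive.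
have [c] := @MVT_segment R g dg 0 h h0 (fun x _ => hd x) hc.
by rewrite in_itv /= subr0; exists c.
Qed.

(** The mean value theorem is applied along [u], then along [v]. The left-hand side is symmetric in
    [u] and [v], which is what [clairaut_real] exploits. *)
Lemma second_difference (V : normedModType R) (f : V -> R) (u v x : V) (h : R) :
  0 <= h -> (forall y, differentiable f y) ->
  (forall y, differentiable ('D_u f) y) ->
  exists s t : R, [/\ 0 <= s <= h, 0 <= t <= h &
    f (x + h *: u + h *: v) - f (x + h *: u) - f (x + h *: v) + f x =
    h ^+ 2 * 'D_v ('D_u f) (x + (s *: u + t *: v))].
Proof.
move=> h0 df dDf.
have [|s hs es] := @mvt0 (fun t => f (x + h *: v + t *: u) - f (x + t *: u))
  (fun t => 'D_u f (x + h *: v + t *: u) - 'D_u f (x + t *: u)) h h0.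
  by move=> t; apply: is_deriveB; exact: is_derive_line.
have [|t ht et] := @mvt0 (fun t => 'D_u f (x + s *: u + t *: v))
  (fun t => 'D_v ('D_u f) (x + s *: u + t *: v)) h h0.
  by move=> t; exact: is_derive_line.
exists s, t; split => //.
rewrite /= !scale0r !addr0 in es et.
transitivity (('D_u f (x + s *: u + h *: v) - 'D_u f (x + s *: u)) * h).
  by rewrite (addrAC x (s *: u)) -es (addrAC x (h *: u)); ring.
by rewrite et addrA; ring.
Qed.

Lemma clairaut_real (V : normedModType R) (f : V -> R) (u v x : V) :
  (forall y, differentiable f y) ->
  (forall y, differentiable ('D_u f) y) -> (forall y, differentiable ('D_v f) y) ->
  {for x, continuous ('D_v ('D_u f))} -> {for x, continuous ('D_u ('D_v f))} ->
  'D_v ('D_u f) x = 'D_u ('D_v f) x.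
Proof.
move=> df du dv cA cB; apply/eqP; rewrite -subr_eq0 -normr_le0.
apply/ler_addgt0Pr => e e0; rewrite add0r.
have e20 : 0 < e / 2 by rewrite divr_gt0.
have /cvgrPdist_lt/(_ _ e20)/nbhs_normP[d1 /= d10 h1] := cA.
have /cvgrPdist_lt/(_ _ e20)/nbhs_normP[d2 /= d20 h2] := cB.
have [d [d0 dd1 dd2]] : exists d, [/\ 0 < d, d <= d1 & d <= d2].
  exists (Num.min d1 d2); split; first by rewrite lt_min d10 d20.
    by rewrite ge_min lexx.
  by rewrite ge_min lexx orbT.
(* With this step, all points x + s u + t v with s and t in [0, h] lie within [d] of [x]; the 1
   keeps the denominator positive. *)
pose h := d / 2 / (1 + `|u| + `|v|).
have D0 : 0 < 1 + `|u| + `|v| by rewrite -addrA ltr_wpDr ?addr_ge0.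
have h0 : 0 < h by rewrite !divr_gt0.
have near : forall s t, 0 <= s <= h -> 0 <= t <= h ->
    `|x - (x + (s *: u + t *: v))| < d.
  move=> s t /andP[s0 sh] /andP[t0 th].
  rewrite opprD addNKr normrN; apply: le_lt_trans (ler_normD _ _) _.
  rewrite !normrZ !ger0_norm//.
  apply: (@le_lt_trans _ _ (h * (1 + `|u| + `|v|))).
    have := normr_ge0 u; have := normr_ge0 v; nra.
  by rewrite /h divfK ?gt_eqF// ltr_pdivrMr// ltr_pMr// ltr1n.
have [s [t [hs ht e1]]] := second_difference v x (ltW h0) df du.
have [s' [t' [hs' ht' e2]]] := second_difference u x (ltW h0) df dv.
have E : 'D_v ('D_u f) (x + (s *: u + t *: v)) =
         'D_u ('D_v f) (x + (s' *: v + t' *: u)).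
  apply: (@mulfI _ (h ^+ 2)); first by rewrite expf_eq0 gt_eqF.
  apply: (etrans (esym e1)); apply: (etrans _ e2).
  by rewrite (addrAC x (h *: v)); congr (_ + _); exact: addrAC.
have a1 := h1 _ (lt_le_trans (near _ _ hs ht) dd1).
have a2 := h2 (x + (s' *: v + t' *: u)).
rewrite /= [s' *: v + _]addrC in a2.
have {}a2 := a2 (lt_le_trans (near _ _ ht' hs') dd2).
rewrite [s' *: v + _]addrC in E; rewrite /= -E in a2.
move: a1 a2; rewrite /=.
move: ('D_v ('D_u f) (x + _)) ('D_v ('D_u f) x) ('D_u ('D_v f) x) => C A B a1 a2.
apply: ltW; rewrite (splitr e) (_ : A - B = (A - C) - (B - C)).
  by apply: le_lt_trans (ler_normB _ _) _; apply: ltrD.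
by rewrite opprB addrA subrK.
Qed.

Lemma is_derive_mono (m : nat) (c t : R) :
  is_derive t 1 (fun t : R => t ^+ m * c) (m%:R * t ^+ m.-1 * c).
Proof.
have h1 : is_derive t 1 (fun t : R => t ^+ m) (m%:R * t ^+ m.-1).
  have := is_deriveX m (@is_derive_id _ _ t (1 : R)).
  rewrite (_ : (id ^+ m) = (fun t : R => t ^+ m)); last first.
    by apply/funext => s; elim: m => // m ih; rewrite exprS exprS -ih.
  by move/is_derive_eq; apply; rewrite /GRing.scale /= mulr1.
have h2 := @is_deriveM R R _ (cst c) t 1 _ _ h1 (is_derive_cst c t 1).
by apply: (is_derive_eq h2); rewrite scaler0 add0r /GRing.scale /= mulrC.
Qed.

(** Induction on the order: the remainder vanishes at 0, and its derivative is the remainder of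
    order [q] of the shifted sequence, so the mean value theorem suffices. No factorial is gained in
    the bound. *)
Lemma taylor_real (q : nat) (g : nat -> R -> R) (B : R) :
  (forall k (t : R), is_derive t (1 : R) (g k) (g k.+1 t)) ->
  (forall t, 0 <= t <= 1 -> `|g q t| <= B) ->
  forall t, 0 <= t <= 1 ->
  `|g 0 t - \sum_(m < q) t ^+ m * (g m 0 / m`!%:R)| <= B.
Proof.
elim: q g => [|q ih] g hd hB t t01.
  by rewrite big_ord0 subr0; exact: hB.
have := ih (fun k => g k.+1) (fun k => hd k.+1) hB => {}ih.
case/andP: (t01) => t0 t1.
pose r t := g 0 t - \sum_(m < q.+1) t ^+ m * (g m 0 / m`!%:R).
pose dr t := g 1 t - \sum_(m < q) t ^+ m * (g m.+1 0 / m`!%:R).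
have hr (s : R) : is_derive s (1 : R) r (dr s).
  apply: is_deriveB.
  have := @is_derive_sum R R R q.+1
    (fun m s => s ^+ m * (g m 0 / m`!%:R)) s (1 : R)
    (fun m => m%:R * s ^+ m.-1 * (g m 0 / m`!%:R))
    (fun m => is_derive_mono m _ s).
  rewrite (_ : \sum_(i < q.+1) _ =
    (fun s : R => \sum_(m < q.+1) s ^+ m * (g m 0 / m`!%:R))).
    move/is_derive_eq; apply.
    rewrite big_ord_recl /= mul0r mul0r add0r; apply: eq_bigr => i _.
    rewrite /bump /= add1n factS natrM invfM.
    have : (i.+1%:R : R) != 0 by rewrite pnatr_eq0.
    have : (i`!%:R : R) != 0 by rewrite pnatr_eq0 -lt0n fact_gt0.
    by move: (i.+1%:R : R) (i`!%:R : R) => a b ha hb; field; rewrite ha hb.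
  by apply/funext => u; rewrite fct_sumE.
have [c /andP[c0 ct] e] := mvt0 t0 hr.
have r0 : r 0 = 0.
  rewrite /r big_ord_recl big1 /= ?addr0.
    by rewrite expr0 mul1r fact0 divr1 subrr.
  by move=> i _; rewrite exprS !mul0r.
move: e; rewrite r0 subr0 -/(r t) => ->.
rewrite normrM (ger0_norm t0) -[leRHS]mulr1; apply: ler_pM => //.
by apply: ih; rewrite c0/= (le_trans ct).
Qed.
End MeanValue.

Section Clairaut.
Variables (R : realType) (n : nat).
Implicit Types (f : 'rV[R]_n -> R[i]) (s : seq 'I_n).

Lemma clairaut f i j : smooth f ->
  pderiv i (pderiv j f) = pderiv j (pderiv i f).
Proof.
move=> hf; apply/funext => x.
have h0 y := smooth_cdiff y hf.
have h1 k y := smooth_cdiff y (smooth_pderiv k hf).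
have h2 k l y := smooth_cdiff y (smooth_pderiv l (smooth_pderiv k hf)).
apply: ceq.
- have c1 := differentiable_continuous (h2 j i x).1.
  have c2 := differentiable_continuous (h2 i j x).1.
  exact: (@clairaut_real _ _ (fun y => complex.Re (f y)) _ _ x
    (fun y => (h0 y).1) (fun y => (h1 j y).1) (fun y => (h1 i y).1) c1 c2).
- have c1 := differentiable_continuous (h2 j i x).2.
  have c2 := differentiable_continuous (h2 i j x).2.
  exact: (@clairaut_real _ _ (fun y => complex.Im (f y)) _ _ x
    (fun y => (h0 y).2) (fun y => (h1 j y).2) (fun y => (h1 i y).2) c1 c2).
Qed.

Lemma pderivs_pderiv s i f : smooth f ->
  pderivs s (pderiv i f) = pderiv i (pderivs s f).
Proof.
move=> hf; elim: s => //= j s ->.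
by rewrite clairaut//; exact: smooth_pderivs.
Qed.

Lemma pderivs_perm s1 s2 f : perm_eq s1 s2 -> smooth f ->
  pderivs s1 f = pderivs s2 f.
Proof.
move=> hp hf; elim: s1 s2 hp => [|i s1 ih] s2 hp.
  by rewrite perm_sym in hp; rewrite (perm_nilP hp).
have : i \in s2 by rewrite -(perm_mem hp) mem_head.
move=> /splitPr is2; case: s2 / is2 hp => t1 t2 hp.
have {}hp : perm_eq s1 (t1 ++ t2).
  rewrite -(perm_cons i); apply: perm_trans hp _.
  by rewrite perm_catC /= perm_cons perm_catC.
rewrite /= (ih _ hp) !pderivs_cat /=.
by rewrite pderivs_pderiv//; exact: smooth_pderivs.
Qed.

Definition mindex s : 'rV[nat]_n := \row_i count_mem i s.

(** The bridge from derivatives along lists, on which induction is easy, to the multi-indices of the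
    definitions. A multi-index forgets the order of differentiation, hence the need for symmetry. *)
Lemma mderiv_mindex s f : smooth f -> pderivs s f = mderiv (mindex s) f.
Proof.
move=> hf; apply: pderivs_perm => //; apply/allP => i _ /=.
rewrite count_flatten -map_comp sumnE big_map big_enum /= (bigD1 i)//= big1.
  by rewrite addn0 count_nseq /= eqxx mul1n mxE.
by move=> j ji; rewrite count_nseq /= (negbTE ji).
Qed.

Lemma mlength_mindex s : mlength (mindex s) = size s.
Proof.
rewrite /mlength; under eq_bigr do rewrite mxE.
elim: s => [|i s ih] /=; first by rewrite big1.
rewrite big_split /= ih (bigD1 i)//= eqxx big1 ?addn0//.
by move=> j ji; rewrite eq_sym (negbTE ji).
Qed.

Definition mseq (alpha : 'rV[nat]_n) : seq 'I_n :=
  flatten [seq nseq (alpha 0 i) i | i <- enum 'I_n].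

Lemma size_mseq alpha : size (mseq alpha) = mlength alpha.
Proof.
rewrite size_flatten /shape -map_comp sumnE big_map big_enum /=.
by apply: eq_bigr => i _; rewrite /= size_nseq.
Qed.

Definition zpow (x : 'rV[R]_n) s : R := \prod_(i <- s) x 0 i.

Lemma zpow_mpow (x : 'rV[R]_n) s : zpow x s = mpow x (mindex s).
Proof.
rewrite /zpow /mpow; elim: s => [|i s ih].
  by rewrite big_nil big1// => i _; rewrite mxE.
rewrite big_cons ih [RHS](bigD1 i)//= [in LHS](bigD1 i)//=.
rewrite !mxE /= eqxx exprS -!mulrA; congr (_ * (_ * _)).
by apply: eq_bigr => j ji; rewrite !mxE /= eq_sym (negbTE ji).
Qed.

Lemma mpow_le (x : 'rV[R]_n) alpha : `|mpow x alpha| <= jbracket x ^+ mlength alpha.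
Proof.
rewrite /mpow /mlength normr_prod -prodrXr.
apply: ler_prod => i _; rewrite normr_ge0 /= normrX.
by apply: lerXn2r; rewrite ?nnegrE ?jb_ge0// coord_jb.
Qed.
End Clairaut.

Section Taylor.
Variables (R : realType) (n : nat).
Implicit Types (f : 'rV[R]_n -> R[i]) (s : seq 'I_n).

(** The derivative along [h], written in partial derivatives so that its iterates are visibly smooth
    in [x] and polynomial in [h]. *)
Definition ddir (h : 'rV[R]_n) f : 'rV[R]_n -> R[i] :=
  fun x => \sum_i (h 0 i)%:C * pderiv i f x.

Lemma smooth_ddir h f : smooth f -> smooth (ddir h f).
Proof.
move=> hf; apply: smooth_sum => i.
exact/smoothZ/smooth_pderiv.
Qed.

Lemma smooth_iter_ddir q h f : smooth f -> smooth (iter q (ddir h) f).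
Proof. by move=> hf; elim: q => //= q ih; exact: smooth_ddir. Qed.

Lemma ddirE h f x : smooth f -> ddir h f x = cD h f x.
Proof. by move=> hf; rewrite cD_coord//; exact: smooth_cdiff. Qed.

Lemma iter_ddir_sum q h (c : 'I_n -> R[i]) (F : 'I_n -> 'rV[R]_n -> R[i]) :
  (forall i, smooth (F i)) ->
  iter q (ddir h) (fun x => \sum_i c i * F i x) =
  fun x => \sum_i c i * iter q (ddir h) (F i) x.
Proof.
move=> hF; elim: q => //= q ->; apply/funext => x.
have hs i : smooth (iter q (ddir h) (F i)) by exact: smooth_iter_ddir.
rewrite ddirE; last by apply: smooth_sum => i; exact: smoothZ.
rewrite cD_sum; last by move=> i; exact/smooth_cdiff/smoothZ.
apply: eq_bigr => i _; rewrite cDZ ?ddirE//; exact: smooth_cdiff.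
Qed.

Lemma iter_ddirSr q h f x : smooth f ->
  iter q.+1 (ddir h) f x = \sum_i (h 0 i)%:C * iter q (ddir h) (pderiv i f) x.
Proof.
move=> hf; rewrite iterSr /ddir -/(ddir h) iter_ddir_sum// => i.
exact: smooth_pderiv.
Qed.

Lemma iter_ddir_bound q h f x (B : R) : smooth f ->
  (forall s, size s = q -> cabs (pderivs s f x) <= B) ->
  cabs (iter q (ddir h) f x) <= l1 h ^+ q * B.
Proof.
elim: q f => [|q ih] f hf hB; first by rewrite mul1r; exact: (hB [::]).
rewrite iter_ddirSr//; apply: le_trans (cabs_sum _ _ _) _.
rewrite exprS -mulrA mulr_suml; apply: ler_sum => i _.
rewrite cabsM cabsR ler_wpM2l//; apply: ih; first exact: smooth_pderiv.
by move=> s hs; rewrite -pderivs_rcons; apply: hB; rewrite size_rcons hs.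
Qed.

(** Real and imaginary parts are expanded separately along the segment, whence the factor 2. *)
Lemma taylor q f x h (B : R) : smooth f ->
  (forall t, 0 <= t <= 1 -> forall s, size s = q ->
     cabs (pderivs s f (x + t *: h)) <= B) ->
  cabs (f (x + h) - \sum_(m < q) (m`!%:R^-1)%:C * iter m (ddir h) f x) <=
  2 * (l1 h ^+ q * B).
Proof.
move=> hf hB.
have hs k := smooth_iter_ddir k h hf.
have hb t : 0 <= t <= 1 ->
    cabs (iter q (ddir h) f (x + t *: h)) <= l1 h ^+ q * B.
  by move=> t01; apply: iter_ddir_bound => // s; exact: hB.
have h1 : 0 <= (1 : R) <= 1 by rewrite ler01 lexx.
apply: le_trans (cabs_le_ReIm _) _; rewrite mulr2n mulrDl !mul1r.
apply: lerD.
- have := @taylor_real R q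
    (fun k t => complex.Re (iter k (ddir h) f (x + t *: h))) (l1 h ^+ q * B).
  move=> /(_ _ _ 1 h1); rewrite scale1r.
  rewrite cReD cReN cRe_sum; under eq_bigr do rewrite expr1n mul1r scale0r addr0.
  under [X in _ -> `|_ - X| <= _]eq_bigr do rewrite cRe_real mulrC.
  apply => [k t|t t01]; last by apply: le_trans (le_Re_cabs _) _; exact: hb.
  rewrite /= ddirE//.
  exact: (is_derive_line (smooth_cdiff _ (hs k)).1).
- have := @taylor_real R q
    (fun k t => complex.Im (iter k (ddir h) f (x + t *: h))) (l1 h ^+ q * B).
  move=> /(_ _ _ 1 h1); rewrite scale1r.
  rewrite cImD cImN cIm_sum; under eq_bigr do rewrite expr1n mul1r scale0r addr0.
  under [X in _ -> `|_ - X| <= _]eq_bigr do rewrite cIm_real mulrC.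
  apply => [k t|t t01]; last by apply: le_trans (le_Im_cabs _) _; exact: hb.
  rewrite /= ddirE//.
  exact: (is_derive_line (smooth_cdiff _ (hs k)).2).
Qed.
End Taylor.

(** * Seminorms of Schwartz functions *)

Section QuadraticRemainder.
Variables (R : realType) (n : nat).

(* Differentiation under an integral or inside a tempered distribution yields
   such a quadratic remainder, so that no dominated convergence is needed. *)
Lemma quad_diff_real (f : 'rV[R]_n -> R) (x c : 'rV[R]_n) (C : R) :
  (forall h : 'rV[R]_n, `|h| <= 1 ->
     `|f (x + h) - f x - \sum_i h 0 i * c 0 i| <= C * `|h| ^+ 2) ->
  differentiable f x /\ forall v, 'D_v f x = \sum_i v 0 i * c 0 i.
Proof.
move=> hf; pose lin (h : 'rV[R]_n) : R := \sum_i h 0 i * c 0 i.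
have lin_lin : linear lin.
  move=> a u v; rewrite /lin /GRing.scale /= mulr_sumr -big_split.
  by apply: eq_bigr => i _ /=; rewrite !mxE mulrDl mulrA.
pose linM := GRing.isLinear.Build _ _ _ _ _ lin_lin.
pose L : {linear 'rV[R]_n -> R} := HB.pack lin linM.
have cL : continuous L.
  move=> y; apply: differentiable_continuous.
  rewrite (_ : (L : _ -> _) = \sum_i (fun h : 'rV[R]_n => h 0 i * c 0 i)).
    apply: differentiable_sum => i.
    apply: differentiableM; last exact: differentiable_cst.
    exact: differentiable_coord.
  by apply/funext => h; rewrite fct_sumE.
have e : f \o shift x = cst (f x) + L +o_ (0 : 'rV[R]_n) id.
  apply/eqaddoP => eps e0.
  have C1 : 0 < `|C| + 1 by rewrite ltr_wpDl.
  suff : \forall h \near (0 : 'rV[R]_n),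
      `|(f \o shift x - (cst (f x) + (L : _ -> _))) h| <= eps * `|h| by [].
  apply/nbhs_normP; exists (Num.min 1 (eps / (`|C| + 1))) => /=.
    by rewrite lt_min ltr01 divr_gt0.
  move=> h /=; rewrite sub0r normrN lt_min => /andP[/ltW h1 /ltW h2].
  have -> : (f \o shift x - (cst (f x) + (L : _ -> _))) h =
      f (x + h) - f x - \sum_i h 0 i * c 0 i.
    by rewrite -[LHS]/(f (h + x) - (f x + lin h)) opprD addrA (addrC h x).
  apply: le_trans (hf h h1) _.
  rewrite expr2 mulrA ler_wpM2r//.
  apply: (@le_trans _ _ ((`|C| + 1) * `|h|)).
    by rewrite ler_wpM2r// (le_trans (ler_norm C))// lerDl.
  by rewrite mulrC -ler_pdivlMr.
have dE := diff_unique cL e.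
have df : differentiable f x.
  by apply/diff_locallyP; rewrite dE; split.
by split => // v; rewrite deriveE// dE.
Qed.

Lemma quad_diff (f : 'rV[R]_n -> R[i]) (x : 'rV[R]_n) (c : 'I_n -> R[i]) (C : R) :
  (forall h : 'rV[R]_n, `|h| <= 1 ->
     cabs (f (x + h) - f x - \sum_i (h 0 i)%:C * c i) <= C * `|h| ^+ 2) ->
  cdiff f x /\ forall i, pderiv i f x = c i.
Proof.
move=> hf.
have [|d1 e1] := @quad_diff_real (fun y => complex.Re (f y)) x
    (\row_i complex.Re (c i)) C.
  move=> h h1; apply: le_trans (hf h h1).
  apply: le_trans (le_Re_cabs _); rewrite !(cReD, cReN) cRe_sum.
  rewrite (_ : \sum_i complex.Re _ = \sum_i h 0 i * (\row_i complex.Re (c i)) 0 i)//.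
  by apply: eq_bigr => i _; rewrite cRe_real mxE.
have [|d2 e2] := @quad_diff_real (fun y => complex.Im (f y)) x
    (\row_i complex.Im (c i)) C.
  move=> h h1; apply: le_trans (hf h h1).
  apply: le_trans (le_Im_cabs _); rewrite !(cImD, cImN) cIm_sum.
  rewrite (_ : \sum_i complex.Im _ = \sum_i h 0 i * (\row_i complex.Im (c i)) 0 i)//.
  by apply: eq_bigr => i _; rewrite cIm_real mxE.
split => // i; have sumE (u : 'rV[R]_n) : \sum_j (delta_mx 0 i : 'rV[R]_n) 0 j * u 0 j = u 0 i.
  rewrite (bigD1 i)//= mxE !eqxx mul1r big1 ?addr0// => j ji.
  by rewrite mxE (negbTE ji) andbF mul0r.
by apply: ceq => /=; rewrite ?e1 ?e2 sumE mxE.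
Qed.
End QuadraticRemainder.

Section Coordinates.
Variables (R : realType) (n : nat).

Lemma cdiff_coord (i : 'I_n) (x : 'rV[R]_n) : cdiff (fun z : 'rV[R]_n => (z 0 i)%:C) x.
Proof.
by split; [exact: differentiable_coord|exact: differentiable_cst].
Qed.

Lemma pderiv_coord (i j : 'I_n) :
  pderiv j (fun z : 'rV[R]_n => (z 0 i)%:C) = fun=> (i == j)%:R.
Proof.
apply/funext => x; rewrite pderivE.
have -> : cD (delta_mx 0 j) (fun z : 'rV[R]_n => (z 0 i)%:C) x =
    ((delta_mx 0 j : 'rV[R]_n) 0 i)%:C.
  apply: ceq; rewrite /cD /=; last exact: derive_cst.
  rewrite deriveE; last exact: differentiable_coord.
  have @f : {linear 'rV[R]_n -> R}.
    by exists (fun N : 'rV[R]_n => N 0 i); do 2![eexists]; do ?[constructor];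
       rewrite ?mxE// => ? *; rewrite ?mxE//; move=> ?; rewrite !mxE.
  rewrite -[fun y : 'rV_n => y 0 i]/(f : _ -> _) diff_lin//.
  exact: coord_continuous.
by rewrite mxE eqxx /=; case: (i == j).
Qed.

Lemma smooth_coord (i : 'I_n) : smooth (fun z : 'rV[R]_n => (z 0 i)%:C).
Proof.
apply: (@smooth_coind _ _ [set f | f = (fun z : 'rV[R]_n => (z 0 i)%:C) \/
  smooth f]); last by left.
move=> f [->|hf]; split=> [x|j].
- exact: cdiff_coord.
- by right; rewrite pderiv_coord; exact: smooth_cst.
- exact: smooth_cdiff.
- by right; exact: smooth_pderiv.
Qed.
End Coordinates.

Lemma fin_unif (I : finType) (P : I -> nat -> Prop) :
  (forall i k k', (k <= k')%N -> P i k -> P i k') ->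
  (forall i, exists k, P i k) -> exists k, forall i, P i k.
Proof.
move=> hm /choice[k hk]; exists (\max_i k i)%N => i.
exact: hm (leq_bigmax _) (hk i).
Qed.

(** There are finitely many lists of bounded length, so bounds that are monotone in a natural number
    can be made uniform over them. This is why constants of estimates are natural numbers below. *)
Lemma list_unif n (P : seq 'I_n -> nat -> Prop) (m : nat) :
  (forall s k k', (k <= k')%N -> P s k -> P s k') ->
  (forall s, exists k, P s k) ->
  exists k, forall s, (size s <= m)%N -> P s k.
Proof.
move=> hm hP; elim: m P hm hP => [|m ih] P hm hP.
  have [k hk] := hP [::]; exists k => s.
  by rewrite leqn0 size_eq0 => /eqP ->.
have [k0 hk0] := hP [::].
have [k1 hk1] : exists k, forall i : 'I_n, forall s, (size s <= m)%N -> P (i :: s) k.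
  apply: (@fin_unif _ (fun i k => forall s, (size s <= m)%N -> P (i :: s) k)).
    by move=> i k k' kk' h s hs; apply: hm kk' _; exact: h.
  move=> i; apply: (ih (fun s => P (i :: s))) => [s k k'|s].
    exact: hm.
  exact: hP.
exists (maxn k0 k1) => -[_|i s hs].
  exact: hm (leq_maxl _ _) hk0.
exact: hm (leq_maxr _ _) (hk1 i s hs).
Qed.

Lemma nat_ub (R : realType) (C : R) : exists k : nat, C <= k%:R.
Proof.
exists (Num.truncn `|C|).+1; apply: le_trans (ler_norm C) _.
by apply: ltW; exact: truncnS_gt.
Qed.

Section SchwartzChar.
Variables (R : realType) (n : nat).
Implicit Types (f : 'rV[R]_n -> R[i]) (s : seq 'I_n).

(** The proof passes through the maximum of 1 and the moduli of the coordinates. Only pure powers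
    appear, so seminorms with [alpha] zero or [K] times a unit vector control all decay of order
    [K]. *)
Lemma jbX_le_sum (x : 'rV[R]_n) K :
  jbracket x ^+ K <= (n.+1)%:R ^+ K * (1 + \sum_i `|x 0 i| ^+ K).
Proof.
pose M : R := \big[Num.max/1]_i `|x 0 i|.
have M1 : 1 <= M.
  rewrite /M; elim/big_rec: _ => // i y _ y1.
  by rewrite le_max y1 orbT.
have MK : M ^+ K <= 1 + \sum_i `|x 0 i| ^+ K.
  rewrite /M; elim/big_ind: _ => [|a b ha hb|i _].
  - by rewrite expr1n lerDl; apply: sumr_ge0 => i _; exact: exprn_ge0.
  - by rewrite /Num.max; case: ifP.
  - rewrite (bigD1 i)//= addrCA lerDl addr_ge0//; apply: sumr_ge0 => j _.
    by rewrite exprn_ge0.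
apply: (@le_trans _ _ ((n.+1)%:R ^+ K * M ^+ K)); last first.
  by rewrite ler_wpM2l// exprn_ge0.
rewrite -exprMn; apply: lerXn2r; rewrite ?nnegrE ?jb_ge0//.
  by rewrite mulr_ge0// (le_trans ler01).
apply: le_trans (jb_le_sum x) _.
rewrite -natr1 mulrDl mul1r [leRHS]addrC lerD//.
rewrite mulr_natl -[X in _ *+ X](card_ord n) -sumr_const.
by apply: ler_sum => i _; exact: le_bigmax.
Qed.

Lemma coords_jb (A M : R) K (x : 'rV[R]_n) : 0 <= A -> A <= M ->
  (forall i, A * `|x 0 i| ^+ K <= M) ->
  A <= (n.+1)%:R ^+ K.+1 * M * jbracket x ^- K.
Proof.
move=> A0 AM hM; rewrite ler_pdivlMr ?jbX_gt0//.
apply: (@le_trans _ _ (A * ((n.+1)%:R ^+ K * (1 + \sum_i `|x 0 i| ^+ K)))).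
  by rewrite ler_wpM2l// jbX_le_sum.
rewrite mulrCA exprSr -!mulrA ler_wpM2l ?exprn_ge0//.
rewrite mulrDr mulr1 mulr_sumr -natr1 mulrDl mul1r [leRHS]addrC lerD//.
rewrite mulr_natl -[X in _ *+ X](card_ord n) -sumr_const.
by apply: ler_sum.
Qed.

(** The bound is linear in [M] with a factor depending on [n] and [K] only; this later turns
    estimates on families into continuity with respect to the seminorms. *)
Lemma seminorm_jb f (M : R) N s K x : smooth f ->
  (size s <= N)%N -> (K <= N)%N ->
  (forall alpha beta : 'rV[nat]_n,
     (mlength alpha <= N)%N -> (mlength beta <= N)%N ->
     `|mpow x alpha| * cabs (mderiv beta f x) <= M) ->
  cabs (pderivs s f x) <= (n.+1)%:R ^+ K.+1 * M * jbracket x ^- K.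
Proof.
move=> hf hs hK hM; apply: coords_jb; first exact: cabs_ge0.
- have := hM 0 (mindex s); rewrite mlength_mindex -mderiv_mindex//.
  rewrite /mpow big1 => [|i _]; last by rewrite mxE.
  by rewrite normr1 mul1r /mlength big1 => [|i _]; [exact|rewrite mxE].
- move=> i; have := hM (\row_j (if j == i then K else 0%N)) (mindex s).
  rewrite mlength_mindex -mderiv_mindex// mulrC.
  rewrite /mpow (bigD1 i)//= big1 => [|j /negbTE ji]; last by rewrite mxE ji.
  rewrite mxE eqxx mulr1 normrX; apply => //.
  rewrite /mlength (bigD1 i)//= big1 => [|j /negbTE ji]; last by rewrite mxE ji.
  by rewrite mxE eqxx addn0.
Qed.

Lemma schwartzP f : schwartz f <-> smooth f /\
  forall s K, exists k : nat, forall x,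
    cabs (pderivs s f x) <= k%:R * jbracket x ^- K.
Proof.
split=> -[hf h]; split => //.
- move=> s K.
  (* Multi-indices with entries at most [K] form a finite type in this encoding, so the sum of the
     chosen constants serves them all. *)
  have /choice[c hc] : forall p : 'rV['I_K.+1]_n, exists C : R, forall x,
      `|mpow x (\row_i (p 0 i : nat))| * cabs (pderivs s f x) <= C.
    move=> p; have [C hC] := h (\row_i (p 0 i : nat)) (mindex s).
    by exists C => x; rewrite mderiv_mindex.
  pose M := \sum_p `|c p|.
  have hM (alpha : 'rV[nat]_n) x : (forall i, (alpha ord0 i <= K)%N) ->
      `|mpow x alpha| * cabs (pderivs s f x) <= M.
    move=> ha; pose p : 'rV['I_K.+1]_n := \row_i inord (alpha 0 i).
    have -> : alpha = \row_i (p 0 i : nat).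
      by apply/rowP => i; rewrite !mxE inordK// ltnS.
    apply: le_trans (hc p x) _; apply: le_trans (ler_norm _) _.
    by rewrite /M (bigD1 p)//= lerDl sumr_ge0.
  have [k hk] := nat_ub ((n.+1)%:R ^+ K.+1 * M).
  exists k => x; apply: (@le_trans _ _ ((n.+1)%:R ^+ K.+1 * M * jbracket x ^- K)).
    rewrite ler_pdivlMr ?jbX_gt0//.
    apply: (@le_trans _ _ (cabs (pderivs s f x) *
        ((n.+1)%:R ^+ K * (1 + \sum_i `|x 0 i| ^+ K)))).
      by rewrite ler_wpM2l ?cabs_ge0// jbX_le_sum.
    rewrite mulrCA exprSr -!mulrA ler_wpM2l ?exprn_ge0//.
    rewrite mulrDr mulr1 mulr_sumr -natr1 mulrDl mul1r [leRHS]addrC lerD//.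
      have := hM 0 x; rewrite /mpow big1 => [|i _]; last by rewrite mxE.
      by rewrite normr1 mul1r; apply => i; rewrite mxE.
    rewrite mulr_natl -[X in _ *+ X](card_ord n) -sumr_const.
    apply: ler_sum => i _; rewrite mulrC.
    have := hM (\row_j (if j == i then K else 0%N)) x.
    rewrite /mpow (bigD1 i)//= big1 => [|j /negbTE ji]; last by rewrite mxE ji.
    rewrite mxE eqxx mulr1 normrX; apply => j.
    by rewrite mxE; case: ifP.
  by rewrite ler_wpM2r ?jbVX_ge0.
- move=> alpha beta; have [k hk] := h (mseq beta) (mlength alpha).
  exists k%:R => x; apply: (@le_trans _ _ (jbracket x ^+ mlength alpha *
      (k%:R * jbracket x ^- mlength alpha))).
    by apply: ler_pM; rewrite ?cabs_ge0 ?mpow_le ?hk.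
  by rewrite mulrCA mulfV ?mulr1// gt_eqF// jbX_gt0.
Qed.
End SchwartzChar.

Lemma row_mx_dir0l (R : realType) m k (i : 'I_m) (t : R) (x : 'rV[R]_m) (y : 'rV[R]_k) :
  row_mx (t *: delta_mx 0 i + x) y = t *: delta_mx 0 (lshift k i) + row_mx x y.
Proof.
apply/rowP => j; rewrite !mxE; case: (splitP j) => j' hj; rewrite ?mxE /=.
  congr (t * _ + _); congr (_ %:R).
  by rewrite -!val_eqE /= hj.
rewrite (_ : (j == lshift k i) = false) ?andbF ?mulr0 ?add0r//.
by apply/negbTE; rewrite -val_eqE /= hj; have := ltn_ord i; lia.
Qed.

Lemma row_mx_dir0r (R : realType) m k (i : 'I_k) (t : R) (x : 'rV[R]_m) (y : 'rV[R]_k) :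
  row_mx x (t *: delta_mx 0 i + y) = t *: delta_mx 0 (rshift m i) + row_mx x y.
Proof.
apply/rowP => j; rewrite !mxE; case: (splitP j) => j' hj; rewrite ?mxE /=.
  rewrite (_ : (j == rshift m i) = false) ?andbF ?mulr0 ?add0r//.
  by apply/negbTE; rewrite -val_eqE /= hj; have := ltn_ord j'; lia.
congr (t * _ + _); congr (_ %:R).
by rewrite -!val_eqE /= hj eqn_add2l.
Qed.

Lemma continuous_row_mxl (R : realType) m k (y : 'rV[R]_k) :
  continuous (fun x : 'rV[R]_m => row_mx x y).
Proof. by apply: dirmap_continuous => i t x; exact: row_mx_dir0l. Qed.

Lemma continuous_row_mxr (R : realType) m k (x : 'rV[R]_m) :
  continuous (fun y : 'rV[R]_k => row_mx x y).
Proof. by apply: dirmap_continuous => i t y; exact: row_mx_dir0r. Qed.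

Lemma continuous_scal1 (R : realType) : continuous (fun x : R => x%:M : 'rV[R]_1).
Proof.
rewrite (_ : (fun x => _) = fun x : R => x *: (1%:M : 'rV[R]_1)).
  exact: scalel_continuous.
by apply/funext => x; rewrite scalemx1.
Qed.

(** * Integration on R^n *)

Section Caratheodory.
Variable R : realType.

(** A Caratheodory function is jointly measurable: rounding x down to the grid of mesh 1/(k+1) makes
    each preimage a countable union of measurable rectangles, and continuity in x gives the
    pointwise limit. *)
Lemma measurable_slices1 d (T : measurableType d) (f : R -> T -> R) :
  (forall t, continuous (f ^~ t)) -> (forall x, measurable_fun setT (f x)) ->
  measurable_fun [set: measurableTypeR R * T] (fun p => f p.1 p.2).
Proof.
move=> cf mf.
pose fl (k : nat) (x : R) : R := (Num.floor (x * k.+1%:R))%:~R / k.+1%:R.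
apply: (@measurable_fun_cvg _ _ _ _ (fun k p => f (fl k p.1) p.2)); last first.
  move=> [x t] _ /=; apply: (@cvg_comp _ _ _ (fun k => fl k x) (f ^~ t) _ (nbhs x)); last exact: cf.
  apply/cvgrPdist_le => e e0.
  near=> k.
  have k0 : (0 : R) < k.+1%:R by rewrite ltr0n.
  have ek : (k.+1%:R : R)^-1 <= e.
    rewrite invf_ple ?posrE//.
    have : (Num.truncn e^-1 <= k)%N by near: k; exists (Num.truncn e^-1).
    rewrite -(ler_nat R) -(lerD2r 1) !natr1 => hk; apply: le_trans hk.
    by apply: ltW; exact: truncnS_gt.
  apply: le_trans ek.
  have -> : x - fl k x = (x * k.+1%:R - (Num.floor (x * k.+1%:R))%:~R) / k.+1%:R.
    by rewrite mulrBl mulfK// gt_eqF.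
  rewrite normrM normfV (gtr0_norm k0) ler_piMl ?invr_ge0 ?(ltW k0)//.
  have /andP[] := floor_itv (x * k.+1%:R); rewrite intrD.
  by move: (x * _) (_%:~R) => a b h1 h2; rewrite ger0_norm; lra.
move=> k _ B mB; rewrite setTI.
rewrite (_ : _ @^-1` B = \bigcup_(z in [set: int])
    ([set x : measurableTypeR R | Num.floor (x * k.+1%:R) = z] `*`
     (f (z%:~R / k.+1%:R) @^-1` B))); last first.
  apply/seteqP; split => [[x t] /= h|[x t] [z _ [/= e h]]].
    by exists (Num.floor (x * k.+1%:R)).
  by rewrite /fl e.
apply: countable_bigcupT_measurable => // z.
apply: measurableX; last by rewrite -[X in measurable X]setTI; exact: mf.
rewrite (_ : mkset _ = (fun x : R => x * k.+1%:R) @^-1` `[z%:~R, (z + 1)%:~R[%classic).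
  have mfun : measurable_fun setT (fun x : R => x * k.+1%:R).
    by apply: measurable_funM => //; exact: measurable_id.
  by rewrite -[X in measurable X]setTI; apply: mfun => //; exact: measurable_itv.
apply/seteqP; split => x /=; rewrite in_itv /=.
  by move=> <-; exact: floor_itv.
by move=> h; apply/floor_def.
Unshelve. all: by end_near. Qed.

(** The coordinates are moved into the parameter space, where only measurability is asked. Thus
    continuity on ['rV[R]_n] yields measurability for the product sigma-algebra of [rn]. *)
Lemma measurable_slices n d (T : measurableType d) (f : 'rV[R]_n -> T -> R) :
  (forall t, continuous (f ^~ t)) -> (forall x, measurable_fun setT (f x)) ->
  measurable_fun [set: rn R n * T] (fun p => f (rn_vec p.1) p.2).
Proof.
elim: n d T f => [|n ih] d T f cf mf.
  by apply: (measurableT_comp (mf 0)); exact: measurable_snd.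
pose g (x : R) (q : rn R n * T) := f (row_mx x%:M (rn_vec q.1)) q.2.
have mg : measurable_fun setT (fun p : measurableTypeR R * (rn R n * T) => g p.1 p.2).
  apply: (@measurable_slices1 _ (rn R n * T)%type g) => [[y t]|x].
    move=> x; apply: (@continuous_comp _ _ _
      (fun x : R => row_mx x%:M (rn_vec y)) (f ^~ t)); last exact: cf.
    apply: (@continuous_comp _ _ _ (fun x : R => x%:M : 'rV[R]_1)
      (fun z => row_mx z (rn_vec y))); first exact: continuous_scal1.
    exact: continuous_row_mxl.
  apply: (ih _ _ (fun y => f (row_mx x%:M y))) => [t y|y]; last exact: mf.
  move=> u; apply: (@continuous_comp _ _ _ (fun y => row_mx x%:M y) (f ^~ t)).
    exact: continuous_row_mxr.
  exact: cf.
pose r (p : rn R n.+1 * T) : measurableTypeR R * (rn R n * T) :=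
  (p.1.1, (p.1.2, p.2)).
have mr : measurable_fun setT r.
  have m1 : measurable_fun setT (fun p : rn R n.+1 * T => p.1) by exact: measurable_fst.
  apply: measurable_fun_pair.
    by apply: (measurableT_comp (f := fst)) m1; exact: measurable_fst.
  apply: measurable_fun_pair; last exact: measurable_snd.
  by apply: (measurableT_comp (f := snd)) m1; exact: measurable_snd.
exact: (measurableT_comp mg mr).
Qed.

Lemma measurable_cont n (f : 'rV[R]_n -> R) : continuous f ->
  measurable_fun [set: rn R n] (fun p => f (rn_vec p)).
Proof.
move=> cf; have mg : measurable_fun [set: rn R n * unit] (fun p => f (rn_vec p.1)).
  by apply: (@measurable_slices n _ unit (fun x _ => f x)) => //.
exact: (measurable_fun_pair1 tt mg).
Qed.

Lemma measurable_cont2 m n (f : 'rV[R]_m -> 'rV[R]_n -> R) :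
  (forall y, continuous (f ^~ y)) -> (forall x, continuous (f x)) ->
  measurable_fun [set: rn R m * rn R n] (fun p => f (rn_vec p.1) (rn_vec p.2)).
Proof.
move=> c1 c2; apply: (@measurable_slices m _ _ (fun x q => f x (rn_vec q))) => //.
by move=> x; exact: measurable_cont.
Qed.

End Caratheodory.

Section RnIntegral.
Variable R : realType.
Notation mu := (@lebesgue_measure R).

Lemma rn_tonelli n (f : measurableTypeR R * rn R n -> \bar R) :
  measurable_fun [set: measurableTypeR R * rn R n] f ->
  (forall p, 0 <= f p)%E ->
  (\int[rn_lebesgue R n.+1]_p f p =
   \int[mu]_x \int[rn_lebesgue R n]_y f (x, y))%E.
Proof.
move=> mf f0; have E := @fubini_tonelli1 _ _ _ _ _ mu (rn_lebesgue R n) f mf f0.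
rewrite /fubini_F in E.
have -> : (\int[rn_lebesgue R n.+1]_p f p = \int[mu \x rn_lebesgue R n]_p f p)%E.
  by reflexivity.
exact: E.
Qed.

(** A tensor product of integrable weights on the line: its integral is [pi ^+ n] by Tonelli, and it
    dominates the bracket to the power -2n. This is the origin of the exponent [n.*2] throughout. *)
Definition wtp n (y : 'rV[R]_n) : R := \prod_i (1 + y 0 i ^+ 2)^-1.

Lemma wtp_ge0 n (y : 'rV[R]_n) : 0 <= wtp y.
Proof. by apply: prodr_ge0 => i _; rewrite invr_ge0 addr_ge0// sqr_ge0. Qed.

Lemma jb_wtp n (y : 'rV[R]_n) : jbracket y ^- n.*2 <= wtp y.
Proof.
rewrite /wtp prodfV lef_pV2 ?posrE ?jbX_gt0//; last first.
  by apply: prodr_gt0 => i _; rewrite ltr_wpDr ?sqr_ge0.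
have -> : jbracket y ^+ n.*2 = \prod_(i < n) jbracket y ^+ 2.
  by rewrite prodr_const card_ord -exprM mul2n.
apply: ler_prod => i _; rewrite addr_ge0 ?sqr_ge0//= jb_sqr lerD2l.
by rewrite dotE (bigD1 i)//= lerDl sumr_ge0// => j _; exact: sqr_ge0.
Qed.

Lemma continuous_at_exprn (V : topologicalType) (f : V -> R) (x : V) k :
  {for x, continuous f} -> {for x, continuous (fun y => f y ^+ k)}.
Proof.
move=> cf; elim: k => [|k ih].
  rewrite (_ : (fun y => _) = cst 1); first exact: cst_continuous.
  by apply/funext => y; rewrite expr0.
rewrite (_ : (fun y => _) = (fun y => f y * f y ^+ k)); first exact: continuousM.
by apply/funext => y; rewrite exprS.
Qed.

Lemma continuous_wtp n : continuous (@wtp n).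
Proof.
rewrite /wtp; elim: (index_enum _) => [|i r ih] y.
  by under eq_fun do rewrite big_nil; exact: cst_continuous.
under eq_fun do rewrite big_cons.
apply: (@continuousM _ _ (fun y : 'rV[R]_n => (1 + y 0 i ^+ 2)^-1)); last exact: ih.
apply: (@continuousV _ _ (fun y : 'rV[R]_n => 1 + y 0 i ^+ 2)).
  by rewrite gt_eqF// ltr_wpDr ?sqr_ge0.
apply: continuousD; first exact: cst_continuous.
by apply: (@continuous_at_exprn _ (fun y : 'rV[R]_n => y 0 i)); exact: coord_continuous.
Qed.

Lemma integral_oneDsqrV : (\int[mu]_x ((1 + x ^+ 2)^-1)%:E = pi%:E)%E.
Proof.
have h := @ge0_symfun_integralT R (fun x => (oneDsqr x)^-1).
rewrite -[LHS]/(\int[mu]_x ((oneDsqr x)^-1)%:E)%E h.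
- rewrite (_ : [set x | (0 <= x)%R] = `[0%R, +oo[%classic); last first.
    by apply/seteqP; split => x; rewrite /= in_itv/= andbT.
  rewrite integral0y_oneDsqr -EFinM; congr (_%:E).
  by rewrite mulrC divfK.
- by move=> x; rewrite invr_ge0 /oneDsqr addr_ge0 ?sqr_ge0.
- by move=> x; exact: continuous_oneDsqrV.
- by move=> x; rewrite /= /oneDsqr sqrrN.
Qed.

Lemma rn_vecS n (p : rn R n.+1) :
  rn_vec p = row_mx (p.1 : R)%:M (rn_vec p.2) :> 'rV[R]_(1 + n).
Proof. by []. Qed.

Lemma wtpS n (x : R) (y : 'rV[R]_n) :
  wtp (row_mx x%:M y : 'rV[R]_(1 + n)) = (1 + x ^+ 2)^-1 * wtp y.
Proof.
rewrite /wtp big_split_ord /= big_ord1 row_mxEl mxE eqxx mulr1n; congr (_ * _).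
by apply: eq_bigr => i _; rewrite row_mxEr.
Qed.

Lemma integral_wtp n :
  (\int[rn_lebesgue R n]_p (wtp (rn_vec p))%:E = (pi ^+ n)%:E)%E.
Proof.
elim: n => [|n ih].
  have mf : measurable_fun [set: rn R 0] (fun p => (wtp (rn_vec p))%:E).
    by apply/measurable_EFinP; apply: measurable_cont; exact: continuous_wtp.
  rewrite [LHS](@integral_dirac _ (rn R 0) tt R setT measurableT _ mf).
  by rewrite diracT mul1e /wtp big_ord0.
rewrite rn_tonelli; last 2 first.
- by apply/measurable_EFinP; exact: (@measurable_cont R n.+1 _ (@continuous_wtp n.+1)).
- by move=> p; rewrite lee_fin wtp_ge0.
under eq_integral => x _.
  under eq_integral => y _ do rewrite rn_vecS /= wtpS EFinM.
  rewrite ge0_integralZl_EFin//; last 3 first.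
  - by move=> y _; rewrite lee_fin wtp_ge0.
  - by apply/measurable_EFinP; apply: measurable_cont; exact: continuous_wtp.
  - by rewrite invr_ge0 addr_ge0 ?sqr_ge0.
  rewrite ih; over.
rewrite ge0_integralZr ?integral_oneDsqrV ?exprS//.
- apply/measurable_EFinP; apply: continuous_measurable_fun.
  by move=> x; exact: continuous_oneDsqrV.
- by move=> x _; rewrite lee_fin invr_ge0 addr_ge0 ?sqr_ge0.
- by rewrite lee_fin exprn_ge0// pi_ge0.
Qed.

Definition mble n (f : 'rV[R]_n -> R) : Prop :=
  measurable_fun [set: rn R n] (fun p => f (rn_vec p)).

Definition rdec n (f : 'rV[R]_n -> R) : Prop :=
  mble f /\ exists C, forall y, `|f y| <= C * jbracket y ^- n.*2.

Lemma rdec_integrable n (f : 'rV[R]_n -> R) : rdec f ->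
  (rn_lebesgue R n).-integrable setT (fun p => (f (rn_vec p))%:E).
Proof.
move=> [mf [C hC]].
have h : (rn_lebesgue R n).-integrable setT (fun p => (`|C| * wtp (rn_vec p))%:E).
  apply/integrableP; split.
    apply/measurable_EFinP; apply: measurable_funM => //.
    exact/measurable_cont/continuous_wtp.
  under eq_integral => p _.
    rewrite gee0_abs; last by rewrite lee_fin mulr_ge0// wtp_ge0.
    over.
  under eq_integral do rewrite EFinM.
  rewrite ge0_integralZl_EFin//; last 2 first.
  - by move=> y _; rewrite lee_fin wtp_ge0.
  - by apply/measurable_EFinP; apply: measurable_cont; exact: continuous_wtp.
  by rewrite integral_wtp -EFinM ltry.
apply: le_integrable h => //; first exact/measurable_EFinP.
move=> p _ /=; rewrite lee_fin (ger0_norm (mulr_ge0 _ (wtp_ge0 _)))//.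
apply: le_trans (hC _) _; apply: ler_pM => //.
- by have := hC (rn_vec p) => /(le_trans (normr_ge0 _)); rewrite pmulr_lge0// jbVX_gt0.
- exact: jbVX_ge0.
- exact: ler_norm.
- exact: jb_wtp.
Qed.

Lemma rdecZ n (c : R) (f : 'rV[R]_n -> R) : rdec f -> rdec (fun y => c * f y).
Proof.
move=> [mf [C hC]]; split.
  by apply: measurable_funM.
by exists (`|c| * C) => y; rewrite normrM -mulrA ler_wpM2l.
Qed.

Lemma rintegralD n (f g : 'rV[R]_n -> R) : rdec f -> rdec g ->
  rintegral (fun y => f y + g y) = rintegral f + rintegral g.
Proof. by move=> hf hg; apply: RintegralD => //; exact: rdec_integrable. Qed.

Lemma rintegralZ n (c : R) (f : 'rV[R]_n -> R) : rdec f ->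
  rintegral (fun y => c * f y) = c * rintegral f.
Proof. by move=> hf; apply: RintegralZl => //; exact: rdec_integrable. Qed.

Lemma continuous_jb n : continuous (@jbracket R n).
Proof.
move=> x; apply: (@continuous_comp _ _ _ (fun x : 'rV[R]_n => 1 + enorm x ^+ 2) Num.sqrt);
  last exact: sqrt_continuous.
rewrite (_ : (fun y => _) = fun x : 'rV[R]_n => 1 + dot x x); last first.
  by apply/funext => y; rewrite /enorm sqr_sqrtr ?dot_ge0.
apply: continuousD; first exact: cst_continuous.
have h (r : seq 'I_n) : continuous (fun z : 'rV[R]_n => \sum_(i <- r) z 0 i * z 0 i).
  elim: r => [|i r ih] y.
    by under eq_fun do rewrite big_nil; exact: cst_continuous.
  under eq_fun do rewrite big_cons.
  apply: (@continuousD _ _ _ (fun z : 'rV[R]_n => z 0 i * z 0 i)); last exact: ih.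
  by apply: continuousM; exact: coord_continuous.
exact: h.
Qed.

Lemma continuous_jbVX n k : continuous (fun y : 'rV[R]_n => jbracket y ^- k).
Proof.
move=> x; apply: (@continuousV _ _ (fun y : 'rV[R]_n => jbracket y ^+ k)).
  by rewrite gt_eqF// jbX_gt0.
by apply: continuous_at_exprn; exact: continuous_jb.
Qed.

Lemma rdec_jb n : rdec (fun y : 'rV[R]_n => jbracket y ^- n.*2).
Proof.
split; first exact/measurable_cont/continuous_jbVX.
by exists 1 => y; rewrite mul1r ger0_norm// jbVX_ge0.
Qed.

Definition cn n : R := rintegral (fun y : 'rV[R]_n => jbracket y ^- n.*2).

Lemma cn_ge0 n : 0 <= cn n.
Proof. by apply: Rintegral_ge0 => p _; exact: jbVX_ge0. Qed.

Lemma rintegral_bound n (f : 'rV[R]_n -> R) (C : R) : mble f ->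
  (forall y, `|f y| <= C * jbracket y ^- n.*2) -> `|rintegral f| <= C * cn n.
Proof.
move=> mf hC; have hf : rdec f by split => //; exists C.
apply: le_trans (le_normr_Rintegral _ (rdec_integrable hf)) _ => //.
rewrite /cn -rintegralZ; last exact: rdec_jb.
apply: le_Rintegral => //.
- apply: (@rdec_integrable _ (fun y => `|f y|)); split.
    exact: measurableT_comp.
  by exists C => y; rewrite normr_id.
- exact: (rdec_integrable (rdecZ C (rdec_jb n))).
Qed.

(** Separate continuity gives joint measurability, and the two decay factors are dominated by [wtp],
    whose integral is known; Fubini then applies. *)
Lemma rintegral_swap m k (f : 'rV[R]_m -> 'rV[R]_k -> R) (C : R) :
  (forall y, continuous (f ^~ y)) -> (forall x, continuous (f x)) ->
  (forall x y, `|f x y| <= C * jbracket x ^- m.*2 * jbracket y ^- k.*2) ->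
  rintegral (fun x => rintegral (f x)) = rintegral (fun y => rintegral (f ^~ y)).
Proof.
move=> c1 c2 hC.
have mf : measurable_fun setT
    (fun p : rn R m * rn R k => (f (rn_vec p.1) (rn_vec p.2))%:E).
  by apply/measurable_EFinP; exact: (measurable_cont2 c1 c2).
have C0 : 0 <= C.
  have := hC 0 0 => /(le_trans (normr_ge0 _)).
  by rewrite -mulrA pmulr_lge0// mulr_gt0 ?jbVX_gt0.
have intf : (rn_lebesgue R m \x rn_lebesgue R k)%E.-integrable setT
    (fun p : rn R m * rn R k => (f (rn_vec p.1) (rn_vec p.2))%:E).
  apply/integrable12ltyP => //=.
  apply: (@le_lt_trans _ _ (\int[rn_lebesgue R m]_x
      (C * wtp (rn_vec x) * pi ^+ k)%:E)%E).
    apply: ge0_le_integral => //.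
    - by move=> x _; apply: integral_ge0.
    - have := @measurable_fun_fubini_tonelli_F _ _ _ _ _ (rn_lebesgue R k)
        (fun p => `|(f (rn_vec p.1) (rn_vec p.2))%:E|%E).
      by apply => //; exact: measurableT_comp.
    - apply/measurable_EFinP; apply: measurable_funM => //.
      apply: measurable_funM => //.
      exact/measurable_cont/continuous_wtp.
    - move=> x _; rewrite EFinM -integral_wtp -ge0_integralZl_EFin//; last 3 first.
      + by move=> y _; rewrite lee_fin wtp_ge0.
      + by apply/measurable_EFinP; apply: measurable_cont; exact: continuous_wtp.
      + by rewrite mulr_ge0// wtp_ge0.
      apply: ge0_le_integral => //.
      + apply/measurable_EFinP; apply: measurableT_comp => //.
        exact: (measurable_cont (c2 (rn_vec x))).
      + apply: emeasurable_funM; first exact: measurable_cst.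
        by apply/measurable_EFinP; apply: measurable_cont; exact: continuous_wtp.
      + move=> y _; rewrite -EFinM lee_fin; apply: le_trans (hC _ _) _.
        by apply: ler_pM; rewrite ?mulr_ge0 ?jbVX_ge0// ?jb_wtp// ler_wpM2l ?jb_wtp.
  under eq_integral => x _.
    rewrite (_ : C * wtp (rn_vec x) * pi ^+ k = (C * pi ^+ k) * wtp (rn_vec x));
      last by rewrite mulrAC.
    rewrite EFinM; over.
  rewrite ge0_integralZl_EFin//; last 3 first.
  - by move=> y _; rewrite lee_fin wtp_ge0.
  - by apply/measurable_EFinP; apply: measurable_cont; exact: continuous_wtp.
  - by rewrite mulr_ge0// exprn_ge0// pi_ge0.
  by rewrite integral_wtp -EFinM ltry.
have := Fubini intf; rewrite /= => E.
rewrite /rintegral /Rintegral; congr fine.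
transitivity (\int[rn_lebesgue R m]_x \int[rn_lebesgue R k]_y
    (f (rn_vec x) (rn_vec y))%:E)%E.
  apply: eq_integral => x _; rewrite fineK//; apply: integrable_fin_num => //.
  apply: rdec_integrable; split; first exact: (measurable_cont (c2 (rn_vec x))).
  by exists (C * jbracket (rn_vec x) ^- m.*2) => y; exact: hC.
rewrite E; apply: eq_integral => y _; rewrite fineK//; apply: integrable_fin_num => //.
apply: (@rdec_integrable _ (f ^~ (rn_vec y))).
split; first exact: (measurable_cont (c1 (rn_vec y))).
by exists (C * jbracket (rn_vec y) ^- k.*2) => x; rewrite mulrAC; exact: hC.
Qed.

End RnIntegral.

(** * Splitting of integrals over a product and affine substitution *)

Section RnSplit.
Variable R : realType.
Notation mu := (@lebesgue_measure R).

Lemma row_mx_nil k (x : 'rV[R]_0) (y : 'rV[R]_k) : row_mx x y = y :> 'rV[R]_(0 + k).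
Proof.
apply/rowP => j; have -> : j = rshift 0 (j : 'I_k) by apply: val_inj.
by rewrite row_mxEr; congr (y _ _); exact: val_inj.
Qed.

Lemma row_mx_assoc m k (t : 'rV[R]_1) (x : 'rV[R]_m) (y : 'rV[R]_k) :
  row_mx (row_mx t x : 'rV[R]_(1 + m)) y = row_mx t (row_mx x y) :> 'rV[R]_(1 + (m + k)).
Proof.
by rewrite (@row_mxA _ _ 1 m k) castmx_id.
Qed.

Lemma measurable_row m k (F : 'rV[R]_(m + k) -> R) : continuous F ->
  measurable_fun [set: rn R m * rn R k]
    (fun z => (F (row_mx (rn_vec z.1) (rn_vec z.2)))%:E).
Proof.
move=> cF; apply/measurable_EFinP.
apply: (@measurable_cont2 R m k (fun x y => F (row_mx x y))) => [y|x] u.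
  apply: (@continuous_comp _ _ _ (fun x => row_mx x y) F); last exact: cF.
  exact: continuous_row_mxl.
apply: (@continuous_comp _ _ _ (fun y => row_mx x y) F); last exact: cF.
exact: continuous_row_mxr.
Qed.

Lemma continuous_pos_part n (f : 'rV[R]_n -> R) : continuous f ->
  continuous (fun z => Num.max (f z) 0).
Proof.
move=> cf; rewrite (_ : (fun z => _) = fun z => (f z + `|f z|) / 2).
  move=> z; apply: (@continuousM _ _ (fun z => f z + `|f z|) (cst (2^-1 : R)));
    last exact: cst_continuous.
  apply: continuousD; first exact: cf.
  by apply: (@continuous_comp _ _ _ f Num.norm); [exact: cf|exact: norm_continuous].
by apply/funext => z; rewrite maxr_absE addr0 subr0.
Qed.

Lemma split_ge0 m k (F : 'rV[R]_(m + k) -> R) : continuous F -> (forall z, 0 <= F z) ->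
  (\int[rn_lebesgue R (m + k)]_p (F (rn_vec p))%:E =
   \int[rn_lebesgue R m]_p \int[rn_lebesgue R k]_q
      (F (row_mx (rn_vec p) (rn_vec q)))%:E)%E.
Proof.
elim: m F => [|m ih] F cF F0.
  pose G (p : rn R 0) := (\int[rn_lebesgue R k]_q
    (F (row_mx (rn_vec p) (rn_vec q)))%:E)%E.
  have mG : measurable_fun [set: rn R 0] G.
    rewrite (_ : G = cst (G tt)); first exact: measurable_cst.
    by apply/funext => -[].
  rewrite [RHS](@integral_dirac _ (rn R 0) tt R setT measurableT _ mG).
  rewrite diracT mul1e; apply: eq_integral => q _.
  by congr (F _)%:E; rewrite -[LHS](row_mx_nil 0).
have cF' x : continuous (fun z : 'rV[R]_(m + k) => F (row_mx (x%:M : 'rV[R]_1) z)).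
  move=> u; apply: (@continuous_comp _ _ _
    (fun z : 'rV[R]_(m + k) => (row_mx (x%:M : 'rV[R]_1) z)) F); last exact: cF.
  exact: continuous_row_mxr.
rewrite (@rn_tonelli R (m + k) (fun p => (F (rn_vec (p : rn R (m + k).+1)))%:E)).
- rewrite (@rn_tonelli R m (fun p => (\int[rn_lebesgue R k]_q
    (F (row_mx (rn_vec (p : rn R m.+1)) (rn_vec q)))%:E)%E)).
  + apply: eq_integral => x _.
    rewrite (ih (fun z => F (row_mx (x%:M : 'rV[R]_1) z)) (cF' x)) => [|z]; last exact: F0.
    apply: eq_integral => p _; apply: eq_integral => q _.
    by rewrite rn_vecS row_mx_assoc.
  + have := @measurable_fun_fubini_tonelli_F _ _ _ _ _ (rn_lebesgue R k) _
      (@measurable_row m.+1 k F cF).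
    by apply => p; rewrite lee_fin.
  + by move=> p; apply: integral_ge0 => q _; rewrite lee_fin.
- by apply/measurable_EFinP; exact: (@measurable_cont R (m + k).+1 F cF).
- by move=> p; rewrite lee_fin.
Qed.

(** The positive and negative parts of a continuous function are continuous, so [split_ge0] applies
    to each. *)
Lemma split_prod m k (F : 'rV[R]_(m + k) -> R) : continuous F ->
  (\int[rn_lebesgue R (m + k)]_p (F (rn_vec p))%:E =
   \int[rn_lebesgue R m \x rn_lebesgue R k]_z
      (F (row_mx (rn_vec z.1) (rn_vec z.2)))%:E)%E.
Proof.
move=> cF.
have key (G : 'rV[R]_(m + k) -> R) : continuous G -> (forall z, 0 <= G z) ->
    (\int[rn_lebesgue R (m + k)]_p (G (rn_vec p))%:E =
     \int[rn_lebesgue R m \x rn_lebesgue R k]_z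
        (G (row_mx (rn_vec z.1) (rn_vec z.2)))%:E)%E.
  move=> cG G0; rewrite split_ge0//.
  have E := @fubini_tonelli1 _ _ _ _ _ (rn_lebesgue R m) (rn_lebesgue R k) _ 
     (measurable_row cG).
  by rewrite E// => z; rewrite lee_fin.
pose Fp z := Num.max (F z) 0; pose Fn z := Num.max (- F z) 0.
have cp : continuous Fp.
  exact: continuous_pos_part.
have cn : continuous Fn.
  by apply: continuous_pos_part => z; apply: continuousN; exact: cF.
rewrite integralE [in RHS]integralE; congr (_ - _)%E.
- transitivity (\int[rn_lebesgue R (m + k)]_p (Fp (rn_vec p))%:E)%E.
    by apply: eq_integral => p _; rewrite funeposE EFin_max.
  rewrite key//; last by move=> z; rewrite le_max lexx orbT.
  by apply: eq_integral => p _; rewrite funeposE EFin_max.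
- transitivity (\int[rn_lebesgue R (m + k)]_p (Fn (rn_vec p))%:E)%E.
    by apply: eq_integral => p _; rewrite funenegE EFin_max.
  rewrite key//; last by move=> z; rewrite le_max lexx orbT.
  by apply: eq_integral => p _; rewrite funenegE EFin_max.
Qed.

Lemma jbVX_row m k (x : 'rV[R]_m) (y : 'rV[R]_k) a b :
  jbracket (row_mx x y) ^- (a + b) <= jbracket x ^- a * jbracket y ^- b.
Proof.
rewrite exprD invfM; apply: ler_pM; rewrite ?jbVX_ge0//.
  rewrite lef_pV2 ?posrE ?jbX_gt0//.
  by apply: lerXn2r; rewrite ?nnegrE ?jb_ge0// jb_rowl.
rewrite lef_pV2 ?posrE ?jbX_gt0//.
by apply: lerXn2r; rewrite ?nnegrE ?jb_ge0// jb_rowr.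
Qed.

Lemma rintegral_split m k (F : 'rV[R]_(m + k) -> R) : continuous F -> rdec F ->
  rintegral F = rintegral (fun x => rintegral (fun y => F (row_mx x y))).
Proof.
move=> cF dF; have iF := rdec_integrable dF.
have [_ [C hC]] := dF.
rewrite /rintegral /Rintegral split_prod//; congr fine.
have iF2 : (rn_lebesgue R m \x rn_lebesgue R k)%E.-integrable setT
    (fun z => (F (row_mx (rn_vec z.1) (rn_vec z.2)))%:E).
  apply/integrableP; split; first exact: measurable_row.
  have /integrableP[_] := iF.
  rewrite (@split_prod m k (fun z => `|F z|))//.
  by move=> z; apply: (@continuous_comp _ _ _ F Num.norm); [exact: cF|exact: norm_continuous].
rewrite -(integral12_prod_meas1 iF2) /fubini_F.
apply: eq_integral => x _; rewrite fineK//.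
apply: integrable_fin_num => //.
apply: (@rdec_integrable _ _ (fun y => F (row_mx (rn_vec x) y))); split.
  apply: measurable_cont => u.
  apply: (@continuous_comp _ _ _ (fun y => row_mx (rn_vec x) y) F); last exact: cF.
  exact: continuous_row_mxr.
exists (C * jbracket (rn_vec x) ^- m.*2) => y.
have C0 : 0 <= C.
  by have := hC 0 => /(le_trans (normr_ge0 _)); rewrite pmulr_lge0// jbVX_gt0.
apply: le_trans (hC _) _; rewrite -mulrA ler_wpM2l// doubleD; exact: jbVX_row.
Qed.

Lemma affine1_ge0 (g : R -> R) (a c : R) : 0 < a -> continuous g -> (forall x, 0 <= g x) ->
  (\int[mu]_x (g x)%:E = a%:E * \int[mu]_x (g (a * x + c))%:E)%E.
Proof.
move=> a0 cg g0.
pose F (x : R) : R := a * x + c.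
have dF (x : R) : is_derive x (1 : R) F a.
  rewrite /F; have h : is_derive x (1 : R) (fun x : R => a *: x) (a *: (1 : R)).
    exact: is_deriveZ.
  have h2 := is_deriveD h (is_derive_cst c x 1).
  by apply: (is_derive_eq h2); rewrite addr0 /GRing.scale/= mulr1.
have dFE : F^`()%classic = cst a.
  by apply/funext => x; rewrite derive1E derive_val.
have cF : continuous F.
  move=> x; apply/differentiable_continuous/derivable1_diffP.
  by have := dF x => -[].
have := @increasing_ge0_integration_by_substitutionT R F g.
rewrite dFE => -> //; last 6 first.
- by move=> x y xy; rewrite /F ltrD2r ltr_pM2l.
- exact: cst_continuous.
- exact: is_cvg_cst.
- exact: is_cvg_cst.
- apply/cvgrNyPle => A.
  apply: filterS (nbhs_ninfty_le (num_real ((A - c) / a))) => x hx.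
  by rewrite /F -lerBrDr mulrC -ler_pdivlMr.
- apply/cvgryPge => A.
  apply: filterS (nbhs_pinfty_ge (num_real ((A - c) / a))) => x hx.
  by rewrite /F -lerBlDr mulrC -ler_pdivrMr.
rewrite -ge0_integralZl_EFin//; last 3 first.
- by move=> x _; rewrite lee_fin.
- apply/measurable_EFinP; apply: continuous_measurable_fun => x.
  by apply: (@continuous_comp _ _ _ F g); [exact: cF|exact: cg].
- exact: ltW.
by apply: eq_integral => x _; rewrite -EFinM /= mulrC.
Qed.

Lemma affine_ge0 n (f : 'rV[R]_n -> R) (a : R) (c : 'rV[R]_n) : 0 < a ->
  continuous f -> (forall x, 0 <= f x) ->
  (\int[rn_lebesgue R n]_p (f (rn_vec p))%:E =
   (a ^+ n)%:E * \int[rn_lebesgue R n]_p (f (a *: rn_vec p + c))%:E)%E.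
Proof.
move=> a0; elim: n f c => [|n ih] f c cf f0.
  rewrite expr0 mul1e; apply: eq_integral => p _; congr (f _)%:E.
  by apply/rowP => -[].
pose c0 : 'rV[R]_1 := @lsubmx _ _ 1 n c; pose c1 : 'rV[R]_n := @rsubmx _ _ 1 n c.
pose f1 (z : 'rV[R]_(1 + n)) := f (row_mx (a *: lsubmx z + c0) (rsubmx z)).
pose L (z : 'rV[R]_(1 + n)) := row_mx (a *: lsubmx z + c0) (rsubmx z).
have cL : continuous L.
  move=> z; apply: differentiable_continuous.
  apply: (@dirmap_differentiable _ _ _ L
    (fun i => row_mx (a *: lsubmx (delta_mx 0 i : 'rV_(1 + n)))
      (rsubmx (delta_mx 0 i : 'rV_(1 + n))))).
  move=> i t x; rewrite /L scale_row_mx add_row_mx; congr (row_mx _ _).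
    by rewrite linearP /= scalerDr !scalerA [a * t]mulrC addrA.
  by rewrite linearP.
have cf1 : continuous f1.
  by move=> z; apply: (@continuous_comp _ _ _ L f); [exact: cL|exact: cf].
(* Only the first coordinate is rescaled: Tonelli makes it the inner variable, where the
   substitution on the line applies. The other coordinates are left to the induction hypothesis. *)
have step1 : (\int[rn_lebesgue R n.+1]_p (f (rn_vec p))%:E =
    a%:E * \int[rn_lebesgue R n.+1]_p (f1 (rn_vec p))%:E)%E.
  have m0 := @measurable_cont R n.+1 f cf; have m1 := @measurable_cont R n.+1 f1 cf1.
  have {}m0 : measurable_fun [set: measurableTypeR R * rn R n]
    (fun p => (f (rn_vec (p : rn R n.+1)))%:E) by apply/measurable_EFinP.
  have {}m1 : measurable_fun [set: measurableTypeR R * rn R n]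
    (fun p => (f1 (rn_vec (p : rn R n.+1)))%:E) by apply/measurable_EFinP.
  rewrite (rn_tonelli m0) => [|p]; last by rewrite lee_fin.
  rewrite (rn_tonelli m1) => [|p]; last by rewrite lee_fin f0.
  rewrite (@fubini_tonelli _ _ _ _ _ mu (rn_lebesgue R n) _ m0) => [|p]; last by rewrite lee_fin.
  rewrite (@fubini_tonelli _ _ _ _ _ mu (rn_lebesgue R n) _ m1) => [|p]; last by rewrite lee_fin f0.
  rewrite -ge0_integralZl_EFin//; last 3 first.
  - by move=> y _; apply: integral_ge0 => x _; rewrite lee_fin f0.
  - have := @measurable_fun_fubini_tonelli_G _ _ _ _ _ mu _ m1.
    by apply => p; rewrite lee_fin f0.
  - exact: ltW.
  apply: eq_integral => y _.
  rewrite (@affine1_ge0 (fun x => f (row_mx (x%:M : 'rV_1) (rn_vec y))) a (c0 0 0))//.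
    congr (_ * _)%E; apply: eq_integral => x _.
    rewrite /f1 rn_vecS /= row_mxKl row_mxKr; congr (EFin (f _)).
    have -> : a *: x%:M + c0 = (a * x + c0 0 0)%:M.
      by apply/rowP => i; rewrite !ord1 !mxE eqxx !mulr1n.
    by [].
  move=> u; apply: (@continuous_comp _ _ _ (fun x : R => row_mx (x%:M : 'rV_1) (rn_vec y)) f);
    last exact: cf.
  apply: (@continuous_comp _ _ _ (fun x : R => x%:M : 'rV[R]_1)
      (fun z => row_mx z (rn_vec y))); first exact: continuous_scal1.
  exact: continuous_row_mxl.
rewrite step1 exprS EFinM -muleA; congr (_ * _)%E.
pose L2 (z : 'rV[R]_(1 + n)) := a *: z + c.
have m1 : measurable_fun [set: measurableTypeR R * rn R n]
    (fun p => (f1 (rn_vec (p : rn R n.+1)))%:E).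
  by apply/measurable_EFinP; exact: (@measurable_cont R n.+1 f1 cf1).
have cf2 : continuous (fun z : 'rV[R]_(1 + n) => f (a *: z + c)).
  move=> z; apply: (@continuous_comp _ _ _ L2 f); last exact: cf.
  apply: continuousD; last exact: cst_continuous.
  exact: scaler_continuous.
have m2 : measurable_fun [set: measurableTypeR R * rn R n]
    (fun p => (f (a *: (rn_vec (p : rn R n.+1)) + c))%:E).
  by apply/measurable_EFinP; exact: (@measurable_cont R n.+1 _ cf2).
rewrite (rn_tonelli m1) => [|p]; last by rewrite lee_fin f0.
rewrite (rn_tonelli m2) => [|p]; last by rewrite lee_fin f0.
rewrite -ge0_integralZl_EFin//; last 3 first.
- by move=> y _; apply: integral_ge0 => x _; rewrite lee_fin f0.
- have := @measurable_fun_fubini_tonelli_F _ _ _ _ _ (rn_lebesgue R n) _ m2.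
  by apply => p; rewrite lee_fin f0.
- by rewrite exprn_ge0// ltW.
apply: eq_integral => x _.
rewrite (ih (fun y => f1 (row_mx (x%:M : 'rV_1) y)) c1)//.
- congr (_ * _)%E; apply: eq_integral => y _.
  rewrite /f1 rn_vecS /= row_mxKl row_mxKr; congr (EFin (f _)).
  transitivity (a *: (row_mx x%:M (rn_vec y) : 'rV[R]_(1 + n)) + row_mx c0 c1).
    by rewrite (@scale_row_mx _ _ 1 n) (@add_row_mx _ _ 1 n).
  by rewrite /c0 /c1 hsubmxK.
- move=> u; apply: (@continuous_comp _ _ _ (fun y => row_mx (x%:M : 'rV_1) y) f1);
    last exact: cf1.
  exact: continuous_row_mxr.
- by move=> z; exact: f0.
Qed.

Lemma rintegral_affine n (f : 'rV[R]_n -> R) (a : R) (c : 'rV[R]_n) : 0 < a ->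
  continuous f -> rdec f ->
  rintegral f = a ^+ n * rintegral (fun x => f (a *: x + c)).
Proof.
move=> a0 cf df; have := rdec_integrable df => iF.
have an0 : 0 < a ^+ n by rewrite exprn_gt0.
pose Fp z := Num.max (f z) 0; pose Fn z := Num.max (- f z) 0.
have cp : continuous Fp.
  exact: continuous_pos_part.
have cn : continuous Fn.
  by apply: continuous_pos_part => z; apply: continuousN; exact: cf.
have p0 z : 0 <= Fp z by rewrite le_max lexx orbT.
have n0 z : 0 <= Fn z by rewrite le_max lexx orbT.
have ep := affine_ge0 c a0 cp p0; have en := affine_ge0 c a0 cn n0.
have fp := integrable_pos_fin_num measurableT iF.
have fn := integrable_neg_fin_num measurableT iF.
rewrite /rintegral /Rintegral [in LHS]integralE [in RHS]integralE.
rewrite (_ : (fun p => _)^\+ = fun p : rn R n => (Fp (rn_vec p))%:E)%E in fp *; last first.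
  by apply/funext => p; rewrite funeposE EFin_max.
rewrite (_ : (fun p => _)^\- = fun p : rn R n => (Fn (rn_vec p))%:E)%E in fn *; last first.
  by apply/funext => p; rewrite funenegE EFin_max.
rewrite [in RHS](_ : (fun p => _)^\+ = fun p : rn R n => (Fp (a *: rn_vec p + c))%:E)%E;
  last by apply/funext => p; rewrite funeposE EFin_max.
rewrite [in RHS](_ : (fun p => _)^\- = fun p : rn R n => (Fn (a *: rn_vec p + c))%:E)%E;
  last by apply/funext => p; rewrite funenegE EFin_max.
move: fp fn; rewrite ep en.
(* Finiteness is known before the substitution and passes to the integrals after it because [a ^+ n]
   is positive; it is needed to subtract the two parts. *)
have aux (x : \bar R) : (0 <= x)%E -> ((a ^+ n)%:E * x)%E \is a fin_num -> x \is a fin_num.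
  by case: x => //= _; rewrite gt0_muley// lte_fin.
move=> /aux fp /aux fn.
have {}fp : (\int[rn_lebesgue R n]_p (Fp (a *: rn_vec p + c))%:E)%E \is a fin_num.
  by apply: fp; apply: integral_ge0 => p _; rewrite lee_fin.
have {}fn : (\int[rn_lebesgue R n]_p (Fn (a *: rn_vec p + c))%:E)%E \is a fin_num.
  by apply: fn; apply: integral_ge0 => p _; rewrite lee_fin.
rewrite -(fineK fp) -(fineK fn) -!EFinM -!EFinB /=.
by rewrite mulrBr.
Qed.
End RnSplit.

(** * Integrals of complex-valued functions *)

Section ComplexIntegral.
Variable R : realType.

Definition ccont (V : topologicalType) (f : V -> R[i]) : Prop :=
  continuous (fun x => complex.Re (f x)) /\ continuous (fun x => complex.Im (f x)).

Lemma cdiff_ccont (V : normedModType R) (f : V -> R[i]) :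
  (forall x, cdiff f x) -> ccont f.
Proof.
by move=> h; split; [exact: cdiff_continuous_Re|exact: cdiff_continuous_Im].
Qed.

Lemma smooth_ccont n (f : 'rV[R]_n -> R[i]) : smooth f -> ccont f.
Proof. by move=> h; apply: cdiff_ccont => x; exact: smooth_cdiff. Qed.

Lemma ccont_comp (V W : topologicalType) (L : V -> W) (f : W -> R[i]) :
  continuous L -> ccont f -> ccont (fun x => f (L x)).
Proof.
move=> cL [f1 f2]; split=> x.
- by apply: (@continuous_comp _ _ _ L (fun x => complex.Re (f x))); [exact: cL|exact: f1].
- by apply: (@continuous_comp _ _ _ L (fun x => complex.Im (f x))); [exact: cL|exact: f2].
Qed.

Lemma ccontM (V : topologicalType) (f g : V -> R[i]) :
  ccont f -> ccont g -> ccont (fun x => f x * g x).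
Proof.
move=> [f1 f2] [g1 g2]; split.
- rewrite (_ : (fun x => _) = (fun x => complex.Re (f x) * complex.Re (g x) -
    complex.Im (f x) * complex.Im (g x))); last by apply/funext => x; rewrite cReM.
  move=> x; apply: (@continuousB _ _ _ (fun x => complex.Re (f x) * complex.Re (g x))
    (fun x => complex.Im (f x) * complex.Im (g x))); apply: continuousM;
    [exact: f1|exact: g1|exact: f2|exact: g2].
- rewrite (_ : (fun x => _) = (fun x => complex.Re (f x) * complex.Im (g x) +
    complex.Im (f x) * complex.Re (g x))); last by apply/funext => x; rewrite cImM.
  move=> x; apply: (@continuousD _ _ _ (fun x => complex.Re (f x) * complex.Im (g x))
    (fun x => complex.Im (f x) * complex.Re (g x))); apply: continuousM;
    [exact: f1|exact: g2|exact: f2|exact: g1].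
Qed.

Lemma ccont_cst (V : topologicalType) (c : R[i]) : ccont (fun _ : V => c).
Proof. by split => x; exact: cst_continuous. Qed.

Definition cmble n (f : 'rV[R]_n -> R[i]) : Prop :=
  mble (fun x => complex.Re (f x)) /\ mble (fun x => complex.Im (f x)).

Lemma ccont_cmble n (f : 'rV[R]_n -> R[i]) : ccont f -> cmble f.
Proof. by move=> [f1 f2]; split; exact: measurable_cont. Qed.

Definition dec n (f : 'rV[R]_n -> R[i]) : Prop :=
  cmble f /\ exists C, forall y, cabs (f y) <= C * jbracket y ^- n.*2.

Lemma dec_Re n (f : 'rV[R]_n -> R[i]) : dec f -> rdec (fun x => complex.Re (f x)).
Proof.
move=> [[m1 m2] [C hC]]; split => //; exists C => y.
exact: le_trans (le_Re_cabs _) _.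
Qed.

Lemma dec_Im n (f : 'rV[R]_n -> R[i]) : dec f -> rdec (fun x => complex.Im (f x)).
Proof.
move=> [[m1 m2] [C hC]]; split => //; exists C => y.
exact: le_trans (le_Im_cabs _) _.
Qed.

Lemma cmbleD n (f g : 'rV[R]_n -> R[i]) : cmble f -> cmble g ->
  cmble (fun x => f x + g x).
Proof.
move=> [f1 f2] [g1 g2]; split; rewrite /mble.
- by under eq_fun do rewrite cReD; exact: measurable_funD.
- by under eq_fun do rewrite cImD; exact: measurable_funD.
Qed.

Lemma cmbleM n (f g : 'rV[R]_n -> R[i]) : cmble f -> cmble g ->
  cmble (fun x => f x * g x).
Proof.
move=> [f1 f2] [g1 g2]; split; rewrite /mble.
- under eq_fun do rewrite cReM.
  by apply: measurable_funB; exact: measurable_funM.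
- under eq_fun do rewrite cImM.
  by apply: measurable_funD; exact: measurable_funM.
Qed.

Lemma cmble_cst n (c : R[i]) : cmble (fun _ : 'rV[R]_n => c).
Proof. by split; exact: measurable_cst. Qed.

Lemma decD n (f g : 'rV[R]_n -> R[i]) : dec f -> dec g -> dec (fun x => f x + g x).
Proof.
move=> [f1 [C hC]] [g1 [D hD]]; split; first exact: cmbleD.
exists (C + D) => y; apply: le_trans (cabsD _ _) _.
by rewrite mulrDl lerD.
Qed.

Lemma decZ n (c : R[i]) (f : 'rV[R]_n -> R[i]) : dec f -> dec (fun x => c * f x).
Proof.
move=> [f1 [C hC]]; split; first by apply: cmbleM => //; exact: cmble_cst.
by exists (cabs c * C) => y; rewrite cabsM -mulrA ler_wpM2l ?cabs_ge0.
Qed.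

Lemma dec0 n : dec (fun _ : 'rV[R]_n => 0).
Proof.
split; first exact: cmble_cst.
by exists 0 => y; rewrite cabs0 mul0r.
Qed.

Lemma dec_sum n (I : Type) (r : seq I) (F : I -> 'rV[R]_n -> R[i]) :
  (forall i, dec (F i)) -> dec (fun x => \sum_(i <- r) F i x).
Proof.
move=> h; elim: r => [|i r ih].
  by under eq_fun do rewrite big_nil; exact: dec0.
by under eq_fun do rewrite big_cons; exact: decD.
Qed.

Lemma dec_cont n (f : 'rV[R]_n -> R[i]) (C : R) : ccont f ->
  (forall y, cabs (f y) <= C * jbracket y ^- n.*2) -> dec f.
Proof. by move=> h hC; split; [exact: ccont_cmble|exists C]. Qed.

Lemma cintegralD n (f g : 'rV[R]_n -> R[i]) : dec f -> dec g ->
  cintegral (fun x => f x + g x) = cintegral f + cintegral g.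
Proof.
move=> hf hg; apply: ceq; rewrite ?cReD ?cImD /=.
- by rewrite -rintegralD; [|exact: dec_Re|exact: dec_Re];
    under eq_fun do rewrite cReD.
- by rewrite -rintegralD; [|exact: dec_Im|exact: dec_Im];
    under eq_fun do rewrite cImD.
Qed.

Lemma cintegralZ n (c : R[i]) (f : 'rV[R]_n -> R[i]) : dec f ->
  cintegral (fun x => c * f x) = c * cintegral f.
Proof.
move=> hf; have h1 := dec_Re hf; have h2 := dec_Im hf.
apply: ceq; rewrite ?cReM ?cImM /=.
- under eq_fun do rewrite cReM -mulNr.
  by rewrite rintegralD ?rintegralZ//; [rewrite mulNr|exact: rdecZ|exact: rdecZ].
- under eq_fun do rewrite cImM.
  by rewrite rintegralD ?rintegralZ//; exact: rdecZ.
Qed.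

Lemma cintegral0 n : cintegral (fun _ : 'rV[R]_n => 0) = 0 :> R[i].
Proof.
by have := @cintegralZ n 0 _ (dec0 n); rewrite !mul0r.
Qed.

Lemma cintegral_sum n (I : Type) (r : seq I) (F : I -> 'rV[R]_n -> R[i]) :
  (forall i, dec (F i)) ->
  cintegral (fun x => \sum_(i <- r) F i x) = \sum_(i <- r) cintegral (F i).
Proof.
move=> h; elim: r => [|i r ih].
  by under eq_fun do rewrite big_nil; rewrite big_nil cintegral0.
under eq_fun do rewrite big_cons.
by rewrite big_cons cintegralD ?ih//; exact: dec_sum.
Qed.

Lemma decN n (f : 'rV[R]_n -> R[i]) : dec f -> dec (fun x => - f x).
Proof. by move=> /(decZ (-1)); under eq_fun do rewrite mulN1r. Qed.

Lemma decB n (f g : 'rV[R]_n -> R[i]) : dec f -> dec g -> dec (fun x => f x - g x).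
Proof. by move=> hf hg; apply: decD => //; exact: decN. Qed.

Lemma cintegralB n (f g : 'rV[R]_n -> R[i]) : dec f -> dec g ->
  cintegral (fun x => f x - g x) = cintegral f - cintegral g.
Proof.
move=> hf hg; rewrite cintegralD//; last exact: decN.
by rewrite -[- cintegral g]mulN1r -cintegralZ//; under [in RHS]eq_fun do rewrite mulN1r.
Qed.

Lemma cintegral_bound n (f : 'rV[R]_n -> R[i]) (C : R) : cmble f ->
  (forall y, cabs (f y) <= C * jbracket y ^- n.*2) ->
  cabs (cintegral f) <= 2 * cn R n * C.
Proof.
move=> [m1 m2] hC; apply: le_trans (cabs_le_ReIm _) _ => /=.
rewrite -mulrA mulr2n mulrDl mul1r [cn R n * C]mulrC; apply: lerD.
- apply: rintegral_bound => // y; exact: le_trans (le_Re_cabs _) _.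
- apply: rintegral_bound => // y; exact: le_trans (le_Im_cabs _) _.
Qed.

Lemma cintegral_swap m k (f : 'rV[R]_m -> 'rV[R]_k -> R[i]) (C : R) :
  (forall y, ccont (f ^~ y)) -> (forall x, ccont (f x)) ->
  (forall x y, cabs (f x y) <= C * jbracket x ^- m.*2 * jbracket y ^- k.*2) ->
  cintegral (fun x => cintegral (f x)) = cintegral (fun y => cintegral (f ^~ y)).
Proof.
move=> c1 c2 hC; apply: ceq => /=.
- apply: (@rintegral_swap _ _ _ (fun x y => complex.Re (f x y)) C) => [y|x|x y].
  + by case: (c1 y).
  + by case: (c2 x).
  + exact: le_trans (le_Re_cabs _) _.
- apply: (@rintegral_swap _ _ _ (fun x y => complex.Im (f x y)) C) => [y|x|x y].
  + by case: (c1 y).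
  + by case: (c2 x).
  + exact: le_trans (le_Im_cabs _) _.
Qed.

Lemma cintegral_split m k (F : 'rV[R]_(m + k) -> R[i]) : ccont F -> dec F ->
  cintegral F = cintegral (fun x => cintegral (fun y => F (row_mx x y))).
Proof.
move=> [c1 c2] dF; apply: ceq => /=.
- exact: (rintegral_split c1 (dec_Re dF)).
- exact: (rintegral_split c2 (dec_Im dF)).
Qed.

Lemma cintegral_affine n (f : 'rV[R]_n -> R[i]) (a : R) (c : 'rV[R]_n) : 0 < a ->
  ccont f -> dec f ->
  cintegral f = (a ^+ n)%:C * cintegral (fun x => f (a *: x + c)).
Proof.
move=> a0 [c1 c2] df; apply: ceq; rewrite ?cRe_real ?cIm_real /=.
- exact: (rintegral_affine c a0 c1 (dec_Re df)).
- exact: (rintegral_affine c a0 c2 (dec_Im df)).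
Qed.
End ComplexIntegral.

(** * Differentiation under the integral sign *)

Section ParametricIntegral.
Variables (R : realType) (m k : nat).

Lemma taylor2 (f : 'rV[R]_m -> R[i]) x h (B : R) : smooth f ->
  (forall t, 0 <= t <= 1 -> forall s, size s = 2%N ->
     cabs (pderivs s f (x + t *: h)) <= B) ->
  cabs (f (x + h) - f x - \sum_i (h 0 i)%:C * pderiv i f x) <= 2 * (l1 h ^+ 2 * B).
Proof.
move=> hf hB; apply: le_trans (taylor hf hB).
rewrite !big_ord_recl big_ord0 addr0 /= !fact0 factS fact0 muln1 invr1.
by rewrite !mul1r opprD addrA.
Qed.

Lemma jb_segment (x h : 'rV[R]_m) t : `|h| <= 1 -> 0 <= t <= 1 ->
  jbracket (x + t *: h) <= 2 * (1 + m%:R) * jbracket x.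
Proof.
move=> h1 /andP[t0 t1].
apply: le_trans (jbD _ _) _; rewrite mulrAC ler_wpM2r ?jb_ge0// ler_wpM2l//.
apply: le_trans (@jbZ _ _ _ _ _) _; first by rewrite ger0_norm.
apply: le_trans (jb_l1 _) _; rewrite lerD2l.
by apply: le_trans (l1_norm _) _; rewrite ler_piMr.
Qed.

Definition param_int (F : 'rV[R]_m -> 'rV[R]_k -> R[i]) (x : 'rV[R]_m) : R[i] :=
  cintegral (F x).

(** Chosen to be stable under derivatives in x. Growth in x is allowed, of an order depending on the
    derivative, because differentiability is local; decay in y gives integrability. *)
Definition param_ok (F : 'rV[R]_m -> 'rV[R]_k -> R[i]) : Prop :=
  [/\ forall y, smooth (F ^~ y),
      forall s x, cmble (fun y => pderivs s (F ^~ y) x)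
    & forall s, exists j : nat, forall x y, cabs (pderivs s (F ^~ y) x) <=
        j%:R * jbracket x ^+ j * jbracket y ^- k.*2].

Definition param_pderiv i (F : 'rV[R]_m -> 'rV[R]_k -> R[i]) :=
  fun x y => pderiv i (F ^~ y) x.

Lemma param_ok_pderiv i F : param_ok F -> param_ok (param_pderiv i F).
Proof.
move=> [h1 h2 h3]; split.
- by move=> y; exact/smooth_pderiv/h1.
- by move=> s x; have := h2 (rcons s i) x; under eq_fun do rewrite pderivs_rcons.
- move=> s; have [j hj] := h3 (rcons s i); exists j => x y.
  by have := hj x y; rewrite pderivs_rcons.
Qed.

Lemma param_dec F x : param_ok F -> dec (F x).
Proof.
move=> [h1 h2 h3]; split; first exact: (h2 [::]).
by have [j hj] := h3 [::]; exists (j%:R * jbracket x ^+ j) => y; exact: hj.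
Qed.

(** The second order Taylor remainder of the integrand is quadratic in [h] with an integrable
    constant, so its integral meets the criterion [quad_diff]. *)
Lemma param_int_diff F x : param_ok F ->
  cdiff (param_int F) x /\
  forall i, pderiv i (param_int F) x = param_int (param_pderiv i F) x.
Proof.
move=> hF; have [h1 h2 h3] := hF.
have [j hj] : exists j : nat, forall s, (size s <= 2)%N -> forall x y,
    cabs (pderivs s (F ^~ y) x) <= j%:R * jbracket x ^+ j * jbracket y ^- k.*2.
  apply: (@list_unif m (fun s j => forall x y,
    cabs (pderivs s (F ^~ y) x) <= j%:R * jbracket x ^+ j * jbracket y ^- k.*2)).
    move=> s j j' jj' h u y; apply: le_trans (h u y) _.
    rewrite ler_wpM2r ?jbVX_ge0//; apply: ler_pM; rewrite ?jbX_ge0//.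
      by rewrite ler_nat.
    exact: jbX_le.
  exact: h3.
pose D : R := j%:R * (2 * (1 + m%:R) * jbracket x) ^+ j.
have D0 : 0 <= D.
  by rewrite mulr_ge0// exprn_ge0// mulr_ge0 ?jb_ge0// mulr_ge0// addr_ge0.
apply: (@quad_diff _ _ _ _ _ (2 * cn R k * (2 * (m%:R ^+ 2 * D)))) => h hh.
have dF u := param_dec u hF.
have dP i := param_dec x (param_ok_pderiv i hF).
rewrite -[X in cabs X](_ : cintegral (fun y => F (x + h) y - F x y -
    \sum_i (h 0 i)%:C * param_pderiv i F x y) = _); last first.
  rewrite cintegralB; [|exact: decB|by apply: dec_sum => i; exact: decZ].
  rewrite cintegralB// cintegral_sum; last by move=> i; exact: decZ.
  by congr (_ - _); apply: eq_bigr => i _; rewrite cintegralZ.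
rewrite -mulrA; apply: cintegral_bound.
  by case: (decB (decB (dF (x + h)) (dF x))
    (@dec_sum _ _ _ (index_enum _) _ (fun i => decZ (h 0 i)%:C (dP i)))).
move=> y; apply: le_trans (@taylor2 (F ^~ y) x h (D * jbracket y ^- k.*2) (h1 y) _) _.
  move=> t t01 s hs; apply: le_trans (hj s _ _ _) _; first by rewrite hs.
  rewrite ler_wpM2r ?jbVX_ge0// ler_wpM2l//.
  by apply: lerXn2r; rewrite ?nnegrE ?jb_ge0 ?jb_segment// !mulr_ge0 ?jb_ge0// addr_ge0.
have J0 := jbVX_ge0 y k.*2; move: D0 J0.
have := l1_norm h; have := l1_ge0 h; have := normr_ge0 h.
move: (jbracket y ^- k.*2) (l1 h) D {dF dP hh hj h2 h3} => J l D nh0 l0 hl D0 J0.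
have -> : 2 * (l ^+ 2 * (D * J)) = 2 * (D * J) * l ^+ 2 by ring.
have -> : 2 * (m%:R ^+ 2 * D) * `|h| ^+ 2 * J = 2 * (D * J) * (m%:R * `|h|) ^+ 2 by ring.
rewrite ler_wpM2l ?mulr_ge0//.
by apply: lerXn2r; rewrite ?nnegrE ?mulr_ge0.
Qed.

Lemma param_smooth F : param_ok F -> smooth (param_int F).
Proof.
move=> hF; apply: (@smooth_coind _ _ [set f | exists2 G, param_ok G & f = param_int G]);
  last by exists F.
move=> _ [G hG ->]; split=> [x|i]; first by case: (param_int_diff x hG).
exists (param_pderiv i G); first exact: param_ok_pderiv.
by apply/funext => x; case: (param_int_diff x hG).
Qed.

Lemma param_pderivs s F : param_ok F ->
  pderivs s (param_int F) = param_int (fun x y => pderivs s (F ^~ y) x).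
Proof.
elim/last_ind: s F => [//|s i ih] F hF.
rewrite pderivs_rcons (_ : pderiv i _ = param_int (param_pderiv i F)); last first.
  by apply/funext => x; case: (param_int_diff x hF).
rewrite ih; last exact: param_ok_pderiv.
by congr param_int; apply/funext => x; apply/funext => y; rewrite pderivs_rcons.
Qed.
End ParametricIntegral.

(** * Families of symbols *)

Section Families.
Variable R : realType.

(** The index lets the dependence on the parameter have unspecified order, as in epsilon^-k;
    monotonicity allows enlarging the index together with the constant. *)
Record gauge (Theta : Type) := Gauge {
  gfun :> nat -> Theta -> R;
  gauge_ge0 : forall k t, 0 <= gfun k t;
  gauge_mono : forall k l t, (k <= l)%N -> gfun k t <= gfun l t }.

Definition gauge1 (Theta : Type) : gauge Theta.
Proof. by apply: (@Gauge _ (fun _ _ => 1)). Defined.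

Variables (Theta : Type) (d : nat).
Implicit Types (g : gauge Theta) (w : nat -> 'rV[R]_d -> R)
  (f : Theta -> 'rV[R]_d -> R[i]).

(* Typically [t] is epsilon: the gauge 1 expresses uniform boundedness in a
   symbol class, the gauge epsilon^-k moderateness and the gauge epsilon^q
   smallness of order q. *)
Definition symb g w f : Prop :=
  (forall t, smooth (f t)) /\
  forall s K, exists k : nat, forall t z,
    cabs (pderivs s (f t) z) <= k%:R * g k t * w K z.

Definition nonneg_weight w := forall K z, 0 <= w K z.

Lemma gauge_le g (w0 : R) k l t : (k <= l)%N -> 0 <= w0 ->
  k%:R * g k t * w0 <= l%:R * g l t * w0.
Proof.
move=> kl w00; rewrite ler_wpM2r//; apply: ler_pM; rewrite ?gauge_ge0//.
  by rewrite ler_nat.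
exact: gauge_mono.
Qed.

Lemma symb_unif g w f N K : nonneg_weight w -> symb g w f ->
  exists k : nat, forall s, (size s <= N)%N -> forall t z,
    cabs (pderivs s (f t) z) <= k%:R * g k t * w K z.
Proof.
move=> w0 [_ hf].
apply: (@list_unif d (fun s' k => forall t z,
  cabs (pderivs s' (f t) z) <= k%:R * g k t * w K z)) => // s' k l kl h t z.
by apply: le_trans (h t z) _; exact: gauge_le.
Qed.

Lemma symb_pderiv g w f i : symb g w f -> symb g w (fun t => pderiv i (f t)).
Proof.
move=> [h1 h2]; split=> [t|s K]; first exact: smooth_pderiv.
have [k hk] := h2 (rcons s i) K; exists k => t z.
by have := hk t z; rewrite pderivs_rcons.
Qed.

Lemma symb_pderivs g w f s : symb g w f -> symb g w (fun t => pderivs s (f t)).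
Proof. by move=> h; elim: s => //= i s ih; exact: symb_pderiv. Qed.

Lemma symbD g w f1 f2 : nonneg_weight w -> symb g w f1 -> symb g w f2 ->
  symb g w (fun t z => f1 t z + f2 t z).
Proof.
move=> w0 [s1 h1] [s2 h2]; split=> [t|s K]; first exact: smoothD.
have [k1 hk1] := h1 s K; have [k2 hk2] := h2 s K.
exists (k1 + k2)%N => t z; rewrite pderivsD//.
apply: le_trans (cabsD _ _) _.
rewrite natrD !mulrDl; apply: lerD.
- apply: le_trans (hk1 t z) _; rewrite ler_wpM2r// ler_wpM2l//.
  by apply: gauge_mono; exact: leq_addr.
- apply: le_trans (hk2 t z) _; rewrite ler_wpM2r// ler_wpM2l//.
  by apply: gauge_mono; exact: leq_addl.
Qed.

Lemma symbZ g w f (c : R[i]) : nonneg_weight w -> symb g w f ->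
  symb g w (fun t z => c * f t z).
Proof.
move=> w0 [s1 h1]; split=> [t|s K]; first exact: smoothZ.
have [k hk] := h1 s K; have [l hl] := nat_ub (cabs c).
exists (l.+1 * k)%N => t z; rewrite pderivsZ// cabsM.
apply: (@le_trans _ _ (l.+1%:R * (k%:R * g k t * w K z))).
  apply: ler_pM; rewrite ?cabs_ge0//.
  by apply: le_trans hl _; rewrite ler_nat.
rewrite natrM -!mulrA ler_wpM2l// ler_wpM2l// ler_wpM2r//.
by apply: gauge_mono; rewrite leq_pmull.
Qed.

Lemma symb_sum g w (I : Type) (r : seq I) (F : I -> Theta -> 'rV[R]_d -> R[i]) :
  nonneg_weight w -> (forall i, symb g w (F i)) ->
  symb g w (fun t z => \sum_(i <- r) F i t z).
Proof.
move=> w0 hF; elim: r => [|i r ih].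
  split=> [t|s K].
    by under eq_fun do rewrite big_nil; exact: smooth_cst.
  exists 0%N => t z; under eq_fun do rewrite big_nil.
  by rewrite pderivs0 cabs0 !mul0r.
rewrite (_ : (fun t z => _) = (fun t z => F i t z + \sum_(j <- r) F j t z)).
  exact: symbD.
by apply/funext => t; apply/funext => z; rewrite big_cons.
Qed.

Lemma symbM g1 g2 g w1 w2 w f1 f2 :
  nonneg_weight w1 -> nonneg_weight w2 -> nonneg_weight w ->
  (forall K, exists K1 K2 (c : nat), forall z, w1 K1 z * w2 K2 z <= c%:R * w K z) ->
  (forall k, exists l : nat, forall t, g1 k t * g2 k t <= l%:R * g l t) ->
  symb g1 w1 f1 -> symb g2 w2 f2 -> symb g w (fun t z => f1 t z * f2 t z).
Proof.
move=> w10 w20 w0 hw hg [s1 h1] [s2 h2]; split=> [t|s K]; first exact: smoothM.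
have [K1 [K2 [c hc]]] := hw K.
have [k1 hk1] := symb_unif (size s) K1 w10 (conj s1 h1).
have [k2 hk2] := symb_unif (size s) K2 w20 (conj s2 h2).
pose k := maxn k1 k2.
have [l hl] := hg k.
(* The witness is both a constant and a gauge index, so it has to exceed the product of the
   constants as well as [l]; each [maxn 1] keeps one factor from annihilating the other. *)
exists (maxn 1 (2 ^ size s * k1 * k2 * c * l) * maxn 1 l)%N => t z.
set L := (_ * _)%N.
have := @pderivsM_bound _ _ s (f1 t) (f2 t) z _ _ (s1 t) (s2 t)
  (fun s' hs' => hk1 s' hs' t z) (fun s' hs' => hk2 s' hs' t z).
move=> /le_trans; apply.
have kk1 : g1 k1 t <= g1 k t by apply: gauge_mono; exact: leq_maxl.
have kk2 : g2 k2 t <= g2 k t by apply: gauge_mono; exact: leq_maxr.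
apply: (@le_trans _ _ (2 ^+ size s * (k1%:R * k2%:R * (l%:R * g l t) * (c%:R * w K z)))).
  rewrite ler_wpM2l ?exprn_ge0//.
  rewrite mulrACA; apply: ler_pM => //.
  - by rewrite mulr_ge0 ?mulr_ge0 ?gauge_ge0.
  - by rewrite mulr_ge0.
  - rewrite mulrACA ler_wpM2l ?mulr_ge0//.
    by apply: le_trans (hl t); apply: ler_pM; rewrite ?gauge_ge0.
have -> : 2 ^+ size s * (k1%:R * k2%:R * (l%:R * g l t) * (c%:R * w K z)) =
    (2 ^ size s * k1 * k2 * c * l)%N%:R * g l t * w K z.
  rewrite !natrM natrX; ring.
rewrite ler_wpM2r//; apply: ler_pM; rewrite ?gauge_ge0//.
  rewrite ler_nat /L; apply: leq_trans (leq_maxr 1 _) _.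
  by rewrite leq_pmulr// leq_max.
apply: gauge_mono; rewrite /L; apply: leq_trans (leq_maxr 1 _) _.
by rewrite leq_pmull// leq_max.
Qed.

Lemma symb_weaken g w w' f :
  (forall K, exists K1 (c : nat), forall z, w K1 z <= c%:R * w' K z) ->
  nonneg_weight w' ->
  symb g w f -> symb g w' f.
Proof.
move=> hw w0 [s1 h1]; split=> // s K.
have [K1 [c hc]] := hw K; have [k hk] := h1 s K1.
exists (k * c.+1)%N => t z; apply: le_trans (hk t z) _.
apply: (@le_trans _ _ (k%:R * g k t * (c.+1%:R * w' K z))).
  rewrite ler_wpM2l ?mulr_ge0 ?gauge_ge0//.
  by apply: le_trans (hc z) _; rewrite ler_wpM2r// ler_nat.
rewrite mulrA ler_wpM2r// natrM mulrAC ler_wpM2l//.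
by apply: gauge_mono; rewrite leq_pmulr.
Qed.

Lemma symb_gauge g g' w f : nonneg_weight w ->
  (forall k, exists l : nat, forall t, g k t <= l%:R * g' l t) ->
  symb g w f -> symb g' w f.
Proof.
move=> w0 hg [s1 h1]; split=> // s K.
have [k hk] := h1 s K; have [l hl] := hg k.
exists (k.+1 * l.+1)%N => t z; apply: le_trans (hk t z) _.
rewrite ler_wpM2r//; apply: (@le_trans _ _ (k.+1%:R * (l.+1%:R * g' l t))).
  apply: ler_pM; rewrite ?gauge_ge0//; first by rewrite ler_nat.
  by apply: le_trans (hl t) _; rewrite ler_wpM2r ?gauge_ge0// ler_nat.
rewrite mulrA natrM ler_wpM2l ?mulr_ge0//; apply: gauge_mono.
by apply: leq_trans (leqnSn l) _; rewrite leq_pmull.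
Qed.

End Families.

Lemma symb_reindex (R : realType) (T1 T2 : Type) (r : T2 -> T1) d (g : gauge R T1)
    (g2 : gauge R T2) (w : nat -> 'rV[R]_d -> R) f :
  (forall k t, g2 k t = g k (r t)) -> symb g w f -> symb g2 w (fun t => f (r t)).
Proof.
move=> hg [h1 h2]; split=> [t|s K]; first exact: h1.
by have [k hk] := h2 s K; exists k => t z; rewrite hg; exact: hk.
Qed.

Lemma symb_comp (R : realType) (Theta : Type) m d (L : Theta -> 'rV[R]_m -> 'rV[R]_d)
    (v : Theta -> 'I_m -> 'rV[R]_d) (A : nat) (g : gauge R Theta)
    (w : nat -> 'rV[R]_d -> R) (w' : nat -> 'rV[R]_m -> R) f :
  (forall th i t x, L th (t *: delta_mx 0 i + x) = t *: v th i + L th x) ->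
  (forall th i, l1 (v th i) <= A%:R) ->
  nonneg_weight w -> nonneg_weight w' ->
  (forall K, exists K1 (c : nat), forall th z, w K1 (L th z) <= c%:R * w' K z) ->
  symb g w f -> symb g w' (fun th z => f th (L th z)).
Proof.
move=> hL hA w0 w'0 hw [s1 h1].
split=> [th|s K]; first exact: (smooth_comp (hL th)).
have [K1 [c hc]] := hw K.
have [k hk] := symb_unif (size s) K1 w0 (conj s1 h1).
exists (A.+1 ^ size s * k.+1 * c.+1)%N => th z.
apply: le_trans (@pderivs_comp_bound _ _ _ (L th) (v th) (hL th) s (f th) z A.+1%:R
  (k.+1%:R * g k th * w K1 (L th z)) (s1 th) _ _ _) _.
- by move=> i; apply: le_trans (hA th i) _; rewrite ler_nat.
- move=> s' hs'; apply: le_trans (hk s' _ th _) _; first by rewrite hs'.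
  by rewrite ler_wpM2r// ler_wpM2r ?gauge_ge0// ler_nat.
- by rewrite !mulr_ge0 ?gauge_ge0.
apply: (@le_trans _ _ (A.+1%:R ^+ size s * (k.+1%:R * g k th * (c.+1%:R * w' K z)))).
  rewrite ler_wpM2l ?exprn_ge0// ler_wpM2l ?mulr_ge0 ?gauge_ge0//.
  by apply: le_trans (hc th z) _; rewrite ler_wpM2r// ler_nat.
rewrite !natrM natrX.
have -> : A.+1%:R ^+ size s * (k.+1%:R * g k th * (c.+1%:R * w' K z)) =
  A.+1%:R ^+ size s * k.+1%:R * c.+1%:R * g k th * w' K z by ring.
rewrite ler_wpM2r// ler_wpM2l ?mulr_ge0 ?exprn_ge0//; apply: gauge_mono.
rewrite mulnAC; apply: leq_trans (leqnSn k) _; rewrite leq_pmull//.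
by rewrite muln_gt0 expn_gt0.
Qed.

(** * Partial integrals and integration by parts *)

Section Partial.
Variables (R : realType) (m k : nat).

Implicit Types (F G : 'rV[R]_(m + k) -> R[i]) (x : 'rV[R]_m) (y : 'rV[R]_k).

Definition Jint (F : 'rV[R]_(m + k) -> R[i]) (x : 'rV[R]_m) : R[i] :=
  cintegral (fun y => F (row_mx x y)).

Definition jok (F : 'rV[R]_(m + k) -> R[i]) : Prop :=
  smooth F /\ forall s, exists j : nat, forall x y,
    cabs (pderivs s F (row_mx x y)) <= j%:R * jbracket x ^+ j * jbracket y ^- k.*2.

Lemma slice_pderivsl s F (y : 'rV[R]_k) :
  pderivs s (fun x => F (row_mx x y)) =
  fun x => pderivs (map (lshift k) s) F (row_mx x y).
Proof.
apply: (pderivs_dir (L := fun x : 'rV[R]_m => row_mx x y)) => i t x.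
exact: row_mx_dir0l.
Qed.

Lemma slice_pderivsr s F (x : 'rV[R]_m) :
  pderivs s (fun y => F (row_mx x y)) =
  fun y => pderivs (map (@rshift m k) s) F (row_mx x y).
Proof.
apply: (pderivs_dir (L := fun y : 'rV[R]_k => row_mx x y)) => i t y.
exact: row_mx_dir0r.
Qed.

Lemma smooth_slicel F y : smooth F -> smooth (fun x => F (row_mx x y)).
Proof.
move=> h; have hd i t x := @row_mx_dir0l R m k i t x y.
exact: (smooth_comp hd).
Qed.

Lemma smooth_slicer F x : smooth F -> smooth (fun y => F (row_mx x y)).
Proof.
move=> h; have hd i t y := @row_mx_dir0r R m k i t x y.
exact: (smooth_comp hd).
Qed.

Lemma jok_param F : jok F -> param_ok (fun x y => F (row_mx x y)).
Proof.
move=> [h1 h2]; split.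
- by move=> y; exact: smooth_slicel.
- move=> s x; under eq_fun do rewrite slice_pderivsl.
  exact/ccont_cmble/smooth_ccont/smooth_slicer/smooth_pderivs.
- move=> s; have [j hj] := h2 (map (lshift k) s); exists j => x y.
  by rewrite slice_pderivsl.
Qed.

Lemma jok_dec F x : jok F -> dec (fun y => F (row_mx x y)).
Proof. by move=> h; exact: (param_dec x (jok_param h)). Qed.

Lemma Jint_smooth F : jok F -> smooth (Jint F).
Proof. by move=> h; exact: (param_smooth (jok_param h)). Qed.

Lemma Jint_pderiv i F : jok F -> pderiv i (Jint F) = Jint (pderiv (lshift k i) F).
Proof.
move=> h; have := param_pderivs [:: i] (jok_param h); rewrite /= => ->.
apply/funext => x; congr cintegral; apply/funext => y.
by have /= := congr1 (fun f => f x) (slice_pderivsl [:: i] F y).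
Qed.

Lemma JintD F G : jok F -> jok G ->
  Jint (fun z => F z + G z) = fun x => Jint F x + Jint G x.
Proof. by move=> hF hG; apply/funext => x; apply: cintegralD; exact: jok_dec. Qed.

Lemma JintZ c F : jok F -> Jint (fun z => c * F z) = fun x => c * Jint F x.
Proof. by move=> hF; apply/funext => x; apply: cintegralZ; exact: jok_dec. Qed.

(** By translation invariance f (y + t e) - f y has integral 0, and it differs from t times the
    derivative by an error with integral O(t^2). Dividing by t and letting t tend to 0 gives the
    claim. *)
Lemma int_pderiv0 (f : 'rV[R]_k -> R[i]) (C : R) i : smooth f ->
  (forall s, (size s <= 2)%N -> forall y, cabs (pderivs s f y) <= C * jbracket y ^- k.*2) ->
  cintegral (pderiv i f) = 0.
Proof.
move=> hf hC.
have C0 : 0 <= C.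
  by have := hC [::] isT 0 => /(le_trans (cabs_ge0 _)); rewrite pmulr_lge0// jbVX_gt0.
have df : dec f by apply: (dec_cont (C := C)); [exact: smooth_ccont|exact: (hC [::])].
have dd : dec (pderiv i f).
  by apply: (dec_cont (C := C)); [exact/smooth_ccont/smooth_pderiv|exact: (hC [:: i])].
pose e : 'rV[R]_k := delta_mx 0 i.
have shift t : smooth (fun y => f (y + t *: e)).
  have hd j (u : R) y : (fun y => y + t *: e) (u *: delta_mx 0 j + y) =
      u *: delta_mx 0 j + (fun y => y + t *: e) y by rewrite addrA.
  exact: (smooth_comp hd).
have bs t y : 0 <= t <= 1 -> jbracket (y + t *: e) ^- k.*2 <=
    2 ^+ k.*2 * jbracket e ^+ k.*2 * jbracket y ^- k.*2.
  move=> /andP[t0 t1]; apply: le_trans (jbVX_shift _ _ _) _.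
  rewrite ler_wpM2r ?jbVX_ge0// ler_wpM2l ?exprn_ge0//.
  by apply: lerXn2r; rewrite ?nnegrE ?jb_ge0// jbZ// ger0_norm.
pose D := C * (2 ^+ k.*2 * jbracket e ^+ k.*2).
have ds t : 0 <= t <= 1 -> dec (fun y => f (y + t *: e)).
  move=> t01; apply: (dec_cont (C := D)); first exact/smooth_ccont/shift.
  move=> y; apply: le_trans (hC [::] isT _) _; rewrite /D -mulrA ler_wpM2l//.
  exact: bs.
have inv t : 0 <= t <= 1 -> cintegral (fun y => f (y + t *: e)) = cintegral f.
  move=> t01; rewrite [RHS](cintegral_affine (t *: e) ltr01 (smooth_ccont hf) df).
  rewrite expr1n mul1r; congr cintegral; apply/funext => y.
  by rewrite scale1r.
have key t : 0 < t <= 1 -> cabs (cintegral (pderiv i f)) <= (2 * cn R k * (2 * D)) * t.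
  move=> /andP[t0 t1]; have t01 : 0 <= t <= 1 by rewrite ltW.
  rewrite -(@ler_pM2l _ t)//.
  have -> : t * (2 * cn R k * (2 * D) * t) = 2 * cn R k * (2 * D * t ^+ 2) by ring.
  have -> : t * cabs (cintegral (pderiv i f)) =
      cabs (cintegral (fun y => t%:C * pderiv i f y)).
    by rewrite cintegralZ// cabsM cabsR ger0_norm ?ltW.
  have dts := ds t t01.
  have -> : cintegral (fun y => t%:C * pderiv i f y) =
      - cintegral (fun y => f (y + t *: e) - f y - t%:C * pderiv i f y).
    rewrite cintegralB; [|exact: decB|exact: decZ].
    by rewrite cintegralB// inv// subrr sub0r opprK.
  rewrite cabsN; apply: cintegral_bound.
    by case: (decB (decB (ds t t01) df) (decZ t%:C dd)).
  move=> y; have := @taylor2 _ _ f y (t *: e) (D * jbracket y ^- k.*2) hf.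
  rewrite (bigD1 i)//= big1 => [|j ji]; last first.
    by rewrite !mxE (negbTE ji) andbF mulr0 mul0r.
  rewrite !mxE !eqxx mulr1 addr0.
  have -> : l1 (t *: e) = t.
    rewrite l1Z ger0_norm ?ltW// /l1 (bigD1 i)//= big1 => [|j ji].
      by rewrite mxE !eqxx normr1 addr0 mulr1.
    by rewrite mxE (negbTE ji) andbF normr0.
  move=> h; apply: le_trans (h _) _; last by apply: eq_ler; ring.
  move=> u /andP[u0 u1] s hs; apply: le_trans (hC s _ _) _; first by rewrite hs.
  rewrite /D -mulrA ler_wpM2l// scalerA; apply: bs.
  by apply/andP; split; [rewrite mulr_ge0// ltW|rewrite mulr_ile1// ltW].
set D2 := 2 * cn R k * (2 * D) in key.
have D20 : 0 <= D2.
  by rewrite !mulr_ge0 ?cn_ge0// ?exprn_ge0 ?jb_ge0.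
apply: Normc.eq0_normc; apply/eqP; rewrite eq_le cabs_ge0 andbT.
apply/ler_addgt0Pr => eps e0; rewrite add0r.
pose t := Num.min 1 (eps / (D2 + 1)).
have D2p : 0 < D2 + 1 by rewrite ltr_wpDl.
have t0 : 0 < t by rewrite lt_min ltr01 divr_gt0.
apply: le_trans (key t _) _; first by rewrite t0 ge_min lexx.
apply: (@le_trans _ _ ((D2 + 1) * (eps / (D2 + 1)))).
  by apply: ler_pM => //; [exact: ltW|rewrite lerDl|rewrite ge_min lexx orbT].
by rewrite mulrCA mulfV ?mulr1// gt_eqF.
Qed.

Lemma Jint_ibp i F : jok F -> Jint (pderiv (rshift m i) F) = fun=> 0.
Proof.
move=> [h1 h2]; apply/funext => x.
have [j hj] : exists j : nat, forall s, (size s <= 2)%N -> forall x y,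
    cabs (pderivs s F (row_mx x y)) <= j%:R * jbracket x ^+ j * jbracket y ^- k.*2.
  apply: (@list_unif (m + k) (fun s j => forall x y,
    cabs (pderivs s F (row_mx x y)) <= j%:R * jbracket x ^+ j * jbracket y ^- k.*2)) => //.
  move=> s j j' jj' h u y; apply: le_trans (h u y) _.
  rewrite ler_wpM2r ?jbVX_ge0//; apply: ler_pM; rewrite ?jbX_ge0//.
    by rewrite ler_nat.
  exact: jbX_le.
have := @int_pderiv0 (fun y => F (row_mx x y)) (j%:R * jbracket x ^+ j) i
  (smooth_slicer x h1).
rewrite /Jint; have /= -> := slice_pderivsr [:: i] F x; apply => s hs y.
rewrite slice_pderivsr; apply: hj.
by rewrite size_map.
Qed.
End Partial.

Section Coordinate.
Variables (R : realType) (d : nat).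

Lemma pderivs_cst j s (c : R[i]) : pderivs (j :: s) (fun _ : 'rV[R]_d => c) = fun=> 0.
Proof.
elim: s j => [|l s ih] j /=; first by apply/funext => y; rewrite pderivE cD_cst.
by have /= -> := ih l; apply/funext => y; rewrite pderivE cD_cst.
Qed.

Lemma coord_bound s (k : 'I_d) (z : 'rV[R]_d) (C : R) : 1 <= C -> `|z 0 k| <= C ->
  cabs (pderivs s (fun z : 'rV[R]_d => (z 0 k)%:C) z) <= C.
Proof.
move=> C1 zC; elim/last_ind: s => [|s i _]; first by apply: le_trans zC; rewrite -cabsR.
rewrite pderivs_rcons pderiv_coord; case: s => [|j s].
  by apply: le_trans C1; rewrite /pderivs /=; case: eqP => _; rewrite ?cabs1 ?cabs0.
by rewrite pderivs_cst cabs0 (le_trans ler01).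
Qed.

Lemma symb_coord (T : Type) (w : nat -> 'rV[R]_d -> R) (k : 'I_d) :
  (forall K (z : 'rV[R]_d), 1 <= w K z) -> (forall K (z : 'rV[R]_d), `|z 0 k| <= w K z) ->
  symb (gauge1 R T) w (fun _ z => (z 0 k)%:C).
Proof.
move=> w1 wk; split=> [t|s K]; first exact: smooth_coord.
by exists 1%N => t z; rewrite !mul1r; exact: coord_bound.
Qed.
End Coordinate.

(** * Iterated oscillatory integrals *)

Section Oscillating.
Variables (R : realType) (n : nat) (sg : R).
Hypothesis sg2 : sg * sg = 1.
Notation d := (n + n + n)%N.
Implicit Types (z : 'rV[R]_d) (b : 'rV[R]_d -> R[i]).

Definition ip (j : 'I_n) : 'I_d := lshift n (lshift n j).
Definition ixi (j : 'I_n) : 'I_d := lshift n (rshift n j).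
Definition iq (j : 'I_n) : 'I_d := rshift (n + n) j.

Lemma cat3_ip (p xi q : 'rV[R]_n) j : cat3 p xi q 0 (ip j) = p 0 j.
Proof. by rewrite /cat3 /ip !row_mxEl. Qed.
Lemma cat3_ixi (p xi q : 'rV[R]_n) j : cat3 p xi q 0 (ixi j) = xi 0 j.
Proof. by rewrite /cat3 /ixi row_mxEl row_mxEr. Qed.
Lemma cat3_iq (p xi q : 'rV[R]_n) j : cat3 p xi q 0 (iq j) = q 0 j.
Proof. by rewrite /cat3 /iq row_mxEr. Qed.

Lemma ip_iq k j : (ip k == iq j) = false.
Proof. by apply/negbTE; rewrite -val_eqE /=; have := ltn_ord k; lia. Qed.
Lemma ixi_iq k j : (ixi k == iq j) = false.
Proof. by apply/negbTE; rewrite -val_eqE /=; have := ltn_ord k; lia. Qed.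
Lemma iq_iq k j : (iq k == iq j) = (k == j).
Proof. by rewrite -!val_eqE /= eqn_add2l. Qed.
Lemma ip_ixi k j : (ip k == ixi j) = false.
Proof. by apply/negbTE; rewrite -val_eqE /=; have := ltn_ord k; lia. Qed.
Lemma iq_ixi k j : (iq k == ixi j) = false.
Proof. by rewrite eq_sym ixi_iq. Qed.
Lemma ixi_ixi k j : (ixi k == ixi j) = (k == j).
Proof. by rewrite -!val_eqE /= eqn_add2l. Qed.

(* Points of R^{3n} are written (p, xi, q): the oscillating factor is
   exp (i sg (p - q) xi), with sg = 1 for A and sg = -1 for its transpose, and
   the test function is a function of q, so that q is integrated first. *)
Definition phase z : R :=
  sg * \sum_j (z 0 (ip j) - z 0 (iq j)) * z 0 (ixi j).

(** The complex-valued copy of [phase], to which the lemmas on [smooth] and [pderiv] apply. *)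
Definition phaseC z : R[i] :=
  sg%:C * \sum_j ((z 0 (ip j))%:C - (z 0 (iq j))%:C) * (z 0 (ixi j))%:C.

Definition osc z : R[i] := expi (phase z).

Lemma phaseCE z : phaseC z = (phase z)%:C.
Proof.
rewrite /phaseC /phase RCM rmorph_sum; congr (_ * _); apply: eq_bigr => j _.
by rewrite rmorphM rmorphB.
Qed.

Lemma phase_cat3 p xi q : phase (cat3 p xi q) = sg * dot (p - q) xi.
Proof.
rewrite /phase /dot; congr (_ * _); apply: eq_bigr => j _.
by rewrite cat3_ip cat3_iq cat3_ixi !mxE.
Qed.

Lemma smooth_coordB i j : smooth (fun z => (z 0 i)%:C - (z 0 j)%:C).
Proof. by apply: smoothB; exact: smooth_coord. Qed.

Lemma smooth_phaseC : smooth phaseC.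
Proof.
apply: smoothZ; apply: smooth_sum => j; apply: smoothM; last exact: smooth_coord.
exact: smooth_coordB.
Qed.

Lemma pderiv_phaseC i z : pderiv i phaseC z = sg%:C * \sum_j
  (((ip j == i)%:R - (iq j == i)%:R) * (z 0 (ixi j))%:C +
   ((z 0 (ip j))%:C - (z 0 (iq j))%:C) * (ixi j == i)%:R).
Proof.
have hs j := smoothM (smooth_coordB (ip j) (iq j)) (@smooth_coord R d (ixi j)).
rewrite pderivE cDZ; last by apply: smooth_cdiff; exact: smooth_sum.
congr (_ * _); rewrite cD_sum; last by move=> j; exact: smooth_cdiff.
apply: eq_bigr => j _.
have := congr1 (fun f => f z) (pderivM i (smooth_coordB (ip j) (iq j))
  (@smooth_coord R d (ixi j))).
rewrite /= pderivE => ->; rewrite pderiv_coord.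
have := congr1 (fun f => f z) (pderivsB [:: i] (@smooth_coord R d (ip j))
  (@smooth_coord R d (iq j))).
by rewrite /= => ->; rewrite !pderiv_coord.
Qed.

Lemma derive_comp1 (g : 'rV[R]_d -> R) (f : R -> R) (df : R) (v z : 'rV[R]_d) :
  differentiable g z -> is_derive (g z) (1 : R) f df ->
  differentiable (fun z => f (g z)) z /\ 'D_v (fun z => f (g z)) z = 'D_v g z * df.
Proof.
move=> dg hf.
have dff : differentiable f (g z) by apply/derivable1_diffP; case: hf.
have dc : differentiable (f \o g) z by exact: differentiable_comp.
split=> //; rewrite -[LHS]/('D_v (f \o g) z) deriveE// diff_comp//= deriveE//.
by rewrite diff1E//= derive1E (@derive_val _ _ _ _ _ _ _ hf).
Qed.

Lemma osc_cdiff z : cdiff osc z.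
Proof.
have [dp _] := smooth_cdiff z smooth_phaseC.
have e : (fun y => complex.Re (phaseC y)) = phase.
  by apply/funext => y; rewrite phaseCE.
rewrite e in dp; split.
- by have [] := derive_comp1 0 dp (is_derive_cos (phase z)).
- by have [] := derive_comp1 0 dp (is_derive_sin (phase z)).
Qed.

Lemma pderiv_osc i z : pderiv i osc z = 'i * pderiv i phaseC z * osc z.
Proof.
have [dp _] := smooth_cdiff z smooth_phaseC.
have e : (fun y => complex.Re (phaseC y)) = phase.
  by apply/funext => y; rewrite phaseCE.
have e2 : pderiv i phaseC z = ('D_(delta_mx 0 i) phase z)%:C.
  apply: ceq => /=; first by rewrite e.
  rewrite (_ : (fun y => _) = cst 0) ?derive_cst//.
  by apply/funext => y; rewrite phaseCE.
rewrite e in dp.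
have [_ d1] := derive_comp1 (delta_mx 0 i) dp (is_derive_cos (phase z)).
have [_ d2] := derive_comp1 (delta_mx 0 i) dp (is_derive_sin (phase z)).
rewrite e2; apply: ceq => /=.
- by rewrite d1; ring.
- by rewrite d2; ring.
Qed.

(** The derivative conjugated by the oscillating factor: it acts on the amplitude alone, at the cost
    of a factor linear in the coordinates. *)
Definition Dop i b z : R[i] := pderiv i b z + 'i * (pderiv i phaseC z * b z).
Definition Dops (s : seq 'I_d) b := foldr Dop b s.

Lemma Dop_smooth i b : smooth b -> smooth (Dop i b).
Proof.
move=> hb; apply: smoothD; first exact: smooth_pderiv.
by apply: smoothZ; apply: smoothM => //; exact/smooth_pderiv/smooth_phaseC.
Qed.

Lemma pderiv_bosc i b : smooth b ->
  pderiv i (fun z => b z * osc z) = fun z => Dop i b z * osc z.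
Proof.
move=> hb; apply/funext => z; rewrite pderivE cDM; [|exact: smooth_cdiff|exact: osc_cdiff].
by rewrite -!pderivE pderiv_osc /Dop; ring.
Qed.

Lemma bosc_smooth b : smooth b -> smooth (fun z => b z * osc z).
Proof.
move=> hb; apply: (@smooth_coind _ _ [set f | exists2 c, smooth c & f = fun z => c z * osc z]);
  last by exists b.
move=> _ [c hc ->]; split=> [z|i].
  by apply: cdiffM; [exact: smooth_cdiff|exact: osc_cdiff].
exists (Dop i c); first exact: Dop_smooth.
exact: pderiv_bosc.
Qed.

Lemma Dops_smooth s b : smooth b -> smooth (Dops s b).
Proof. by move=> hb; elim: s => //= i s; exact: Dop_smooth. Qed.

Lemma pderivs_bosc s b : smooth b ->
  pderivs s (fun z => b z * osc z) = fun z => Dops s b z * osc z.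
Proof.
move=> hb; elim: s => //= i s ->.
by rewrite pderiv_bosc//; exact: Dops_smooth.
Qed.

(** The weight of an amplitude times a test function: growth of a fixed order [M] in p and xi, decay
    of order [K] in q. In [symb] the order [K] is arbitrary while [M] stays fixed. *)
Definition wB (M K : nat) z : R :=
  jbracket (lsubmx (lsubmx z)) ^+ M * jbracket (rsubmx (lsubmx z)) ^+ M *
  jbracket (rsubmx z) ^- K.

Definition wP (M K : nat) z : R :=
  (jbracket (lsubmx (lsubmx z)) * jbracket (rsubmx (lsubmx z)) *
  jbracket (rsubmx z)) ^+ M.

Definition wq (K : nat) z : R := jbracket (rsubmx z).

Lemma wB_ge0 M : nonneg_weight (wB M).
Proof. by move=> K z; rewrite !mulr_ge0 ?jbX_ge0 ?jbVX_ge0. Qed.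

Lemma wP_ge0 M : nonneg_weight (wP M).
Proof. by move=> K z; rewrite exprn_ge0// !mulr_ge0 ?jb_ge0. Qed.

Lemma wq_ge0 : nonneg_weight wq.
Proof. by move=> K z; exact: jb_ge0. Qed.

Lemma wPB M1 M2 K : exists K1 K2 (c : nat), forall z,
  wP M1 K1 z * wB M2 K2 z <= c%:R * wB (M1 + M2) K z.
Proof.
(* The growth of order [M1] in q is absorbed by [M1] further powers of decay in q. *)
exists 0%N, (K + M1)%N, 1%N => z; rewrite mul1r /wP /wB.
move: (jb_gt0 (rsubmx z)).
move: (jbracket (lsubmx (lsubmx z))) (jbracket (rsubmx (lsubmx z))) (jbracket _).
move=> a c e e0; rewrite !exprMn !exprD invfM.
apply: eq_ler.
have eM : e ^+ M1 != 0 by rewrite expf_neq0// gt_eqF.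
have eK : e ^+ K != 0 by rewrite expf_neq0// gt_eqF.
by move: (e ^+ M1) (e ^+ K) eM eK => u v hu hv; field; rewrite hu hv.
Qed.

Lemma wqB M K : exists K1 K2 (c : nat), forall z,
  wq K1 z * wB M K2 z <= c%:R * wB M K z.
Proof.
exists 0%N, K.+1, 1%N => z; rewrite mul1r /wq /wB mulrCA.
rewrite ler_wpM2l ?mulr_ge0 ?jbX_ge0// exprS invfM mulrA mulfV ?mul1r//.
by rewrite gt_eqF// jb_gt0.
Qed.

Lemma submx_jb z (k : 'I_d) : `|z 0 k| <= wP 1 0 z.
Proof.
rewrite /wP expr1; apply: le_trans (coord_jb z k) _.
rewrite -{1}(hsubmxK z); apply: le_trans (jb_row _ _) _.
rewrite ler_wpM2r ?jb_ge0// -{1}(hsubmxK (lsubmx z)); exact: jb_row.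
Qed.

Lemma wP_ge1 M K z : 1 <= wP M K z.
Proof. by rewrite exprn_ege1// !mulr_ege1 ?jb_ge1. Qed.

Variable Theta : Type.
Implicit Types (g : gauge R Theta) (B : Theta -> 'rV[R]_d -> R[i]).

Lemma gauge1M g k : exists l : nat, forall t, gauge1 R Theta k t * g k t <= l%:R * g l t.
Proof.
exists k.+1 => t; rewrite mul1r.
apply: le_trans (gauge_mono g t (leqnSn k)) _.
by rewrite ler_peMl ?gauge_ge0// ler1n.
Qed.

Lemma symb_coordM g M B k : symb g (wB M) B ->
  symb g (wB M.+1) (fun t z => (z 0 k)%:C * B t z).
Proof.
apply: (@symbM _ _ _ (gauge1 R Theta) g g (wP 1) (wB M)) => //.
- exact: wP_ge0.
- exact: wB_ge0.
- exact: wB_ge0.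
- exact: wPB.
- exact: gauge1M.
- apply: symb_coord => [K z|K z]; first exact: wP_ge1.
  exact: submx_jb.
Qed.

(** In contrast to [symb_coordM], the factor q is absorbed by the decay in q, so [M] does not
    increase. *)
Lemma symb_qM g M B j : symb g (wB M) B ->
  symb g (wB M) (fun t z => (z 0 (iq j))%:C * B t z).
Proof.
apply: (@symbM _ _ _ (gauge1 R Theta) g g wq (wB M)) => //.
- exact: wq_ge0.
- exact: wB_ge0.
- exact: wB_ge0.
- exact: wqB.
- exact: gauge1M.
- apply: symb_coord => [K z|K z]; first exact: jb_ge1.
  by rewrite -{1}(hsubmxK z) row_mxEr; exact: coord_jb.
Qed.

Lemma symb_BW g M M' B : (M <= M')%N -> symb g (wB M) B -> symb g (wB M') B.
Proof.
move=> hM; apply: symb_weaken; last exact: wB_ge0.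
move=> K; exists K, 1%N => z; rewrite mul1r /wB ler_wpM2r ?jbVX_ge0//.
by apply: ler_pM; rewrite ?jbX_ge0// jbX_le.
Qed.

Lemma symb_Dop g M B i : symb g (wB M) B ->
  symb g (wB M.+1) (fun t => Dop i (B t)).
Proof.
move=> hB; have w0 := @wB_ge0 M.+1.
apply: symbD => //; first exact/(symb_BW (leqnSn M))/symb_pderiv.
apply: symbZ => //.
rewrite (_ : (fun t z => pderiv i phaseC z * B t z) = (fun t z => sg%:C * \sum_j
  (((ip j == i)%:R - (iq j == i)%:R) * ((z 0 (ixi j))%:C * B t z) +
   (ixi j == i)%:R * ((z 0 (ip j))%:C * B t z + (-1) * ((z 0 (iq j))%:C * B t z))))).
  apply: symbZ => //; apply: symb_sum => // j; apply: symbD => //.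
    by apply: symbZ => //; exact: symb_coordM.
  apply: symbZ => //; apply: symbD => //; first exact: symb_coordM.
  by apply: symbZ => //; exact: symb_coordM.
apply/funext => t; apply/funext => z; rewrite pderiv_phaseC -mulrA mulr_suml.
by congr (_ * _); apply: eq_bigr => j _; ring.
Qed.

Lemma symb_Dops g M B s : symb g (wB M) B ->
  symb g (wB (M + size s)) (fun t => Dops s (B t)).
Proof.
move=> hB; elim: s => [|i s ih] /=; first by rewrite addn0.
by rewrite addnS; exact: symb_Dop.
Qed.

Lemma wB_cat3 M K p xi q : wB M K (cat3 p xi q) =
  jbracket p ^+ M * jbracket xi ^+ M * jbracket q ^- K.
Proof. by rewrite /wB /cat3 !row_mxKl !row_mxKr. Qed.

Lemma wB_row M K (z : 'rV[R]_(n + n)) q : wB M K (row_mx z q) =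
  jbracket (lsubmx z) ^+ M * jbracket (rsubmx z) ^+ M * jbracket q ^- K.
Proof. by rewrite /wB !row_mxKl !row_mxKr. Qed.

Lemma cabs_osc z : cabs (osc z) = 1.
Proof. exact: cabs_expi. Qed.

Lemma jok_bosc g M B t : symb g (wB M) B ->
  @jok R (n + n) n (fun z => B t z * osc z).
Proof.
move=> hB; have [h1 _] := hB; split; first exact/bosc_smooth/h1.
move=> s; rewrite pderivs_bosc//; have [_ /(_ [::] n.*2) [k hk]] := symb_Dops s hB.
have [l hl] := nat_ub (k%:R * g k t).
(* The order is doubled because the bracket of the pair (p, xi) has to dominate the brackets of both
   p and xi. *)
exists (maxn l (M + size s).*2) => x y; rewrite cabsM cabs_osc mulr1.
apply: le_trans (hk t _) _; rewrite wB_row mulrA ler_wpM2r ?jbVX_ge0//.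
apply: ler_pM; rewrite ?mulr_ge0 ?gauge_ge0 ?jbX_ge0//.
  by apply: le_trans hl _; rewrite ler_nat leq_maxl.
apply: (le_trans _ (jbX_le x (leq_maxr l _))); rewrite -addnn [leRHS]exprD.
apply: ler_pM; rewrite ?jbX_ge0//; apply: lerXn2r; rewrite ?nnegrE ?jb_ge0//.
  by rewrite -{2}(hsubmxK x) jb_rowl.
by rewrite -{2}(hsubmxK x) jb_rowr.
Qed.

Definition Gop b : 'rV[R]_(n + n) -> R[i] :=
  @Jint R (n + n) n (fun z => b z * osc z).

Definition Top b : 'rV[R]_n -> R[i] := @Jint R n n (Gop b).

Lemma Gop_pderiv g M B t i : symb g (wB M) B ->
  pderiv i (Gop (B t)) = Gop (Dop (lshift n i) (B t)).
Proof.
move=> hB; rewrite /Gop Jint_pderiv; last exact: jok_bosc hB.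
by rewrite pderiv_bosc//; case: hB.
Qed.

Lemma Gop_pderivs g M B t s : symb g (wB M) B ->
  pderivs s (Gop (B t)) = Gop (Dops (map (@lshift (n + n) n) s) (B t)).
Proof.
move=> hB; elim: s => //= i s ->.
exact: (@Gop_pderiv _ _ (fun t => Dops _ (B t)) t i (symb_Dops _ hB)).
Qed.

Lemma GopD g M M' B B' t : symb g (wB M) B -> symb g (wB M') B' ->
  Gop (fun z => B t z + B' t z) = fun y => Gop (B t) y + Gop (B' t) y.
Proof.
move=> h h'; rewrite /Gop -JintD; [|exact: jok_bosc h|exact: jok_bosc h'].
by congr Jint; apply/funext => z; rewrite mulrDl.
Qed.

Lemma GopZ g M B t c : symb g (wB M) B ->
  Gop (fun z => c * B t z) = fun y => c * Gop (B t) y.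
Proof.
move=> h; rewrite /Gop -JintZ; last exact: jok_bosc h.
by congr Jint; apply/funext => z; rewrite mulrA.
Qed.

(** The q_j-derivative of amplitude times oscillation has integral 0 over q, and the part falling on
    the oscillation is [- 'i * sg%:C] times xi_j times the integrand. That constant squares to -1,
    so the identity can be solved for the product with xi_j. *)
Lemma Gop_ixi g M B t j (z : 'rV[R]_(n + n)) : symb g (wB M) B ->
  (z 0 (rshift n j))%:C * Gop (B t) z =
  - 'i * sg%:C * Gop (pderiv (iq j) (B t)) z.
Proof.
move=> hB; have jB := jok_bosc t hB; have [sB _] := hB.
have h0 := congr1 (fun f => f z) (Jint_ibp j jB).
rewrite pderiv_bosc// /= in h0.
have e : (fun z => Dop (iq j) (B t) z) =
    (fun z => pderiv (iq j) (B t) z + (- 'i * sg%:C) * ((z 0 (ixi j))%:C * B t z)).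
  apply/funext => y; rewrite /Dop pderiv_phaseC; congr (_ + _).
  rewrite (bigD1 j)//= big1 => [|k kj].
    rewrite ip_iq ixi_iq iq_iq eq_refl.
    by rewrite -[true%:R]/(1 : R[i]) -[false%:R]/(0 : R[i]); ring.
  by rewrite ip_iq ixi_iq iq_iq (negbTE kj) subrr mul0r mulr0 addr0.
have {}h0 : Gop (pderiv (iq j) (B t)) z +
    (- 'i * sg%:C) * ((z 0 (rshift n j))%:C * Gop (B t) z) = 0.
  rewrite -[RHS]h0 -[RHS]/(Gop (fun z => Dop (iq j) (B t) z) z) e.
  have s1 := symb_pderiv (iq j) hB; have s2 := symb_coordM (ixi j) hB.
  rewrite (@GopD _ _ _ _ _ t s1 (symbZ (- 'i * sg%:C) (@wB_ge0 _) s2)) (GopZ _ _ s2).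
  congr (_ + _ * _); rewrite /Gop /Jint -cintegralZ; last exact: (jok_dec z jB).
  by congr cintegral; apply/funext => y; rewrite /ixi row_mxEl mulrA.
have ss : (- 'i * sg%:C) * (- 'i * sg%:C) = -1 :> R[i].
  rewrite mulrACA -RCM sg2 mulr1 mulrNN -expr2; exact: sqr_i.
have {h0} h0 : Gop (pderiv (iq j) (B t)) z =
    - ((- 'i * sg%:C) * ((z 0 (rshift n j))%:C * Gop (B t) z)).
  by apply/eqP; rewrite -addr_eq0 h0.
by rewrite h0 mulrN mulrA ss mulN1r opprK.
Qed.
End Oscillating.

(** * Decay of the iterated integrals *)

Section OscBounds.
Variables (R : realType) (n : nat) (sg : R).
Hypothesis sg2 : sg * sg = 1.
Notation d := (n + n + n)%N.
Variable Theta : Type.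
Implicit Types (g : gauge R Theta) (B : Theta -> 'rV[R]_d -> R[i]).
Notation Gop := (@Gop R n sg).
Notation Top := (@Top R n sg).
Notation Dop := (@Dop R n sg).
Notation Dops := (@Dops R n sg).
Notation wB := (@wB R n).

Lemma jb_step (x : 'rV[R]_n) (a : R) : 0 <= a ->
  jbracket x * a <= a + \sum_j `|x 0 j| * a.
Proof.
move=> a0; rewrite -mulr_suml -{2}[a]mul1r -mulrDl ler_wpM2r//.
exact: jb_le_sum.
Qed.

Lemma cabs_sg : cabs (- 'i * sg%:C : R[i]) = 1.
Proof.
rewrite cabsM cabsN cabsi mul1r cabsR; have := normrM sg sg; rewrite sg2 normr1.
move/esym/eqP; rewrite -expr2 sqrp_eq1 ?normr_ge0// => /eqP; exact.
Qed.

Lemma Gop_bound0 g M B : symb g (wB M) B ->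
  exists k : nat, forall t p xi,
    cabs (Gop (B t) (row_mx p xi)) <= k%:R * g k t * jbracket p ^+ M * jbracket xi ^+ M.
Proof.
move=> hB; have [s1 /(_ [::] n.*2)[k hk]] := hB.
have [c hc] := nat_ub (2 * cn R n).
exists (c.+1 * k)%N => t p xi.
apply: le_trans (@cintegral_bound _ _ _
  (k%:R * g k t * jbracket p ^+ M * jbracket xi ^+ M) _ _) _.
- exact: (jok_dec (row_mx p xi) (jok_bosc sg t hB)).1.
- move=> y; rewrite cabsM cabs_osc mulr1; apply: le_trans (hk t _) _.
  by rewrite wB_cat3 !mulrA.
rewrite natrM.
have -> : c.+1%:R * k%:R * g (c.+1 * k)%N t * jbracket p ^+ M * jbracket xi ^+ M =
  c.+1%:R * (k%:R * g (c.+1 * k)%N t * jbracket p ^+ M * jbracket xi ^+ M) by ring.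
apply: ler_pM; rewrite ?mulr_ge0 ?cn_ge0 ?gauge_ge0 ?jbX_ge0//.
  by apply: le_trans hc _; rewrite ler_nat.
rewrite ler_wpM2r ?jbX_ge0// ler_wpM2r ?jbX_ge0// ler_wpM2l//.
by apply: gauge_mono; rewrite leq_pmull.
Qed.

(* Integrating by parts in the Schwartz variable gains one power of the dual
   variable at each step, without changing the weight. *)
Lemma Gop_bound g M K B : symb g (wB M) B ->
  exists k : nat, forall t p xi,
    jbracket xi ^+ K * cabs (Gop (B t) (row_mx p xi)) <=
    k%:R * g k t * (jbracket p ^+ M * jbracket xi ^+ M).
Proof.
elim: K B => [|K ih] B hB.
  have [k hk] := Gop_bound0 hB; exists k => t p xi.
  by rewrite expr0 mul1r; apply: le_trans (hk t p xi) _; rewrite !mulrA.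
have [k0 h0] := ih B hB.
have [k1 h1] : exists k : nat, forall j t p xi,
    jbracket xi ^+ K * cabs (Gop (pderiv (iq j) (B t)) (row_mx p xi)) <=
    k%:R * g k t * (jbracket p ^+ M * jbracket xi ^+ M).
  apply: (@fin_unif _ (fun j k => forall t p xi,
    jbracket xi ^+ K * cabs (Gop (pderiv (iq j) (B t)) (row_mx p xi)) <=
    k%:R * g k t * (jbracket p ^+ M * jbracket xi ^+ M))).
    move=> j k l kl h t p xi; apply: le_trans (h t p xi) _.
    by apply: gauge_le => //; rewrite mulr_ge0 ?jbX_ge0.
  by move=> j; apply: (ih (fun t => pderiv (iq j) (B t))); exact: symb_pderiv.
exists (k0 + n * k1)%N => t p xi.
set a := cabs (Gop (B t) (row_mx p xi)).
set w := jbracket p ^+ M * jbracket xi ^+ M.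
have w0 : 0 <= w by rewrite mulr_ge0 ?jbX_ge0.
rewrite exprS -mulrA.
apply: le_trans (jb_step xi _) _; first by rewrite mulr_ge0 ?jbX_ge0 ?cabs_ge0.
have gk : g k0 t <= g (k0 + n * k1)%N t by apply: gauge_mono; exact: leq_addr.
(* The comparison of gauge indices below needs [k1 <= n * k1]; for [n = 0] the sum over coordinates
   is empty and [h0] suffices. *)
have [n0|n0] := posnP n.
  rewrite big1 => [|j _]; last by have := ltn_ord j; rewrite {2}n0.
  rewrite addr0; apply: le_trans (h0 t p xi) _; apply: gauge_le => //.
  exact: leq_addr.
rewrite natrD natrM !mulrDl; apply: lerD.
  by apply: le_trans (h0 t p xi) _; rewrite ler_wpM2r// ler_wpM2l.
rewrite -!mulrA mulr_natl -[X in _ *+ X](card_ord n) -sumr_const.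
apply: ler_sum => j _; rewrite mulrCA /a.
have -> : `|xi 0 j| * cabs (Gop (B t) (row_mx p xi)) =
    cabs (Gop (pderiv (iq j) (B t)) (row_mx p xi)).
  have := Gop_ixi sg2 t j (row_mx p xi) hB; rewrite row_mxEr => /(congr1 (fun u : R[i] => cabs u)).
  by rewrite cabsM cabsR => ->; rewrite cabsM cabs_sg mul1r.
apply: le_trans (h1 j t p xi) _; rewrite -mulrA ler_wpM2l// ler_wpM2r//.
by apply: gauge_mono; apply: leq_trans (leq_addl _ _); rewrite leq_pmull.
Qed.

Lemma Gop_decay g M K B : symb g (wB M) B ->
  exists k : nat, forall t p xi,
    cabs (Gop (B t) (row_mx p xi)) <=
    k%:R * g k t * (jbracket p ^+ M * jbracket xi ^- K).
Proof.
(* Of the powers of the bracket of xi gained, [M] offset the growth of the amplitude and [K] remain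
   as decay. *)
move=> hB; have [k hk] := Gop_bound (M + K) hB; exists k => t p xi.
rewrite mulrA ler_pdivlMr ?jbX_gt0// mulrC.
rewrite -(@ler_pM2l _ (jbracket xi ^+ M)) ?jbX_gt0// mulrA -exprD.
by apply: le_trans (hk t p xi) _; rewrite mulrA mulrC.
Qed.

Lemma jok_Gop g M B t : symb g (wB M) B -> @jok R n n (Gop (B t)).
Proof.
move=> hB; split; first exact/Jint_smooth/(jok_bosc sg t hB).
move=> s; rewrite (Gop_pderivs sg t s hB).
have [k hk] := Gop_decay n.*2 (symb_Dops sg (map (@lshift (n + n) n) s) hB).
have [l hl] := nat_ub (k%:R * g k t).
set M' := (M + _)%N in hk.
exists (maxn l M') => x y; apply: le_trans (hk t x y) _.
rewrite mulrA ler_wpM2r ?jbVX_ge0//.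
apply: ler_pM; rewrite ?mulr_ge0 ?gauge_ge0 ?jbX_ge0//.
  by apply: le_trans hl _; rewrite ler_nat leq_maxl.
exact: jbX_le (leq_maxr _ _).
Qed.

Lemma TopD g M M' B B' t : symb g (wB M) B -> symb g (wB M') B' ->
  Top (fun z => B t z + B' t z) = fun y => Top (B t) y + Top (B' t) y.
Proof.
move=> h h'; rewrite /Top (GopD sg t h h') JintD//; [exact: jok_Gop h|exact: jok_Gop h'].
Qed.

Lemma TopZ g M B t c : symb g (wB M) B ->
  Top (fun z => c * B t z) = fun y => c * Top (B t) y.
Proof. by move=> h; rewrite /Top (GopZ sg t c h) JintZ//; exact: jok_Gop h. Qed.

Lemma Top_pderiv g M B t i : symb g (wB M) B ->
  pderiv i (Top (B t)) = Top (Dop (ip i) (B t)).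
Proof.
move=> hB; rewrite /Top Jint_pderiv; last exact: jok_Gop hB.
by rewrite (Gop_pderiv sg t _ hB).
Qed.

Lemma Top_pderivs g M B t s : symb g (wB M) B ->
  pderivs s (Top (B t)) = Top (Dops (map (@ip n) s) (B t)).
Proof.
move=> hB; elim: s => [|i s ih]; first by [].
rewrite -[LHS]/(pderiv i (pderivs s (Top (B t)))) ih.
exact: (@Top_pderiv _ _ (fun t => Dops _ (B t)) t i (symb_Dops _ _ hB)).
Qed.

(** What multiplication by p_j becomes after an integration by parts in xi_j: p_j is q_j plus p_j -
    q_j, and the latter times the oscillation is, up to a constant, its xi_j-derivative. Neither
    term raises [M]. *)
Definition Qop j (b : 'rV[R]_d -> R[i]) (z : 'rV[R]_d) : R[i] :=
  (z 0 (iq j))%:C * b z + 'i * sg%:C * pderiv (ixi j) b z.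

Lemma symb_Qop g M B j : symb g (wB M) B -> symb g (wB M) (fun t => Qop j (B t)).
Proof.
move=> hB; have w0 := @wB_ge0 R n M; apply: symbD => //; first exact: symb_qM.
by apply: symbZ => //; exact: symb_pderiv.
Qed.

Lemma solve_skew (s a b c : R[i]) : s * s = -1 -> a + s * (c + (-1) * b) = 0 ->
  c = b + s * a.
Proof.
move=> ss h; have -> : a = - (s * (c + (-1) * b)) by apply/eqP; rewrite -addr_eq0 h.
by rewrite mulrN mulrA ss; ring.
Qed.

Lemma Top_coord g M B t j (p : 'rV[R]_n) : symb g (wB M) B ->
  (p 0 j)%:C * Top (B t) p = Top (Qop j (B t)) p.
Proof.
move=> hB; have jG := jok_Gop t hB; have [sB _] := hB.
have h0 := congr1 (fun f => f p) (Jint_ibp j jG).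
rewrite (Gop_pderiv sg t _ hB) /= -[lshift n (rshift n j)]/(ixi j) in h0.
have e : (fun z => Dop (ixi j) (B t) z) =
    (fun z => pderiv (ixi j) (B t) z + ('i * sg%:C) * ((z 0 (ip j))%:C * B t z +
      (-1) * ((z 0 (iq j))%:C * B t z))).
  apply/funext => y; rewrite /Dop pderiv_phaseC; congr (_ + _).
  rewrite (bigD1 j)//= big1 => [|k kj].
    rewrite ip_ixi ixi_ixi iq_ixi eq_refl.
    by rewrite -[true%:R]/(1 : R[i]) -[false%:R]/(0 : R[i]); ring.
  by rewrite ip_ixi ixi_ixi iq_ixi (negbTE kj) subrr mul0r mulr0 addr0.
have s1 := symb_pderiv (ixi j) hB.
have s2 := symb_coordM (ip j) hB; have s3 := symb_qM j hB.
have w0 := @wB_ge0 R n.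
have s3' := symb_BW (leqnSn M) s3.
have s4 := symbD (w0 _) s2 (symbZ (-1) (w0 _) s3').
have {}h0 : Top (pderiv (ixi j) (B t)) p + ('i * sg%:C) *
    ((p 0 j)%:C * Top (B t) p + (-1) * Top (fun z => (z 0 (iq j))%:C * B t z) p) = 0.
  rewrite -[RHS]h0 -[RHS]/(Top (fun z => Dop (ixi j) (B t) z) p) e.
  rewrite (@TopD _ _ _ _ _ t s1 (symbZ _ (w0 _) s4)) (TopZ t _ s4).
  rewrite (@TopD _ _ _ _ _ t s2 (symbZ _ (w0 _) s3')) (TopZ t _ s3').
  congr (_ + _ * (_ + _)).
  rewrite /Top /Jint -cintegralZ; last exact: (jok_dec p jG).
  congr cintegral; apply/funext => y; rewrite /Gop /Jint -cintegralZ.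
    by congr cintegral; apply/funext => q; rewrite /ip !row_mxEl mulrA.
  exact: (jok_dec (row_mx p y) (jok_bosc sg t hB)).
rewrite (@TopD _ _ _ _ _ t s3 (symbZ _ (w0 _) s1)) (TopZ t _ s1).
have ss : ('i * sg%:C) * ('i * sg%:C) = -1 :> R[i].
  rewrite mulrACA -RCM sg2 mulr1 -expr2; exact: sqr_i.
exact: (solve_skew ss h0).
Qed.

Lemma Top_bound0 g M B : symb g (wB M) B ->
  exists k : nat, forall t p, cabs (Top (B t) p) <= k%:R * g k t * jbracket p ^+ M.
Proof.
move=> hB; have [k hk] := Gop_decay n.*2 hB.
have [c hc] := nat_ub (2 * cn R n).
exists (c.+1 * k)%N => t p.
apply: le_trans (@cintegral_bound _ _ _ (k%:R * g k t * jbracket p ^+ M) _ _) _.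
- exact: (jok_dec p (jok_Gop t hB)).1.
- by move=> y; apply: le_trans (hk t p y) _; rewrite mulrA.
rewrite natrM.
have -> : c.+1%:R * k%:R * g (c.+1 * k)%N t * jbracket p ^+ M =
  c.+1%:R * (k%:R * g (c.+1 * k)%N t * jbracket p ^+ M) by ring.
apply: ler_pM; rewrite ?mulr_ge0 ?cn_ge0 ?gauge_ge0 ?jbX_ge0//.
  by apply: le_trans hc _; rewrite ler_nat.
rewrite ler_wpM2r ?jbX_ge0// ler_wpM2l//.
by apply: gauge_mono; rewrite leq_pmull.
Qed.

(** The scheme of [Gop_bound] with [Qop j] in place of the q_j-derivative. As [Qop] preserves [M],
    the growth on the right does not depend on the number [K] of powers gained. *)
Lemma Top_bound g M K B : symb g (wB M) B ->
  exists k : nat, forall t p,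
    jbracket p ^+ K * cabs (Top (B t) p) <= k%:R * g k t * jbracket p ^+ M.
Proof.
elim: K B => [|K ih] B hB.
  by have [k hk] := Top_bound0 hB; exists k => t p; rewrite expr0 mul1r.
have [k0 h0] := ih B hB.
have [k1 h1] : exists k : nat, forall j t p,
    jbracket p ^+ K * cabs (Top (Qop j (B t)) p) <= k%:R * g k t * jbracket p ^+ M.
  apply: (@fin_unif _ (fun j k => forall t p,
    jbracket p ^+ K * cabs (Top (Qop j (B t)) p) <= k%:R * g k t * jbracket p ^+ M)).
    move=> j k l kl h t p; apply: le_trans (h t p) _.
    by apply: gauge_le => //; rewrite jbX_ge0.
  by move=> j; apply: (ih (fun t => Qop j (B t))); exact: symb_Qop.
exists (k0 + n * k1)%N => t p.
set a := cabs (Top (B t) p).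
set w := jbracket p ^+ M.
have w0 : 0 <= w by rewrite jbX_ge0.
rewrite exprS -mulrA.
apply: le_trans (jb_step p _) _; first by rewrite mulr_ge0 ?jbX_ge0 ?cabs_ge0.
have gk : g k0 t <= g (k0 + n * k1)%N t by apply: gauge_mono; exact: leq_addr.
have [n0|n0] := posnP n.
  rewrite big1 => [|j _]; last by have := ltn_ord j; rewrite {2}n0.
  rewrite addr0; apply: le_trans (h0 t p) _; apply: gauge_le => //.
  exact: leq_addr.
rewrite natrD natrM !mulrDl; apply: lerD.
  by apply: le_trans (h0 t p) _; rewrite ler_wpM2r// ler_wpM2l.
rewrite -!mulrA mulr_natl -[X in _ *+ X](card_ord n) -sumr_const.
apply: ler_sum => j _; rewrite mulrCA /a.
have -> : `|p 0 j| * cabs (Top (B t) p) = cabs (Top (Qop j (B t)) p).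
  by rewrite -(Top_coord t j p hB) cabsM cabsR.
apply: le_trans (h1 j t p) _; rewrite -mulrA ler_wpM2l// ler_wpM2r//.
by apply: gauge_mono; apply: leq_trans (leq_addl _ _); rewrite leq_pmull.
Qed.

Definition wS m (K : nat) (z : 'rV[R]_m) : R := jbracket z ^- K.

Lemma wS_ge0 m : nonneg_weight (@wS m).
Proof. by move=> K z; exact: jbVX_ge0. Qed.

(** The gauge is unchanged, so bounded, moderate and small families of amplitudes all yield Schwartz
    families of the same kind. *)
Lemma symb_Top g M B : symb g (wB M) B -> symb g (@wS n) (fun t => Top (B t)).
Proof.
move=> hB; split=> [t|s K]; first exact/Jint_smooth/(jok_Gop t hB).
(* The first two summands offset the growth of the differentiated amplitude, which rises by one per
   derivative; [K] powers of decay remain. *)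
have [k hk] := Top_bound (M + size (map (@ip n) s) + K) (symb_Dops sg (map (@ip n) s) hB).
exists k => t p; rewrite (Top_pderivs t s hB) /wS.
rewrite ler_pdivlMr ?jbX_gt0// mulrC.
set M' := (M + _)%N in hk *.
rewrite -(@ler_pM2l _ (jbracket p ^+ M')) ?jbX_gt0// mulrA -exprD.
by apply: le_trans (hk t p) _; rewrite mulrC.
Qed.
End OscBounds.

(** * Fourier transform *)

Section SchwartzFamilies.
Variable R : realType.

Lemma schwartz_symb (T : Type) (n : nat) (f : 'rV[R]_n -> R[i]) :
  schwartz f -> symb (gauge1 R T) (@wS R n) (fun _ => f).
Proof.
move=> /schwartzP[h1 h2]; split=> // s K; have [k hk] := h2 s K.
by exists k => t z; rewrite mulr1; exact: hk.
Qed.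

Lemma symb_schwartz (T : Type) (n : nat) (g : gauge R T) F (t : T) :
  symb g (@wS R n) F -> schwartz (F t).
Proof.
move=> [h1 h2]; apply/schwartzP; split=> // s K; have [k hk] := h2 s K.
have [l hl] := nat_ub (k%:R * g k t).
exists l => x; apply: le_trans (hk t x) _.
by rewrite ler_wpM2r ?jbVX_ge0.
Qed.

Definition cgauge (T : Type) (c : T -> R) (c0 : forall t, 0 <= c t) : gauge R T.
Proof. by apply: (@Gauge _ _ (fun _ => c)). Defined.

Lemma eps_gt0 (e : eps_index R) : 0 < val e.
Proof. by case: e => e /= /andP[]. Qed.

Lemma eps_le1 (e : eps_index R) : val e <= 1.
Proof. by case: e => e /= /andP[]. Qed.

Definition gaugeE : gauge R (eps_index R).
Proof.
apply: (@Gauge _ _ (fun k e => val e ^- k)).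
- by move=> k e; rewrite invr_ge0 exprn_ge0// ltW// eps_gt0.
- move=> k l e kl; rewrite lef_pV2 ?posrE ?exprn_gt0 ?eps_gt0//.
  by rewrite ler_wiXn2l// ?eps_le1// ltW// eps_gt0.
Defined.

Lemma jb_scale n (e : eps_index R) (x : 'rV[R]_n) k :
  jbracket (val e *: x) ^- k <= val e ^- k * jbracket x ^- k.
Proof.
rewrite -invfM -exprMn lef_pV2 ?posrE ?exprn_gt0 ?mulr_gt0 ?jb_gt0 ?eps_gt0//.
apply: lerXn2r; rewrite ?nnegrE ?mulr_ge0 ?jb_ge0 ?(ltW (eps_gt0 e))//.
rewrite -(@ler_pXn2r _ 2) ?nnegrE ?mulr_ge0 ?jb_ge0 ?(ltW (eps_gt0 e))//.
rewrite exprMn !jb_sqr !dotE.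
have -> : \sum_i (val e *: x) 0 i ^+ 2 = val e ^+ 2 * \sum_i x 0 i ^+ 2.
  by rewrite mulr_sumr; apply: eq_bigr => i _; rewrite mxE exprMn.
by rewrite mulrDr mulr1 lerD2r expr_le1 ?(ltW (eps_gt0 e))// eps_le1.
Qed.

Lemma scale_dir m n (a : R) (L : 'rV[R]_m -> 'rV[R]_n) : linear L ->
  forall i (t : R) x, a *: L (t *: delta_mx 0 i + x) =
    t *: (a *: L (delta_mx 0 i)) + a *: L x.
Proof. by move=> hL i t x; rewrite hL scalerDr !scalerA [a * t]mulrC. Qed.
End SchwartzFamilies.

Section Fourier.
Variables (R : realType) (n : nat).
Notation Gop := (@Gop R n 1).
Notation d := (n + n + n)%N.
Implicit Types f : 'rV[R]_n -> R[i].

Definition liftq (f : 'rV[R]_n -> R[i]) (z : 'rV[R]_d) : R[i] := f (rsubmx z).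

Lemma rsubmx_dir (i : 'I_d) (t : R) (x : 'rV[R]_d) :
  rsubmx (t *: delta_mx 0 i + x) = t *: rsubmx (delta_mx 0 i : 'rV[R]_d) + rsubmx x :> 'rV[R]_n.
Proof. by rewrite linearP. Qed.

Lemma l1_delta m (i : 'I_m) : l1 (delta_mx 0 i : 'rV[R]_m) = 1.
Proof.
rewrite /l1 (bigD1 i)//= mxE !eqxx normr1 big1 ?addr0// => j ji.
by rewrite mxE (negbTE ji) andbF normr0.
Qed.

Lemma l1_row m k (x : 'rV[R]_m) (y : 'rV[R]_k) : l1 (row_mx x y) = l1 x + l1 y.
Proof.
rewrite /l1 big_split_ord /=; congr (_ + _); apply: eq_bigr => i _.
  by rewrite row_mxEl.
by rewrite row_mxEr.
Qed.

Lemma l1_rsubmx m k (x : 'rV[R]_(m + k)) : l1 (rsubmx x) <= l1 x.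
Proof. by rewrite -{2}(hsubmxK x) l1_row lerDr l1_ge0. Qed.

Lemma l1_lsubmx m k (x : 'rV[R]_(m + k)) : l1 (lsubmx x) <= l1 x.
Proof. by rewrite -{2}(hsubmxK x) l1_row lerDl l1_ge0. Qed.

Lemma symb_liftq (T : Type) (g : gauge R T) F M : symb g (@wS R n) F ->
  symb g (@wB R n M) (fun t => liftq (F t)).
Proof.
apply: (@symb_comp R T d n (fun _ z => rsubmx z) (fun _ i => rsubmx (delta_mx 0 i : 'rV[R]_d)) 1).
- by move=> th i t x; exact: rsubmx_dir.
- by move=> th i; apply: le_trans (l1_rsubmx _) _; rewrite l1_delta.
- exact: wS_ge0.
- exact: wB_ge0.
- move=> K; exists K, 1%N => t z; rewrite mul1r /wS /wB.
  by rewrite ler_peMl ?jbVX_ge0// mulr_ege1// jbX_ge1.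
Qed.

Lemma fourier_kernel f (xi : 'rV[R]_n) : (fun q => expi (- dot q xi) * f q) =
  fun q => liftq f (row_mx (row_mx 0 xi) q) * osc 1 (row_mx (row_mx 0 xi) q).
Proof.
apply/funext => q.
rewrite /liftq row_mxKr mulrC -[row_mx (row_mx 0 xi) q]/(cat3 0 xi q) /osc.
by rewrite phase_cat3 sub0r mul1r; congr (_ * expi _); rewrite /dot -sumrN;
  apply: eq_bigr => i _; rewrite !mxE mulNr.
Qed.

(** The Fourier transform is the inner integral at p = 0 for an amplitude depending on q only, so
    its decay is a case of [Gop_decay]. *)
Lemma fourierE f : fourier f = fun xi => Gop (liftq f) (row_mx 0 xi).
Proof. by apply/funext => xi; rewrite /fourier fourier_kernel. Qed.

Lemma fourier_symb (T : Type) (g : gauge R T) F : symb g (@wS R n) F ->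
  symb g (@wS R n) (fun t => fourier (F t)).
Proof.
move=> hF; have hB := symb_liftq 0 hF.
have sg2 : (1 : R) * 1 = 1 by rewrite mul1r.
split=> [t|s K].
  rewrite fourierE; apply: smooth_slicer.
  exact/Jint_smooth/(jok_bosc 1 t hB).
set s' := map (@lshift (n + n) n) (map (@rshift n n) s).
have [k hk] := Gop_decay sg2 K (symb_Dops 1 s' hB).
exists k => t xi; rewrite fourierE slice_pderivsr (Gop_pderivs 1 t _ hB).
apply: le_trans (hk t 0 xi) _; rewrite mulrA ler_wpM2r ?jbVX_ge0//.
rewrite (_ : jbracket 0 = 1) ?expr1n ?mulr1//.
by rewrite /jbracket /enorm dotE big1 ?sqrtr0 ?expr0n ?addr0 ?sqrtr1// => i _; rewrite mxE expr0n.
Qed.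

Lemma schwartz_fourier f : schwartz f -> schwartz (fourier f).
Proof. by move=> /(@schwartz_symb R unit)/fourier_symb/(symb_schwartz tt). Qed.

Lemma fourier_pderiv f j : schwartz f ->
  pderiv j (fourier f) = fourier (fun x => (- 'i * (x 0 j)%:C) * f x).
Proof.
move=> hf; have hB := symb_liftq 0 (@schwartz_symb R unit n f hf).
rewrite fourierE; have /= -> := @slice_pderivsr R n n [:: j] (Gop (liftq f)) 0.
apply/funext => xi; rewrite (Gop_pderiv 1 tt _ hB) fourierE.
congr cintegral; apply/funext => q; congr (_ * _).
rewrite /Dop pderiv_phaseC -[row_mx (row_mx 0 xi) q]/(cat3 0 xi q).
rewrite -[lshift n (rshift n j)]/(@ixi n j).
have -> : pderiv (@ixi n j) (liftq f) (cat3 0 xi q) = 0.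
  have [sf _] := hf.
  have hd i (t : R) x := rsubmx_dir i t x.
  rewrite (pderiv_comp hd); last exact: smooth_cdiff.
  apply: big1 => i _; rewrite !mxE /= (_ : (rshift (n + n) i == ixi j) = false).
    by rewrite mul0r.
  exact: iq_ixi.
rewrite add0r (bigD1 j)//= big1 => [|k kj]; last first.
  by rewrite ip_ixi ixi_ixi iq_ixi (negbTE kj) subrr mul0r mulr0 addr0.
rewrite ip_ixi ixi_ixi iq_ixi eq_refl cat3_ip cat3_iq.
rewrite [(0 : 'rV[R]_n) 0 j]mxE /liftq row_mxKr.
rewrite -[true%:R]/(1 : R[i]) -[false%:R]/(0 : R[i]).
rewrite -[(0 : R)%:C]/(0 : R[i]) -[(1 : R)%:C]/(1 : R[i]); by ring.
Qed.

Lemma schwartz_coordM f (c : R[i]) j : schwartz f ->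
  schwartz (fun x => (c * (x 0 j)%:C) * f x).
Proof.
move=> hf; apply/schwartzP; have [sf bf] := (schwartzP f).1 hf.
have sc : smooth (fun x : 'rV[R]_n => c * (x 0 j)%:C) by apply/smoothZ/smooth_coord.
split; first exact: smoothM.
move=> s K.
have [k hk] : exists k : nat, forall s', (size s' <= size s)%N -> forall x,
    cabs (pderivs s' f x) <= k%:R * jbracket x ^- K.+1.
  apply: (@list_unif n (fun s' k => forall x,
    cabs (pderivs s' f x) <= k%:R * jbracket x ^- K.+1)) => // s' k l kl h x.
  by apply: le_trans (h x) _; rewrite ler_wpM2r ?jbVX_ge0// ler_nat.
have [l hl] := nat_ub (cabs c).
exists (2 ^ size s * l * k)%N => x.
apply: le_trans (@pderivsM_bound _ _ s _ f x (l%:R * jbracket x) _ sc sf _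
  (fun s' hs' => hk s' hs' x)) _.
  - move=> s' _; rewrite pderivsZ; last exact: smooth_coord.
  rewrite cabsM; apply: ler_pM; rewrite ?cabs_ge0 ?hl//.
  by apply: coord_bound; [exact: jb_ge1|exact: coord_jb].
rewrite !natrM natrX -!mulrA ler_wpM2l ?exprn_ge0// ler_wpM2l// mulrCA ler_wpM2l//.
by rewrite exprS invfM mulrA mulfV ?mul1r// gt_eqF// jb_gt0.
Qed.
End Fourier.

(** * Oscillatory integrals as iterated integrals *)

Section Uniform.
Variable R : realType.

Lemma schwartz_unif d (f : 'rV[R]_d -> R[i]) N K : schwartz f ->
  exists k : nat, forall s, (size s <= N)%N -> forall z,
    cabs (pderivs s f z) <= k%:R * jbracket z ^- K.
Proof.
move=> /(@schwartz_symb R unit) /(@symb_unif _ _ _ _ _ _ N K (@wS_ge0 R d)) [k hk].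
by exists k => s hs z; have := hk s hs tt z; rewrite mulr1.
Qed.

Lemma schwartz_dec d (f : 'rV[R]_d -> R[i]) : schwartz f -> dec f.
Proof.
move=> hf; have [k hk] := schwartz_unif 0 d.*2 hf.
by apply: (dec_cont (C := k%:R)); [exact: smooth_ccont hf.1|exact: (hk [::])].
Qed.

Lemma schwartz_mul_dec d (f g : 'rV[R]_d -> R[i]) :
  schwartz f -> schwartz g -> dec (fun x => f x * g x).
Proof.
move=> sf sh; have [k hk] := schwartz_unif 0 d.*2 sf; have [l hl] := schwartz_unif 0 0 sh.
apply: (dec_cont (C := k%:R * l%:R)); first exact/smooth_ccont/(smoothM sf.1 sh.1).
move=> y; rewrite cabsM mulrAC; apply: ler_pM; rewrite ?cabs_ge0//; first exact: (hk [::]).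
by have := hl [::] isT y; rewrite expr0 invr1 mulr1.
Qed.

(** A limit at 0+ only sees parameters in ]0, 1], so the cut-off scale can range over [eps_index]
    and the cut-off error be treated as a symbol with gauge epsilon. *)
Lemma ccvg_linear (F : R -> R[i]) l (C : R) :
  (forall e : eps_index R, cabs (F (val e) - l) <= C * val e) -> ccvg_at0r F l.
Proof.
move=> hF.
have key (u : R[i] -> R) : (forall x y, u (x - y) = u x - u y) ->
    (forall x, `|u x| <= cabs x) -> (fun h => u (F h)) @ 0^'+ --> u l.
  move=> uB ule; apply/cvgrPdist_le => /= eps e0.
  near=> h.
  have h0 : 0 < h by near: h; exact: nbhs_right_gt.
  have h1 : h <= 1 by near: h; apply: nbhs_right_le.
  have hh : 0 < h <= 1 by rewrite h0.
  have := hF (exist _ h hh) => /= hFh.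
  rewrite distrC -uB; apply: le_trans (ule _) _; apply: le_trans hFh _.
  have C1 : 0 < `|C| + 1 by rewrite ltr_wpDl.
  apply: (@le_trans _ _ ((`|C| + 1) * h)).
    by rewrite ler_wpM2r ?(ltW h0)// (le_trans (ler_norm _))// lerDl.
  rewrite mulrC -ler_pdivlMr//; near: h; apply: nbhs_right_le.
  exact: divr_gt0.
split; apply: key.
- by move=> x y; rewrite cReD cReN.
- exact: le_Re_cabs.
- by move=> x y; rewrite cImD cImN.
- exact: le_Im_cabs.
Unshelve. all: by end_near.
Qed.

Lemma ccvg_unique (F : R -> R[i]) l l' : ccvg_at0r F l -> ccvg_at0r F l' -> l = l'.
Proof.
move=> [h1 h2] [h1' h2']; apply: ceq.
- exact: (cvg_unique _ h1 h1').
- exact: (cvg_unique _ h2 h2').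
Qed.

End Uniform.

Section Regularisation.
Variables (R : realType) (n : nat) (sg : R).
Hypothesis sg2 : sg * sg = 1.
Notation d := (n + n + n)%N.
Variables (b : 'rV[R]_d -> R[i]) (M : nat).
Hypothesis hb : symb (gauge1 R unit) (@wB R n M) (fun _ => b).

Section Cutoff.
Variable psi : 'rV[R]_(n + n) -> R[i].
Hypotheses (hpsi : schwartz psi) (psi0 : psi 0 = 1).

Definition qxi (z : 'rV[R]_d) : 'rV[R]_(n + n) := row_mx (rsubmx z) (rsubmx (lsubmx z)).

Lemma qxi_dir (h : R) (i : 'I_d) (t : R) (x : 'rV[R]_d) :
  h *: qxi (t *: delta_mx 0 i + x) = t *: (h *: qxi (delta_mx 0 i)) + h *: qxi x.
Proof.
rewrite /qxi !linearP /= -add_row_mx -scale_row_mx scalerDr !scalerA.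
by rewrite [h * t]mulrC.
Qed.

Lemma l1_qxi z : l1 (qxi z) <= l1 z.
Proof.
rewrite l1_row -[leRHS](congr1 (@l1 R d) (hsubmxK z)) l1_row addrC lerD2r.
exact: l1_rsubmx.
Qed.

Lemma jb_wP (z : 'rV[R]_d) : jbracket z <= wP 1 0 z.
Proof.
rewrite /wP expr1 -{1}(hsubmxK z); apply: le_trans (jb_row _ _) _.
rewrite ler_wpM2r ?jb_ge0// -{1}(hsubmxK (lsubmx z)); exact: jb_row.
Qed.

Definition epsG : gauge R (eps_index R) := cgauge (fun e => ltW (eps_gt0 e)).

(** The value is O(epsilon) by a first order expansion at 0, where [psi] is 1, and every derivative
    brings a factor epsilon. The price is linear growth in z, which amplitudes may have. *)
Lemma cutoff_symb : symb epsG (@wP R n 1) (fun e z => psi (val e *: qxi z) - 1).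
Proof.
have [spsi _] := hpsi.
have hd (e : eps_index R) := qxi_dir (val e).
have sc (e : eps_index R) : smooth (fun z => psi (val e *: qxi z)).
  exact: (smooth_comp (hd e)).
split=> [e|s K]; first by apply: smoothB => //; exact: smooth_cst.
have [k hk] := schwartz_unif (maxn 1 (size s)) 0 hpsi.
have {}hk s' : (size s' <= maxn 1 (size s))%N -> forall z, cabs (pderivs s' psi z) <= k%:R.
  by move=> hs z; have := hk s' hs z; rewrite expr0 invr1 mulr1.
exists (2 * k * d + k)%N => e z; rewrite -[epsG _ e]/(val e).
have e0 := eps_gt0 e; have e1 := eps_le1 e.
have w1 := wP_ge1 1 K z; have jw := jb_wP z; rewrite -[wP 1 0 z]/(wP 1 K z) in jw.
move: (wP 1 K z) w1 jw => W w1 jw.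
have t0 : 0 <= k%:R * val e * W.
  by apply: mulr_ge0; [apply: mulr_ge0 => //; exact: ltW|exact: le_trans w1].
case: s hk => [|i s] hk.
  have := @taylor R _ 1 psi 0 (val e *: qxi z) k%:R spsi.
  rewrite big_ord1 -[iter _ _ _ _]/(psi 0) add0r psi0 mulr1 fact0 invr1 expr1.
  move=> /(_ _)/le_trans; apply.
    by move=> t _ s hs; apply: hk; rewrite hs leq_maxl.
  rewrite l1Z ger0_norm ?(ltW e0)//.
  apply: le_trans (_ : (2 * k * d)%:R * val e * W <= _); last first.
    by rewrite [in leRHS]natrD -!mulrA [leRHS]mulrDl lerDl !mulrA.
  have -> : 2 * (val e * l1 (qxi z) * k%:R) = 2 * k%:R * val e * l1 (qxi z) by ring.
  rewrite !natrM /= -!mulrA ler_wpM2l// ler_wpM2l// [leRHS]mulrCA ler_wpM2l ?(ltW e0)//.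
  apply: le_trans (l1_qxi z) _; apply: le_trans (l1_jb z) _.
  by rewrite ler_wpM2l.
rewrite pderivsB//; last exact: smooth_cst.
rewrite pderivs_cst subr0.
apply: le_trans (@pderivs_comp_bound _ _ _ (fun z => val e *: qxi z) _
  (hd e) (i :: s) psi z (val e) k%:R spsi _ _ _) _ => //.
- move=> j; rewrite l1Z ger0_norm ?(ltW e0)// -[leRHS]mulr1 ler_wpM2l ?(ltW e0)//.
  by apply: le_trans (l1_qxi _) _; rewrite l1_delta.
- by move=> s' hs'; apply: hk; rewrite hs' leq_maxr.
apply: le_trans (_ : k%:R * val e * W <= _); last first.
  rewrite natrD -!mulrA [leRHS]mulrDl lerDr.
  by rewrite mulr_ge0// mulr_ge0// ?(ltW e0)// (le_trans ler01 w1).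
rewrite mulrC -mulrA ler_wpM2l// -[leLHS]mulr1; apply: ler_pM => //.
  by rewrite exprn_ge0 ?(ltW e0).
by rewrite /= exprS -[leRHS]mulr1 ler_wpM2l ?(ltW e0)// exprn_ile1 ?(ltW e0).
Qed.

Definition pqx (p : 'rV[R]_n) (z : 'rV[R]_(n + n)) : 'rV[R]_d :=
  cat3 p (rsubmx z) (lsubmx z).

Lemma pqx_dir p (i : 'I_(n + n)) (t : R) (x : 'rV[R]_(n + n)) :
  pqx p (t *: delta_mx 0 i + x) =
  t *: cat3 0 (rsubmx (delta_mx 0 i : 'rV[R]_(n + n))) (lsubmx (delta_mx 0 i : 'rV[R]_(n + n))) +
  pqx p x.
Proof.
rewrite /pqx /cat3 !linearP /= scale_row_mx add_row_mx scale_row_mx add_row_mx.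
by rewrite scaler0 add0r.
Qed.

(** With the cut-off the double integral converges absolutely, so Fubini allows q to be integrated
    first. *)
Lemma Top_cutoff (e : eps_index R) p :
  cintegral (fun z => b (pqx p z) * osc sg (pqx p z) * psi (val e *: z)) =
  Top sg (fun z => b z * psi (val e *: qxi z)) p.
Proof.
have [spsi _] := hpsi; have [sb /(_ [::] 0%N) [k hk]] := hb.
set F := (fun z => _).
have cF : ccont F.
  apply: ccontM.
    apply: (@ccont_comp R _ _ (pqx p) (fun z => b z * osc sg z)).
      exact: dirmap_continuous (pqx_dir p).
    exact/smooth_ccont/bosc_smooth/(sb tt).
  have hd i (t : R) x := @scale_dir R (n + n) (n + n) (val e) id (fun c u v => erefl) i t x.
  apply: (@ccont_comp R _ _ (fun z : 'rV[R]_(n + n) => val e *: z) psi).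
    exact: (dirmap_continuous hd).
  exact: smooth_ccont.
(* [M] powers compensate the growth of [b] in xi; the rest is the integrable exponent in dimension
   [n + n]. *)
have [l hl] := schwartz_unif 0 (M + (n + n).*2) hpsi.
pose C := k%:R * jbracket p ^+ M * (l%:R * val e ^- (M + (n + n).*2)).
have C0 : 0 <= C by rewrite !mulr_ge0 ?jbX_ge0// invr_ge0 exprn_ge0// ltW// eps_gt0.
have bF z : cabs (F z) <= C * jbracket z ^- (n + n).*2.
  rewrite cabsM cabsM cabs_osc mulr1.
  apply: (@le_trans _ _ ((k%:R * jbracket p ^+ M * jbracket z ^+ M) *
     (l%:R * (val e ^- (M + (n + n).*2) * jbracket z ^- (M + (n + n).*2))))).
    apply: ler_pM; rewrite ?cabs_ge0//.
      apply: le_trans (hk tt _) _; rewrite wB_cat3 expr0 invr1 !mulr1 mulrA.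
      rewrite ler_wpM2l ?mulr_ge0 ?jbX_ge0//; apply: lerXn2r; rewrite ?nnegrE ?jb_ge0//.
      by rewrite -{2}(hsubmxK z) jb_rowr.
    apply: le_trans (hl [::] isT _) _; rewrite ler_wpM2l//; exact: jb_scale.
  rewrite [jbracket z ^+ (M + _)]exprD invfM /C.
  have jz : jbracket z ^+ M != 0 by rewrite gt_eqF// jbX_gt0.
  apply: eq_ler.
  move: (jbracket z ^+ M) jz (jbracket z ^- _) (val e ^- _) (jbracket p ^+ M) => u hu v x y.
  by field.
rewrite (cintegral_split cF (dec_cont cF bF)).
rewrite (@cintegral_swap _ _ _ (fun q xi => F (row_mx q xi)) C).
- rewrite /Top /Jint; congr cintegral; apply/funext => xi; congr cintegral.
  apply/funext => q; rewrite /F /pqx row_mxKl row_mxKr.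
  by rewrite -[row_mx (row_mx p xi) q]/(cat3 p xi q) /qxi /cat3 row_mxKr row_mxKl row_mxKr mulrAC.
- by move=> y; apply: (ccont_comp _ cF); exact: continuous_row_mxl.
- by move=> x; apply: (ccont_comp _ cF); exact: continuous_row_mxr.
- move=> q xi; apply: le_trans (bF _) _; rewrite -mulrA ler_wpM2l// doubleD.
  exact: jbVX_row.
Qed.

(** The error is [Top] of [b] times the cut-off error; [Top_bound0] preserves the gauge epsilon and
    so gives a linear rate. *)
Lemma Top_cutoff_cvg p :
  ccvg_at0r (fun h => cintegral (fun z => b (pqx p z) * osc sg (pqx p z) * psi (h *: z)))
    (Top sg b p).
Proof.
have hbE : symb (gauge1 R (eps_index R)) (@wB R n M) (fun _ => b).
  exact: (@symb_reindex R unit (eps_index R) (fun=> tt) _ (gauge1 R unit)).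
have hD : symb epsG (@wB R n (1 + M)) (fun e z => (psi (val e *: qxi z) - 1) * b z).
  apply: (symbM (@wP_ge0 R n 1) (@wB_ge0 R n M) (@wB_ge0 R n (1 + M)) _ _ cutoff_symb hbE).
  - exact: wPB.
  - by move=> k; exists 1%N => e; rewrite mul1r mulr1.
have hD1 : symb (gauge1 R (eps_index R)) (@wB R n (1 + M))
    (fun e z => (psi (val e *: qxi z) - 1) * b z).
  apply: symb_gauge hD; first exact: wB_ge0.
  by move=> k; exists 1%N => e; rewrite mul1r; exact: eps_le1.
have [k hk] := Top_bound0 sg2 hD.
apply: (@ccvg_linear _ _ _ (k%:R * jbracket p ^+ (1 + M))) => e.
rewrite Top_cutoff.
have -> : (fun z => b z * psi (val e *: qxi z)) =
    (fun z => (psi (val e *: qxi z) - 1) * b z + b z).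
  by apply/funext => z; rewrite mulrBl mul1r subrK mulrC.
rewrite (TopD sg2 e hD1 hbE) addrK.
by apply: le_trans (hk e p) _; rewrite mulrAC.
Qed.
End Cutoff.

Lemma Top_oscillatory p :
  is_oscillatory (fun z => b (pqx p z) * osc sg (pqx p z)) (Top sg b p).
Proof. by move=> psi hpsi psi0; exact: Top_cutoff_cvg. Qed.

(** [xget] returns some value that is the limit for every cut-off. It is identified by comparing
    limits along one cut-off, which is why a [psi] has to be supplied. *)
Lemma oscillatoryE (psi : 'rV[R]_(n + n) -> R[i]) p : schwartz psi -> psi 0 = 1 ->
  oscillatory (fun z => b (pqx p z) * osc sg (pqx p z)) = Top sg b p.
Proof.
move=> hpsi psi0; rewrite /oscillatory.
set F := (fun z => _); case: xgetP => [l _ /= hl|/(_ (Top sg b p))]; last first.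
  by case; exact: Top_oscillatory.
by apply: ccvg_unique (hl psi hpsi psi0) _; exact: Top_oscillatory.
Qed.
End Regularisation.

(** * Mollifiers *)

Lemma symb_pullback (R : realType) d m (L : 'rV[R]_d -> 'rV[R]_m) (v : 'I_d -> 'rV[R]_m)
    (A : nat) (f : 'rV[R]_m -> R[i]) :
  (forall i (t : R) x, L (t *: delta_mx 0 i + x) = t *: v i + L x) ->
  (forall i, l1 (v i) <= A%:R) -> schwartz f ->
  symb (gauge1 R unit) (fun K z => jbracket (L z) ^- K) (fun _ z => f (L z)).
Proof.
move=> hL hA hf.
apply: (@symb_comp R unit d m (fun _ => L) (fun _ => v) A (gauge1 R unit) (@wS R m) _
  (fun _ => f)) => //.
- exact: wS_ge0.
- by move=> K z; exact: jbVX_ge0.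
- by move=> K; exists K, 1%N => t z; rewrite mul1r.
- exact: schwartz_symb.
Qed.

Lemma symb_lsubmx (R : realType) m n (f : 'rV[R]_m -> R[i]) : schwartz f ->
  symb (gauge1 R unit) (fun K (z : 'rV[R]_(m + n)) => jbracket (lsubmx z) ^- K)
    (fun _ z => f (lsubmx z)).
Proof.
apply: (@symb_pullback R (m + n) m _ (fun i => lsubmx (delta_mx 0 i : 'rV[R]_(m + n))) 1).
- by move=> i t x; rewrite linearP.
- by move=> i; apply: le_trans (l1_lsubmx _) _; rewrite l1_delta.
Qed.

Section Tensor.
Variables (R : realType) (m n : nat).

Lemma schwartz_tensor (f : 'rV[R]_m -> R[i]) (g : 'rV[R]_n -> R[i]) :
  schwartz f -> schwartz g ->
  schwartz (fun z : 'rV[R]_(m + n) => f (lsubmx z) * g (rsubmx z)).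
Proof.
move=> hf hg.
pose w1 K (z : 'rV[R]_(m + n)) := jbracket (lsubmx z) ^- K.
pose w2 K (z : 'rV[R]_(m + n)) := jbracket (rsubmx z) ^- K.
have w10 : nonneg_weight w1 by move=> K z; exact: jbVX_ge0.
have w20 : nonneg_weight w2 by move=> K z; exact: jbVX_ge0.
have h1 : symb (gauge1 R unit) w1 (fun _ z => f (lsubmx z)) by exact: symb_lsubmx.
have h2 : symb (gauge1 R unit) w2 (fun _ z => g (rsubmx z)).
  apply: (@symb_pullback R (m + n) n _ (fun i => rsubmx (delta_mx 0 i : 'rV[R]_(m + n))) 1) => //.
  - by move=> i t x; rewrite linearP.
  - by move=> i; apply: le_trans (l1_rsubmx _) _; rewrite l1_delta.
apply: (symb_schwartz tt (g := gauge1 R unit) (F := fun _ z => f (lsubmx z) * g (rsubmx z))).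
apply: (symbM w10 w20 (@wS_ge0 R (m + n)) _ _ h1 h2).
- move=> K; exists K, K, 1%N => z; rewrite mul1r /w1 /w2 /wS -invfM -exprMn.
  rewrite lef_pV2 ?posrE ?exprn_gt0 ?mulr_gt0 ?jb_gt0//.
  apply: lerXn2r; rewrite ?nnegrE ?mulr_ge0 ?jb_ge0//.
  by rewrite -{1}(hsubmxK z); exact: jb_row.
- by move=> k; exists 1%N => t; rewrite !mul1r.
Qed.
End Tensor.

Section Mollifier.
Variables (R : realType) (n : nat) (phi : 'rV[R]_n -> R[i]).
Hypothesis hphi : mollifier phi.
Local Notation phat := (fourier phi).
Implicit Types e : eps_index R.

Lemma moll_schwartz : schwartz phi. Proof. by case: hphi. Qed.
Lemma phat_schwartz : schwartz phat.
Proof. exact/schwartz_fourier/moll_schwartz. Qed.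

Lemma fourier_pderivs (s : seq 'I_n) (f : 'rV[R]_n -> R[i]) : schwartz f ->
  pderivs s (fourier f) = fourier (fun x => (- 'i) ^+ size s * (zpow x s)%:C * f x).
Proof.
elim/last_ind: s f => [|s i ih] f hf.
  by congr fourier; apply/funext => x; rewrite /zpow big_nil expr0 !mul1r.
rewrite pderivs_rcons fourier_pderiv// ih; last exact: schwartz_coordM.
congr fourier; apply/funext => x.
by rewrite size_rcons exprS /zpow -cats1 big_cat big_seq1 RCM; ring.
Qed.

Lemma fourier0 (f : 'rV[R]_n -> R[i]) : fourier f 0 = cintegral f.
Proof.
congr cintegral; apply/funext => x.
by rewrite /dot big1 ?oppr0 ?expi0 ?mul1r// => i _; rewrite mxE mulr0.
Qed.

Lemma schwartz_zpow (s : seq 'I_n) (f : 'rV[R]_n -> R[i]) : schwartz f ->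
  schwartz (fun x => (zpow x s)%:C * f x).
Proof.
move=> hf; elim: s => [|i s ih].
  by rewrite (_ : (fun x => _) = f)//; apply/funext => x; rewrite /zpow big_nil mul1r.
rewrite (_ : (fun x => _) = fun x : 'rV[R]_n => (1 * (x 0 i)%:C) * ((zpow x s)%:C * f x)).
  exact: schwartz_coordM.
by apply/funext => x; rewrite /zpow big_cons RCM mul1r mulrA.
Qed.

Lemma moll_moment (s : seq 'I_n) : (0 < size s)%N ->
  cintegral (fun x => (zpow x s)%:C * phi x) = 0.
Proof.
move=> s0; have [_ _ /(_ (mindex s)) hm] := hphi.
rewrite -[RHS]hm; first by congr cintegral; apply/funext => x; rewrite zpow_mpow.
apply/eqP => h; have := mlength_mindex s; rewrite h /mlength big1 => [s00|i _].
  by rewrite -s00 in s0.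
by rewrite mxE.
Qed.

(** The derivatives of the Fourier transform at 0 are the moments of [phi] up to constants, so the
    moment conditions make [phat - 1] flat at 0. *)
Lemma phat_flat (s : seq 'I_n) : pderivs s (fun x => phat x - 1) 0 = 0.
Proof.
have [sp _] := phat_schwartz.
rewrite pderivsB//; last exact: smooth_cst.
case: s => [|i s].
  by rewrite /= fourier0; case: hphi => _ -> _; rewrite subrr.
rewrite pderivs_cst subr0 fourier_pderivs; last exact: moll_schwartz.
rewrite fourier0 -[RHS](mulr0 ((- 'i) ^+ size (i :: s))) -(@moll_moment (i :: s))//.
rewrite -cintegralZ.
  by congr cintegral; apply/funext => x; rewrite mulrA.
exact/schwartz_dec/schwartz_zpow/moll_schwartz.
Qed.

Lemma phat_bound (s : seq 'I_n) q : exists k : nat, forall x,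
  cabs (pderivs s (fun x => phat x - 1) x) <= k%:R * l1 x ^+ q.
Proof.
have [sp _] := phat_schwartz.
have sr : smooth (fun x => phat x - 1) by apply: smoothB => //; exact: smooth_cst.
have [k hk] := schwartz_unif (q + size s) 0 phat_schwartz.
have hk1 s' x : (size s' <= q + size s)%N ->
    cabs (pderivs s' (fun x => phat x - 1) x) <= k.+1%:R.
  move=> hs; rewrite pderivsB//; last exact: smooth_cst.
  apply: le_trans (cabsB _ _) _; rewrite -[k.+1]addn1 natrD; apply: lerD.
    by have := hk s' hs x; rewrite expr0 invr1 mulr1.
  case: s' hs => [|i s'] _; last by rewrite pderivs_cst cabs0.
  by rewrite -[pderivs _ _ _]/(1 : R[i]) cabs1.
exists (2 * k.+1)%N => x.
have := @taylor R n q (pderivs s (fun x => phat x - 1)) 0 x k.+1%:R (smooth_pderivs s sr).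
(* All Taylor coefficients at 0 vanish by [phat_flat], so the function is its own remainder. *)
rewrite add0r big1 ?subr0 => [|m _]; last first.
  rewrite (_ : iter _ _ _ _ = 0) ?mulr0//.
  apply: Normc.eq0_normc; apply/eqP; rewrite eq_le cabs_ge0 andbT.
  rewrite -(mulr0 (l1 x ^+ m)); apply: iter_ddir_bound; first exact: smooth_pderivs.
  by move=> s' _; rewrite -pderivs_cat phat_flat cabs0.
move=> /(_ _)/le_trans; apply.
  by move=> t _ s' hs; rewrite -pderivs_cat; apply: hk1; rewrite size_cat hs.
by rewrite natrM mulrCA mulrC.
Qed.

Definition gaugeQ q : gauge R (eps_index R) :=
  cgauge (fun e => exprn_ge0 q (ltW (eps_gt0 e))).

Definition wQ q (K : nat) (x : 'rV[R]_n) : R := jbracket x ^+ q.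

Lemma scalee_dir e (i : 'I_n) (t : R) (x : 'rV[R]_n) :
  val e *: (t *: delta_mx 0 i + x) = t *: (val e *: delta_mx 0 i) + val e *: x.
Proof. exact: (@scale_dir R n n (val e) id (fun c u v => erefl)). Qed.

Lemma l1_scalee e (i : 'I_n) : l1 (val e *: (delta_mx 0 i : 'rV[R]_n)) = val e.
Proof. by rewrite l1Z l1_delta mulr1 ger0_norm// ltW// eps_gt0. Qed.

(** Flatness at 0 gives a factor (epsilon |x|)^q, that is, epsilon^q at the price of growth of order
    [q] in x; the chain rule contributes only factors at most 1. *)
Lemma phat_cut q : symb (gaugeQ q) (wQ q) (fun e x => phat (val e *: x) - 1).
Proof.
have [sp _] := phat_schwartz.
have sr : smooth (fun x => phat x - 1) by apply: smoothB => //; exact: smooth_cst.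
split=> [e|s K].
  exact: (@smooth_comp R n n (fun x => val e *: x) _
    (scalee_dir e) (fun x => phat x - 1)).
have [k hk] : exists k : nat, forall s', (size s' <= size s)%N -> forall x,
    cabs (pderivs s' (fun x => phat x - 1) x) <= k%:R * l1 x ^+ q.
  apply: (@list_unif n (fun s' k => forall x,
    cabs (pderivs s' (fun x => phat x - 1) x) <= k%:R * l1 x ^+ q)).
    move=> s' k l kl h x; apply: le_trans (h x) _.
    by rewrite ler_wpM2r ?exprn_ge0 ?l1_ge0// ler_nat.
  by move=> s'; exact: phat_bound.
exists (k * n ^ q)%N => e x; rewrite -[gaugeQ q _ e]/(val e ^+ q).
have e0 := ltW (eps_gt0 e).
apply: le_trans (@pderivs_comp_bound _ _ _ (fun z => val e *: z) _
  (scalee_dir e) s (fun x => phat x - 1) x 1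
  (k%:R * l1 (val e *: x) ^+ q) sr _ _ _) _.
- by move=> i; rewrite l1_scalee eps_le1.
- by move=> s' hs'; apply: hk; rewrite hs'.
- by rewrite mulr_ge0// exprn_ge0// l1_ge0.
rewrite expr1n mul1r l1Z ger0_norm// natrM natrX exprMn -!mulrA ler_wpM2l//.
rewrite mulrCA ler_wpM2l ?exprn_ge0// /wQ -exprMn.
by apply: lerXn2r; rewrite ?nnegrE ?l1_ge0 ?mulr_ge0 ?jb_ge0// l1_jb.
Qed.

Definition w1 (K : nat) (x : 'rV[R]_n) : R := 1.

Lemma w1_ge0 : nonneg_weight w1. Proof. by []. Qed.
Lemma wQ_ge0 q : nonneg_weight (wQ q). Proof. by move=> K x; exact: jbX_ge0. Qed.

Lemma phat_scale_bounded : symb (gauge1 R (eps_index R)) w1 (fun e x => phat (val e *: x)).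
Proof.
apply: (@symb_comp R (eps_index R) n n (fun e x => val e *: x)
  (fun e i => val e *: delta_mx 0 i) 1 _ (@wS R n) w1 (fun _ => phat)).
- exact: scalee_dir.
- by move=> e i; rewrite l1_scalee eps_le1.
- exact: wS_ge0.
- exact: w1_ge0.
- by move=> K; exists 0%N, 1%N => e x; rewrite /wS expr0 invr1 mulr1.
- exact/schwartz_symb/phat_schwartz.
Qed.

(** The counterpart of [phat_scale_bounded]: decay of order [K] costs epsilon^-K. It makes moderate
    nets integrable, whereas the version without decay keeps bounded Schwartz families bounded. *)
Lemma phat_scale_moderate : symb (gaugeE R) (@wS R n) (fun e x => phat (val e *: x)).
Proof.
have [sp _] := phat_schwartz.
split=> [e|s K].
  exact: (smooth_comp (scalee_dir e)).
have [k hk] := schwartz_unif (size s) K phat_schwartz.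
exists (maxn k K) => e x; have e0 := ltW (eps_gt0 e).
apply: le_trans (@pderivs_comp_bound _ _ _ (fun z => val e *: z) _
  (scalee_dir e) s phat x 1
  (k%:R * jbracket (val e *: x) ^- K) sp _ _ _) _.
- by move=> i; rewrite l1_scalee eps_le1.
- by move=> s' hs'; apply: hk; rewrite hs'.
- by rewrite mulr_ge0// jbVX_ge0.
rewrite expr1n mul1r -mulrA; apply: ler_pM; rewrite ?jbVX_ge0// ?ler_nat ?leq_maxl//.
apply: le_trans (jb_scale e x K) _; rewrite /wS ler_wpM2r ?jbVX_ge0//.
exact: (gauge_mono (gaugeE R) e (leq_maxr k K)).
Qed.

Lemma scaleV_dir e (i : 'I_n) (t : R) (x : 'rV[R]_n) :
  (val e)^-1 *: (t *: delta_mx 0 i + x) =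
  t *: ((val e)^-1 *: delta_mx 0 i) + (val e)^-1 *: x.
Proof. exact: (@scale_dir R n n (val e)^-1 id (fun c u v => erefl)). Qed.

Lemma moll_moderate : symb (gaugeE R) (@wS R n) (fun e => moll phi (val e)).
Proof.
have [sp _] := moll_schwartz.
have sc e : smooth (fun x => phi ((val e)^-1 *: x)).
  exact: (smooth_comp (scaleV_dir e)).
split=> [e|s K]; first exact: smoothZ.
have [k hk] := schwartz_unif (size s) K moll_schwartz.
exists (maxn k (n + size s)) => e x; have e0 := eps_gt0 e.
have eX0 j : 0 <= val e ^- j by rewrite invr_ge0 exprn_ge0// ltW.
rewrite pderivsZ// cabsM cabsR ger0_norm//.
apply: (@le_trans _ _ (val e ^- n * ((val e)^-1 ^+ size s * (k%:R * jbracket x ^- K)))).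
  rewrite ler_wpM2l//.
  apply: le_trans (@pderivs_comp_bound _ _ _ (fun z => (val e)^-1 *: z) _
    (scaleV_dir e) s phi x (val e)^-1
    (k%:R * jbracket ((val e)^-1 *: x) ^- K) sp _ _ _) _.
  - by move=> i; rewrite l1Z l1_delta mulr1 ger0_norm// invr_ge0 ltW.
  - by move=> s' hs'; apply: hk; rewrite hs'.
  - by rewrite mulr_ge0// jbVX_ge0.
  rewrite exprVn ler_wpM2l// ler_wpM2l//.
  rewrite lef_pV2 ?posrE ?jbX_gt0//; apply: lerXn2r; rewrite ?nnegrE ?jb_ge0//.
  have ex : x = val e *: ((val e)^-1 *: x) by rewrite scalerA mulfV ?scale1r// lt0r_neq0.
  rewrite {1}ex; apply: jbZ.
  by rewrite ger0_norm ?eps_le1// ltW.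
rewrite exprVn !mulrA -[val e ^- n * val e ^- _]invfM -exprD /wS ler_wpM2r ?jbVX_ge0//.
rewrite mulrC; apply: ler_pM => //; first by rewrite ler_nat leq_maxl.
exact: (gauge_mono (gaugeE R) e (leq_maxr k (n + size s))).
Qed.

Lemma fourier_integrand (f : 'rV[R]_n -> R[i]) x : schwartz f ->
  ccont (fun y => expi (- dot y x) * f y) /\ dec (fun y => expi (- dot y x) * f y).
Proof.
move=> hf; have hB := symb_liftq 0 (@schwartz_symb R unit n _ hf).
rewrite fourier_kernel; split; last exact: (jok_dec (row_mx 0 x) (jok_bosc 1 tt hB)).
exact: (smooth_ccont (smooth_slicer (row_mx 0 x) (jok_bosc 1 tt hB).1)).
Qed.

Lemma fourier_moll e x : fourier (moll phi (val e)) x = phat (val e *: x).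
Proof.
have e0 := eps_gt0 e; have ene0 := lt0r_neq0 e0.
have hm : schwartz (moll phi (val e)) := symb_schwartz e moll_moderate.
have [c1 d1] := fourier_integrand x hm.
have [c2 d2] := fourier_integrand (val e *: x) moll_schwartz.
rewrite /fourier (cintegral_affine 0 e0 c1 d1).
rewrite (_ : (fun y => _) = fun y =>
    (val e ^- n)%:C * (expi (- dot y (val e *: x)) * phi y)).
  by rewrite cintegralZ// mulrA -RCM mulfV ?expf_neq0// mul1r.
apply/funext => y; rewrite addr0 /moll scalerA mulVf// scale1r mulrCA; congr (_ * (expi (- _) * _)).
by apply: eq_bigr => i _; rewrite !mxE mulrCA mulrA.
Qed.
End Mollifier.

(** * Tempered distributions *)

Section Tempered.
Variables (R : realType) (n : nat).
Implicit Types (f g psi rho : 'rV[R]_n -> R[i]).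

Lemma schwartz_lin (c : R[i]) f g : schwartz f -> schwartz g ->
  schwartz (fun x => c * f x + g x).
Proof.
move=> /(@schwartz_symb R unit) hf /(@schwartz_symb R unit) hg.
have h := symbD (@wS_ge0 R n) (symbZ c (@wS_ge0 R n) hf) hg.
exact: symb_schwartz tt h.
Qed.

Lemma schwartz0 : schwartz (fun _ : 'rV[R]_n => 0 : R[i]).
Proof.
apply/schwartzP; split=> [|s K]; first exact: smooth_cst.
by exists 0%N => x; rewrite pderivs0 cabs0 mul0r.
Qed.

Lemma schwartzD f g : schwartz f -> schwartz g -> schwartz (fun x => f x + g x).
Proof.
move=> hf hg; have := schwartz_lin 1 hf hg; congr schwartz.
by apply/funext => x; rewrite mul1r.
Qed.

Lemma schwartzZ (c : R[i]) f : schwartz f -> schwartz (fun x => c * f x).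
Proof.
move=> hf; have := schwartz_lin c hf schwartz0; congr schwartz.
by apply/funext => x; rewrite addr0.
Qed.

Lemma schwartzB f g : schwartz f -> schwartz g -> schwartz (fun x => f x - g x).
Proof.
move=> hf hg; have := schwartz_lin (-1) hg hf; congr schwartz.
by apply/funext => x; rewrite mulN1r addrC.
Qed.

Lemma schwartz_sum (I : Type) (r : seq I) (F : I -> 'rV[R]_n -> R[i]) :
  (forall i, schwartz (F i)) -> schwartz (fun x => \sum_(i <- r) F i x).
Proof.
move=> hF; elim: r => [|i r ih].
  by under eq_fun do rewrite big_nil; exact: schwartz0.
by under eq_fun do rewrite big_cons; exact: schwartzD.
Qed.

Lemma schwartz_pderivs s f : schwartz f -> schwartz (pderivs s f).
Proof.
move=> /(@schwartz_symb R unit) hf.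
exact: symb_schwartz tt (symb_pderivs s hf).
Qed.

Variable w : ('rV[R]_n -> R[i]) -> R[i].
Hypothesis hw : tempered w.

Lemma temperedD f g : schwartz f -> schwartz g ->
  w (fun x => f x + g x) = w f + w g.
Proof.
move=> hf hg; have [h _] := hw; have := h 1 f g hf hg; rewrite mul1r => <-.
by congr w; apply/funext => x; rewrite mul1r.
Qed.

Lemma tempered0 : w (fun=> 0) = 0.
Proof.
have := temperedD schwartz0 schwartz0.
rewrite (_ : (fun x => _) = fun=> 0); last by apply/funext => x; rewrite addr0.
by move/eqP; rewrite -subr_eq0 opprD addNKr oppr_eq0 => /eqP.
Qed.

Lemma temperedZ c f : schwartz f -> w (fun x => c * f x) = c * w f.
Proof.
move=> hf; have [h _] := hw; have := h c f _ hf schwartz0.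
rewrite tempered0 addr0 => <-.
by congr w; apply/funext => x; rewrite addr0.
Qed.

Lemma temperedB f g : schwartz f -> schwartz g ->
  w (fun x => f x - g x) = w f - w g.
Proof.
move=> hf hg; have [h _] := hw; have := h (-1) g f hg hf.
rewrite mulN1r addrC => <-.
by congr w; apply/funext => x; rewrite mulN1r addrC.
Qed.

Lemma tempered_sum (I : Type) (r : seq I) (F : I -> 'rV[R]_n -> R[i]) :
  (forall i, schwartz (F i)) ->
  w (fun x => \sum_(i <- r) F i x) = \sum_(i <- r) w (F i).
Proof.
move=> hF; elim: r => [|i r ih].
  by under eq_fun do rewrite big_nil; rewrite tempered0 big_nil.
under eq_fun do rewrite big_cons; rewrite temperedD ?ih ?big_cons//.
exact: schwartz_sum.
Qed.

Lemma tempered_le : exists N C : nat, forall f (B : R), schwartz f -> 0 <= B ->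
  (forall s, (size s <= N)%N -> forall y, cabs (pderivs s f y) <= B * jbracket y ^- N) ->
  cabs (w f) <= C%:R * B.
Proof.
have [_ [N [C hN]]] := hw; have [l hl] := nat_ub C.
exists N, l => f B sf B0 hf.
apply: (@le_trans _ _ (C * B)); last by rewrite ler_wpM2r.
apply: hN => // alpha beta ha hb x.
apply: (@le_trans _ _ (jbracket x ^+ N * (B * jbracket x ^- N))).
  apply: ler_pM; rewrite ?cabs_ge0//.
    by apply: le_trans (mpow_le x alpha) _; exact: jbX_le.
  by apply: (hf (mseq beta)); rewrite size_mseq.
by rewrite mulrCA mulfV ?mulr1// gt_eqF// jbX_gt0.
Qed.

Definition dconv psi (x : 'rV[R]_n) : R[i] := w (fun y => psi (x - y)).

Lemma refl_dir (x : 'rV[R]_n) (i : 'I_n) (t : R) (y : 'rV[R]_n) :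
  x - (t *: delta_mx 0 i + y) = t *: (- delta_mx 0 i) + (x - y).
Proof. by rewrite opprD addrCA scalerN. Qed.

Lemma refl_bound rho (x : 'rV[R]_n) (B : R) N s : smooth rho -> 0 <= B ->
  (forall s', size s' = size s -> forall v, cabs (pderivs s' rho v) <= B * jbracket v ^- N) ->
  forall y, cabs (pderivs s (fun y => rho (x - y)) y) <=
    B * (2 ^+ N * jbracket x ^+ N) * jbracket y ^- N.
Proof.
move=> sr B0 hB y.
apply: le_trans (@pderivs_comp_bound _ _ _ (fun y => x - y) _
  (refl_dir x) s rho y 1
  (B * jbracket (x - y) ^- N) sr _ _ _) _.
- by move=> i; rewrite -scaleN1r l1Z l1_delta normrN normr1 mulr1.
- by move=> s' hs'; exact: hB.
- by rewrite mulr_ge0// jbVX_ge0.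
rewrite expr1n mul1r -mulrA ler_wpM2l// addrC -(jbN y); exact: jbVX_shift.
Qed.

Lemma schwartz_refl psi (x : 'rV[R]_n) : schwartz psi -> schwartz (fun y => psi (x - y)).
Proof.
move=> hp; have [sp _] := hp; apply/schwartzP; split.
  exact: (smooth_comp (refl_dir x)).
move=> s K; have [k hk] := schwartz_unif (size s) K hp.
have [l hl] := nat_ub (k%:R * (2 ^+ K * jbracket x ^+ K)).
exists l => y; apply: le_trans (@refl_bound psi x k%:R K s sp _ _ y) _ => //.
  by move=> s' hs'; apply: hk; rewrite hs'.
by rewrite ler_wpM2r ?jbVX_ge0.
Qed.

(** By Peetre's inequality, reflecting and translating a test function costs the [N]-th power of the
    bracket of [x]. The bound is linear in [B], which lets smallness of [rho] pass through [w]. *)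
Lemma dconv_bound : exists N C : nat, forall rho (B : R) (x : 'rV[R]_n),
  schwartz rho -> 0 <= B ->
  (forall s, (size s <= N)%N -> forall v, cabs (pderivs s rho v) <= B * jbracket v ^- N) ->
  cabs (dconv rho x) <= C%:R * B * jbracket x ^+ N.
Proof.
have [N [C hC]] := tempered_le; exists N, (C * 2 ^ N)%N => rho B x hr B0 hB.
have [sr _] := hr.
apply: le_trans (hC _ (B * (2 ^+ N * jbracket x ^+ N)) (schwartz_refl x hr) _ _) _.
- by rewrite !mulr_ge0 ?exprn_ge0 ?jb_ge0.
- move=> s hs y; apply: refl_bound => // s' hs'; apply: hB.
  by rewrite hs'.
by rewrite natrM natrX; apply: eq_ler; ring.
Qed.

Lemma trans_dir (h : 'rV[R]_n) (i : 'I_n) (t : R) (x : 'rV[R]_n) :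
  (fun v => v + h) (t *: delta_mx 0 i + x) = t *: delta_mx 0 i + (fun v => v + h) x.
Proof. by rewrite addrA. Qed.

Lemma pderivs_trans (h : 'rV[R]_n) s psi :
  pderivs s (fun v => psi (v + h)) = fun v => pderivs s psi (v + h).
Proof.
by rewrite (@pderivs_dir R n n (fun v => v + h) id s psi (trans_dir h)) map_id.
Qed.

Lemma schwartz_trans (h : 'rV[R]_n) psi : schwartz psi -> schwartz (fun v => psi (v + h)).
Proof.
move=> hp; have [sp _] := hp; apply/schwartzP; split.
  exact: (@smooth_comp R n n (fun v => v + h) _
    (trans_dir h) psi).
move=> s K; have [k hk] := schwartz_unif (size s) K hp.
have [l hl] := nat_ub (k%:R * (2 ^+ K * jbracket h ^+ K)).
exists l => y; rewrite pderivs_trans; apply: le_trans (hk s (leqnn _) _) _.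
apply: (@le_trans _ _ (k%:R * (2 ^+ K * jbracket h ^+ K) * jbracket y ^- K)).
  by rewrite -mulrA ler_wpM2l// jbVX_shift.
by rewrite ler_wpM2r ?jbVX_ge0.
Qed.

(** The second order Taylor remainder [rho] of [psi] is quadratic in [h] in the finitely many
    seminorms that control [w], so applying [w] to it meets the criterion [quad_diff]. *)
Lemma dconv_diff psi (x : 'rV[R]_n) : schwartz psi ->
  cdiff (dconv psi) x /\ forall i, pderiv i (dconv psi) x = dconv (pderiv i psi) x.
Proof.
move=> hp; have [sp _] := hp; have [N [C hC]] := dconv_bound.
have [k hk] := schwartz_unif N.+2 N hp.
pose D : R := 2 ^+ N * (1 + n%:R) ^+ N.
have D0 : 0 <= D by rewrite mulr_ge0 ?exprn_ge0// addr_ge0.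
pose B (h : 'rV[R]_n) := 2 * (l1 h ^+ 2 * (k%:R * D)).
apply: (@quad_diff R n (dconv psi) x (fun i => dconv (pderiv i psi) x)
  (C%:R * (2 * (n%:R ^+ 2 * (k%:R * D))) * jbracket x ^+ N)) => h h1.
pose rho v := psi (v + h) - psi v - \sum_i (h 0 i)%:C * pderiv i psi v.
have hdi i : schwartz (fun v => (h 0 i)%:C * pderiv i psi v).
  exact/schwartzZ/(schwartz_pderivs [:: i] hp).
have hrho : schwartz rho.
  by apply: schwartzB; [apply: schwartzB => //; exact: schwartz_trans|exact: schwartz_sum].
have -> : dconv psi (x + h) - dconv psi x - \sum_i (h 0 i)%:C * dconv (pderiv i psi) x =
    dconv rho x.
  have r1 := schwartz_refl (x + h) hp; have r2 := schwartz_refl x hp.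
  have r3 i := schwartz_refl x (schwartz_pderivs [:: i] hp).
  rewrite /dconv /rho [in RHS](_ : (fun y => _) = fun y => (psi (x + h - y) - psi (x - y)) -
    \sum_i (h 0 i)%:C * pderiv i psi (x - y)); last first.
    by apply/funext => y; rewrite [x - y + h]addrAC.
  rewrite temperedB; [|exact: schwartzB|by apply: schwartz_sum => i; exact: schwartzZ (r3 i)].
  rewrite temperedB// tempered_sum; last by move=> i; exact: schwartzZ (r3 i).
  by congr (_ - _); apply: eq_bigr => i _; rewrite temperedZ//; exact: r3.
apply: le_trans (hC rho (B h) x hrho _ _) _.
- by rewrite !mulr_ge0 ?l1_ge0.
- move=> s hs v.
  have spi i : smooth (fun v => (h 0 i)%:C * pderiv i psi v) by exact: (hdi i).1.
  have st := (schwartz_trans h hp).1.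
  rewrite /rho pderivsB; [|exact: smoothB|exact: smooth_sum].
  rewrite pderivsB// pderivs_sum// pderivs_trans.
  rewrite (eq_bigr (fun i => (h 0 i)%:C * pderiv i (pderivs s psi) v)); last first.
    move=> i _; rewrite pderivsZ; last exact: (schwartz_pderivs [:: i] hp).1.
    by rewrite -pderivs_pderiv.
  have ss := (schwartz_pderivs s hp).1.
  apply: le_trans (taylor2 (B := k%:R * D * jbracket v ^- N) ss _) _.
    move=> t t01 s' hs'; rewrite -pderivs_cat.
    apply: le_trans (hk _ _ _) _; first by rewrite size_cat hs' !add2n !ltnS.
    rewrite -mulrA ler_wpM2l//; apply: le_trans (jbVX_shift _ _ _) _.
    rewrite ler_wpM2r ?jbVX_ge0// ler_wpM2l ?exprn_ge0//.
    apply: lerXn2r; rewrite ?nnegrE ?jb_ge0 ?addr_ge0//.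
    apply: le_trans (jb_l1 _) _; rewrite lerD2l l1Z.
    apply: le_trans (_ : 1 * (n%:R * 1) <= _); last by rewrite mul1r mulr1.
    case/andP: t01 => t0 t1; apply: ler_pM; rewrite ?normr_ge0 ?l1_ge0//.
      by rewrite ger0_norm.
    by apply: le_trans (l1_norm h) _; rewrite ler_wpM2l.
  by rewrite /B; apply: eq_ler; ring.
have lh : l1 h ^+ 2 <= n%:R ^+ 2 * `|h| ^+ 2.
  rewrite -exprMn; apply: lerXn2r; rewrite ?nnegrE ?l1_ge0 ?mulr_ge0//.
  exact: l1_norm.
have -> : C%:R * (2 * (n%:R ^+ 2 * (k%:R * D))) * jbracket x ^+ N * `|h| ^+ 2 =
  C%:R * (2 * ((n%:R ^+ 2 * `|h| ^+ 2) * (k%:R * D))) * jbracket x ^+ N by ring.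
rewrite ler_wpM2r ?jbX_ge0// ler_wpM2l// ler_wpM2l// ler_wpM2r//.
by rewrite mulr_ge0.
Qed.

Lemma dconv_smooth psi : schwartz psi -> smooth (dconv psi).
Proof.
move=> hp; apply: (@smooth_coind R n [set f | exists2 c, schwartz c & f = dconv c]);
  last by exists psi.
move=> _ [c hc ->]; split=> [x|i]; first by have [] := dconv_diff x hc.
exists (pderiv i c); first exact: (schwartz_pderivs [:: i] hc).
by apply/funext => x; have [_ ->] := dconv_diff x hc.
Qed.

Lemma dconv_pderivs s psi : schwartz psi -> pderivs s (dconv psi) = dconv (pderivs s psi).
Proof.
move=> hp; elim: s => //= i s ->; apply/funext => x.
by have [_ ->] := dconv_diff x (schwartz_pderivs s hp).
Qed.

Lemma dconv_moderate (P : eps_index R -> 'rV[R]_n -> R[i]) s :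
  symb (gaugeE R) (@wS R n) P ->
  exists k : nat, forall e x, cabs (pderivs s (dconv (P e)) x) <=
    k%:R * val e ^- k * jbracket x ^+ k.
Proof.
move=> hP; have [N [C hC]] := dconv_bound.
have [k hk] := symb_unif (N + size s) N (@wS_ge0 R n) hP.
have sP e : schwartz (P e) := symb_schwartz e hP.
pose l := (maxn (C * k) (maxn k N)); exists l => e x.
rewrite dconv_pderivs//.
apply: le_trans (hC _ (k%:R * val e ^- k) x (schwartz_pderivs s (sP e)) _ _) _.
- by rewrite mulr_ge0//; exact: (gauge_ge0 (gaugeE R)).
- move=> s' hs' v; rewrite -pderivs_cat; apply: hk.
  by rewrite size_cat leq_add2r.
apply: ler_pM; rewrite ?jbX_ge0 ?mulr_ge0//; first exact: (gauge_ge0 (gaugeE R)).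
  rewrite mulrA -natrM; apply: ler_pM => //; first exact: (gauge_ge0 (gaugeE R)).
    by rewrite ler_nat leq_maxl.
  by apply: (gauge_mono (gaugeE R)); rewrite /l !leq_max leqnn orbT.
by apply: jbX_le; rewrite /l !leq_max leqnn !orbT.
Qed.
End Tempered.

(** * Riemann sums over a grid of cells *)

Section Cells.
Variables (R : realType) (m p' : nat).
Notation p := p'.+1.
Notation Q := (2 * p * p)%N.
Implicit Types (c : {ffun 'I_m -> 'I_Q}) (x : 'rV[R]_m).

(* The cube [-p, p[ ^ m is cut into cells of side 1/p. *)
Definition cell_coord c i x : bool :=
  ((c i)%:R <= (x 0 i + p%:R) * p%:R) && ((x 0 i + p%:R) * p%:R < (c i).+1%:R).

Definition in_cell c x : bool := [forall i, cell_coord c i x].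

Definition cell_pt c : 'rV[R]_m := \row_i ((c i)%:R / p%:R - p%:R).

(** The indicator function of a cell, factored over the coordinates so that measurability reduces to
    intervals. *)
Definition cell_fun c x : R[i] := \prod_i (((cell_coord c i x)%:R : R)%:C).

Let p0 : 0 < (p%:R : R). Proof. by rewrite ltr0n. Qed.

Lemma cell_funE c x : cell_fun c x = (in_cell c x)%:R.
Proof.
rewrite /cell_fun /in_cell; case: forallP => h.
  by rewrite big1// => i _; rewrite h.
have [i hi] : exists i, ~~ cell_coord c i x by apply/existsP; rewrite -negb_forall; apply/forallP.
by rewrite (bigD1 i)//= (negbTE hi) mul0r.
Qed.

Lemma cell_uniq c c' x : in_cell c x -> in_cell c' x -> c = c'.
Proof.
move=> /forallP h /forallP h'; apply/ffunP => i; apply/val_inj => /=.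
have /andP[a b] := h i; have /andP[a' b'] := h' i.
have := le_lt_trans a b'; have := le_lt_trans a' b; rewrite !ltr_nat !ltnS => u v.
by apply/eqP; rewrite eqn_leq v.
Qed.

Lemma in_cell_pt c x i : in_cell c x -> `|(cell_pt c - x) 0 i| <= p%:R^-1.
Proof.
move=> /forallP /(_ i) /andP[a b]; rewrite !mxE.
have -> : (c i)%:R / p%:R - p%:R - x 0 i = ((c i)%:R - (x 0 i + p%:R) * p%:R) / p%:R.
  by rewrite mulrBl mulfK ?gt_eqF//; ring.
rewrite normrM [X in _ * X]ger0_norm ?invr_ge0 ?(ltW p0)//.
rewrite -[leRHS]mul1r ler_wpM2r ?invr_ge0 ?(ltW p0)//.
rewrite ler_norml; move: b; rewrite -[(c i).+1%:R]natr1 => b.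
move: a b; move: ((x 0 i + p%:R) * p%:R) ((c i)%:R : R) => u v a b.
by apply/andP; split; lra.
Qed.

Lemma in_cell_l1 c x : in_cell c x -> l1 (cell_pt c - x) <= m%:R / p%:R.
Proof.
move=> h; rewrite mulr_natl -[X in _ *+ X](card_ord m) -sumr_const.
by apply: ler_sum => i _; exact: in_cell_pt.
Qed.

(** A bracket below p keeps all coordinates inside the cube, where truncation locates the cell. In
    the second case decay in x takes over the role of the mesh size. *)
Lemma in_cell_or x :
  (exists c, in_cell c x) \/ (p%:R <= jbracket x /\ forall c, in_cell c x = false).
Proof.
case: (boolP [exists c, in_cell c x]) => [/existsP h|]; first by left.
rewrite negb_exists => /forallP h; right; split; last by move=> c; exact/negbTE/h.
rewrite leNgt; apply/negP => hx.
have key i : exists j : 'I_Q, (j%:R <= (x 0 i + p%:R) * p%:R) && ((x 0 i + p%:R) * p%:R < j.+1%:R).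
  have := le_lt_trans (coord_jb x i) hx; rewrite ltr_norml => /andP[a b].
  have u0 : 0 <= (x 0 i + p%:R) * p%:R by rewrite mulr_ge0// ltW//; lra.
  have /andP[c1 c2] := truncn_itv u0.
  have jQ : (Num.Def.trunc ((x 0 i + p%:R) * p%:R)%R < Q)%N.
    rewrite -(ltr_nat R); apply: le_lt_trans c1 _.
    by rewrite natrM ltr_pM2r// natrM mulr_natl mulr2n ltrD2r.
  by exists (Ordinal jQ); rewrite c1.
have [c hc] := fin_all_exists key.
by have /negP := h (finfun c); apply; apply/forallP => i; rewrite /cell_coord ffunE hc.
Qed.

Lemma cell_sum c0 x (G : {ffun 'I_m -> 'I_Q} -> R[i]) : in_cell c0 x ->
  \sum_c cell_fun c x * G c = G c0.
Proof.
move=> h; rewrite (bigD1 c0)//= cell_funE h mul1r big1 ?addr0// => c cc0.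
rewrite cell_funE; case: (boolP (in_cell c x)) => [hc|]; last by rewrite mul0r.
by rewrite (cell_uniq hc h) eqxx in cc0.
Qed.

Lemma cell_sum0 x (G : {ffun 'I_m -> 'I_Q} -> R[i]) : (forall c, in_cell c x = false) ->
  \sum_c cell_fun c x * G c = 0.
Proof. by move=> h; rewrite big1// => c _; rewrite cell_funE h mul0r. Qed.

Lemma cell_fun_cmble c : cmble (cell_fun c).
Proof.
rewrite /cell_fun; elim: (index_enum _) => [|i r ih].
  by rewrite (_ : (fun x => _) = fun=> 1); [exact: cmble_cst|apply/funext => x; rewrite big_nil].
rewrite (_ : (fun x => _) = fun x => ((cell_coord c i x)%:R : R)%:C *
   \prod_(i <- r) (((cell_coord c i x)%:R : R)%:C)); last first.
  by apply/funext => x; rewrite big_cons.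
apply: cmbleM => //; split; last exact: measurable_cst.
pose I : set R := [set` `[(c i)%:R, (c i).+1%:R[%R].
have -> : (fun x => complex.Re ((cell_coord c i x)%:R : R)%:C) =
    (fun x => \1_I ((x 0 i + p%:R) * p%:R) : R).
  apply/funext => x /=; rewrite indicE /cell_coord; congr (_%:R); congr nat_of_bool.
  by rewrite /I mem_setE in_itv.
rewrite /mble; apply: (measurableT_comp (f := \1_I : R -> R)).
  by apply: measurable_indic; exact: measurable_itv.
have := @measurable_cont R m (fun x => (x 0 i + p%:R) * p%:R); apply => x.
apply: (@continuousM _ _ (fun x : 'rV[R]_m => x 0 i + p%:R)); last exact: cst_continuous.
apply: (@continuousD _ _ _ (fun x : 'rV[R]_m => x 0 i)); last exact: cst_continuous.
exact: coord_continuous.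
Qed.

Lemma cell_l1 c x : in_cell c x -> l1 (cell_pt c - x) <= m%:R.
Proof.
move=> /in_cell_l1 h; apply: le_trans h _; rewrite ler_pdivrMr//.
by rewrite ler_peMr// ler1n.
Qed.

Lemma cell_fun_dec c : dec (cell_fun c).
Proof.
split; first exact: cell_fun_cmble.
exists ((2 * (1 + m%:R) * jbracket (cell_pt c)) ^+ m.*2) => x.
rewrite cell_funE; case: (boolP (in_cell c x)) => h; last first.
  by rewrite cabs0 mulr_ge0 ?jbVX_ge0// exprn_ge0// !mulr_ge0 ?jb_ge0// addr_ge0.
rewrite cabs1 ler_pdivlMr ?jbX_gt0// mul1r.
apply: lerXn2r; rewrite ?nnegrE ?mulr_ge0 ?jb_ge0 ?addr_ge0//.
have -> : x = - (cell_pt c - x) + cell_pt c by rewrite opprB subrK.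
apply: le_trans (jbD _ _) _; rewrite ler_wpM2r ?jb_ge0// ler_wpM2l//.
by rewrite jbN; apply: le_trans (jb_l1 _) _; rewrite lerD2l; exact: cell_l1.
Qed.

Lemma cell_integral (f : 'rV[R]_m -> R[i]) : dec f ->
  cintegral (fun x => f x - \sum_c cell_fun c x * f (cell_pt c)) =
  cintegral f - \sum_c cintegral (cell_fun c) * f (cell_pt c).
Proof.
move=> hf.
have hd c : dec (fun x => cell_fun c x * f (cell_pt c)).
  by have := decZ (f (cell_pt c)) (cell_fun_dec c); congr dec; apply/funext => x; rewrite mulrC.
rewrite cintegralB//; last exact: dec_sum.
rewrite cintegral_sum//; congr (_ - _); apply: eq_bigr => c _.
rewrite mulrC -cintegralZ; last exact: cell_fun_dec.
by congr cintegral; apply/funext => x; rewrite mulrC.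
Qed.
End Cells.

(** * Exchange of a tempered distribution with an integral *)

Section DistributionFubini.
Variables (R : realType) (m n : nat) (w : ('rV[R]_n -> R[i]) -> R[i]).
Hypothesis hw : tempered w.
Variable K : 'rV[R]_(m + n) -> R[i].
Hypothesis hK : schwartz K.
Hypothesis mK : cmble (fun x : 'rV[R]_m => w (fun y => K (row_mx x y))).

Lemma schwartz_row a b (x : 'rV[R]_m) (y : 'rV[R]_n) (f : 'rV[R]_(m + n) -> R[i]) (k : R) :
  cabs (f (row_mx x y)) <= k * jbracket (row_mx x y) ^- (a + b) -> 0 <= k ->
  cabs (f (row_mx x y)) <= k * jbracket x ^- a * jbracket y ^- b.
Proof.
by move=> h k0; apply: le_trans h _; rewrite -mulrA ler_wpM2l// jbVX_row.
Qed.

Lemma schwartz_slice (x : 'rV[R]_m) : schwartz (fun y => K (row_mx x y)).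
Proof.
have [sK _] := hK; apply/schwartzP; split; first exact: smooth_slicer.
move=> s N; have [k hk] := schwartz_unif (size s) (0 + N) hK.
exists k => y; rewrite slice_pderivsr.
have := hk (map (@rshift m n) s) _ (row_mx x y); rewrite size_map => /(_ (leqnn _)).
by move=> /schwartz_row => /(_ (ler0n _ _)); rewrite expr0 invr1 mulr1.
Qed.

Lemma param_schwartz : param_ok (fun (y : 'rV[R]_n) (x : 'rV[R]_m) => K (row_mx x y)).
Proof.
have [sK _] := hK; split.
- by move=> x; exact: smooth_slicer.
- move=> s y; rewrite (_ : (fun x => _) = fun x => pderivs (map (@rshift m n) s) K (row_mx x y)).
    exact/ccont_cmble/smooth_ccont/smooth_slicel/smooth_pderivs.
  by apply/funext => x; rewrite slice_pderivsr.
- move=> s; have [k hk] := schwartz_unif (size s) (m.*2 + 0) hK.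
  exists k => y x; rewrite slice_pderivsr.
  have := hk (map (@rshift m n) s) _ (row_mx x y); rewrite size_map => /(_ (leqnn _)).
  move=> /schwartz_row => /(_ (ler0n _ _)); rewrite expr0 invr1 mulr1 => /le_trans; apply.
  by rewrite ler_wpM2r ?jbVX_ge0// ler_peMr// jbX_ge1.
Qed.

Definition fiber_int (y : 'rV[R]_n) : R[i] := cintegral (fun x => K (row_mx x y)).

Lemma fiber_pderivs s y : pderivs s fiber_int y =
  cintegral (fun x => pderivs (map (@rshift m n) s) K (row_mx x y)).
Proof.
rewrite [fiber_int](_ : _ = param_int (fun y x => K (row_mx x y)))// param_pderivs.
  by congr cintegral; apply/funext => x; rewrite slice_pderivsr.
exact: param_schwartz.
Qed.

Lemma fiber_dec s y : dec (fun x => pderivs (map (@rshift m n) s) K (row_mx x y)).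
Proof.
have [sK _] := hK; have [k hk] := schwartz_unif (size s) (m.*2 + 0) hK.
apply: (dec_cont (C := k%:R)); first exact/smooth_ccont/smooth_slicel/smooth_pderivs.
move=> x; have := hk (map (@rshift m n) s) _ (row_mx x y); rewrite size_map => /(_ (leqnn _)).
by move=> /schwartz_row => /(_ (ler0n _ _)); rewrite expr0 invr1 mulr1.
Qed.

Lemma fiber_schwartz : schwartz fiber_int.
Proof.
apply/schwartzP; split; first exact: (param_smooth param_schwartz).
move=> s N; have [k hk] := schwartz_unif (size s) (m.*2 + N) hK.
have [l hl] := nat_ub (2 * cn R m * k%:R).
exists l => y; rewrite fiber_pderivs.
apply: le_trans (cintegral_bound (C := k%:R * jbracket y ^- N) (fiber_dec s y).1 _) _.
  move=> x; have := hk (map (@rshift m n) s) _ (row_mx x y); rewrite size_map => /(_ (leqnn _)).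
  by move=> /schwartz_row => /(_ (ler0n _ _)) /le_trans; apply; rewrite mulrAC.
by rewrite mulrA ler_wpM2r ?jbVX_ge0.
Qed.

(** Inside the cube the error is a first order Taylor remainder with step at most m/p. Outside it
    the sum vanishes, and one power of decay in x beyond the integrable [m.*2] is worth 1/p. *)
Lemma cell_error N : exists E : nat, forall p' s x y, (size s <= N)%N ->
  cabs (pderivs (map (@rshift m n) s) K (row_mx x y) -
    \sum_c @cell_fun R m p' c x * pderivs (map (@rshift m n) s) K (row_mx (cell_pt R c) y)) <=
  E%:R / p'.+1%:R * jbracket x ^- m.*2 * jbracket y ^- N.
Proof.
have [k hk] := schwartz_unif N.+1 (m.*2.+1 + N) hK.
pose D := (2 ^ m.*2 * (1 + m) ^ m.*2)%N.
exists (2 * m * k * D + k)%N => p' s x y hs.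
set f := pderivs _ K.
have p0 : (0 : R) < p'.+1%:R by rewrite ltr0n.
have sf : smooth f by apply: smooth_pderivs; case: hK.
have bf s' z : (size s' <= 1)%N ->
    cabs (pderivs s' f (row_mx z y)) <= k%:R * jbracket z ^- m.*2.+1 * jbracket y ^- N.
  move=> hs'; rewrite /f -pderivs_cat; apply: schwartz_row => //.
  by apply: hk; rewrite size_cat size_map -add1n leq_add.
have pos (u v : R) : 0 <= u -> 0 <= v -> 0 <= u / p'.+1%:R * v.
  by move=> u0 v0; rewrite mulr_ge0// divr_ge0// ltW.
case: (in_cell_or p' x) => [[c hc]|[px hx]].
  rewrite (cell_sum _ hc) -opprB cabsN.
  have := @taylor R _ 1 f (row_mx x y) (row_mx (cell_pt R c - x) 0)
    (k%:R * D%:R * jbracket x ^- m.*2 * jbracket y ^- N) sf.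
  rewrite big_ord1 -[iter _ _ _ _]/(f (row_mx x y)) fact0 invr1 mul1r.
  rewrite add_row_mx addr0 [x + _]addrC subrK => /(_ _)/le_trans; apply.
    move=> t t01 s' hs'; rewrite scale_row_mx scaler0 add_row_mx addr0.
    apply: le_trans (bf s' _ _) _; first by rewrite hs'.
    rewrite ler_wpM2r ?jbVX_ge0// -mulrA ler_wpM2l//.
    apply: le_trans (jbVX_le _ (leqnSn _)) _; apply: le_trans (jbVX_shift _ _ _) _.
    rewrite ler_wpM2r ?jbVX_ge0// /D natrM !natrX ler_wpM2l ?exprn_ge0//.
    apply: lerXn2r; rewrite ?nnegrE ?jb_ge0//.
    apply: le_trans (jbZ _ _) _; first by case/andP: t01 => t0 t1; rewrite ger0_norm.
    by apply: le_trans (jb_l1 _) _; rewrite natrD lerD2l cell_l1.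
  rewrite expr1 l1_row [l1 0]big1 ?addr0; last by move=> i _; rewrite mxE normr0.
  set a := jbracket x ^- _; set b := jbracket y ^- _.
  have a0 : 0 <= a by exact: jbVX_ge0.
  have b0 : 0 <= b by exact: jbVX_ge0.
  apply: (@le_trans _ _ (2 * (m%:R / p'.+1%:R * (k%:R * D%:R * a * b)))).
    by rewrite ler_wpM2l// ler_wpM2r ?mulr_ge0// in_cell_l1.
  have -> : 2 * (m%:R / p'.+1%:R * (k%:R * D%:R * a * b)) =
    (2 * m * k * D)%N%:R / p'.+1%:R * a * b by rewrite !natrM; ring.
  rewrite ler_wpM2r// ler_wpM2r// ler_wpM2r ?invr_ge0 ?(ltW p0)// ler_nat.
  exact: leq_addr.
rewrite cell_sum0// subr0; apply: le_trans (bf [::] x isT) _.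
rewrite ler_wpM2r ?jbVX_ge0//.
apply: (@le_trans _ _ (k%:R / p'.+1%:R * jbracket x ^- m.*2)); last first.
  rewrite ler_wpM2r ?jbVX_ge0// ler_wpM2r ?invr_ge0 ?(ltW p0)// ler_nat.
  exact: leq_addl.
rewrite -mulrA ler_wpM2l// exprS invfM ler_wpM2r ?jbVX_ge0//.
by rewrite lef_pV2 ?posrE ?jb_gt0.
Qed.

(* Both sides are compared with the Riemann sum over the cells. *)
Lemma tempered_fubini :
  w fiber_int = cintegral (fun x : 'rV[R]_m => w (fun y => K (row_mx x y))).
Proof.
have [N [C hC]] := tempered_le hw.
have [E hE] := cell_error N.
have [k hk] := schwartz_unif N (m.*2 + N) hK.
have dw : dec (fun x : 'rV[R]_m => w (fun y => K (row_mx x y))).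
  split=> //; exists (C%:R * k%:R) => x; rewrite -mulrA.
  apply: hC; [exact: schwartz_slice|by rewrite mulr_ge0 ?jbVX_ge0|].
  move=> s hs y; rewrite slice_pderivsr; apply: schwartz_row => //.
  by apply: hk; rewrite size_map.
pose U p' y := cintegral (fun x => K (row_mx x y) -
  \sum_c @cell_fun R m p' c x * K (row_mx (cell_pt R c) y)).
have hUE p' y : U p' y = fiber_int y -
    \sum_c cintegral (@cell_fun R m p' c) * K (row_mx (cell_pt R c) y).
  exact: (@cell_integral R m p' (fun x => K (row_mx x y)) (fiber_dec [::] y)).
have hcs p' (c : {ffun 'I_m -> 'I_(2 * p'.+1 * p'.+1)}) (z : R[i]) :
  schwartz (fun y => z * K (row_mx (cell_pt R c) y)) by exact/schwartzZ/schwartz_slice.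
pose V p' x := w (fun y => K (row_mx x y)) -
  \sum_c @cell_fun R m p' c x * w (fun y => K (row_mx (cell_pt R c) y)).
(* By linearity [w] maps the Riemann sum for [fiber_int] to the Riemann sum for the pairing, so the
   sums cancel and only the two errors remain. *)
have diffE p' : w fiber_int - cintegral (fun x : 'rV[R]_m => w (fun y => K (row_mx x y))) =
    w (U p') - cintegral (V p').
  rewrite (@cell_integral R m p' _ dw) (_ : U p' = fun y => fiber_int y -
    \sum_c cintegral (@cell_fun R m p' c) * K (row_mx (cell_pt R c) y)); last exact/funext.
  rewrite (temperedB hw) ?(tempered_sum hw)//; [|exact: fiber_schwartz|exact: schwartz_sum].
  rewrite (eq_bigr (fun c => cintegral (@cell_fun R m p' c) *
     w (fun y => K (row_mx (cell_pt R c) y)))); last first.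
    by move=> c _; rewrite (temperedZ hw)//; exact: schwartz_slice.
  by rewrite opprB addrA subrK.
pose B : R := C%:R * (2 * cn R m * E%:R) + 2 * cn R m * (C%:R * E%:R).
have bnd p' : cabs (w fiber_int - cintegral (fun x : 'rV[R]_m => w (fun y => K (row_mx x y)))) <=
    B / p'.+1%:R.
  have p0 : (0 : R) < p'.+1%:R by rewrite ltr0n.
  rewrite (diffE p') /B mulrDl; apply: le_trans (cabsB _ _) _; apply: lerD.
    rewrite -2!mulrA; apply: hC.
    - rewrite (_ : U p' = fun y => fiber_int y -
        \sum_c cintegral (@cell_fun R m p' c) * K (row_mx (cell_pt R c) y)); last exact/funext.
      by apply: schwartzB; [exact: fiber_schwartz|exact: schwartz_sum].
    - by rewrite !mulr_ge0 ?cn_ge0// invr_ge0 ltW.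
    move=> s hs y.
    have -> : pderivs s (U p') y = cintegral (fun x =>
       pderivs (map (@rshift m n) s) K (row_mx x y) -
       \sum_c @cell_fun R m p' c x * pderivs (map (@rshift m n) s) K (row_mx (cell_pt R c) y)).
      rewrite (@cell_integral R m p' _ (fiber_dec s y)) -fiber_pderivs.
      rewrite (_ : U p' = fun y => fiber_int y -
        \sum_c cintegral (@cell_fun R m p' c) * K (row_mx (cell_pt R c) y)); last exact/funext.
      rewrite pderivsB; [|exact: fiber_schwartz.1|].
        2: by apply: smooth_sum => c; case: (hcs p' c (cintegral (cell_fun c))).
      rewrite pderivs_sum; last by move=> c; case: (hcs p' c (cintegral (cell_fun c))).
      congr (_ - _); apply: eq_bigr => c _.
      rewrite pderivsZ; last by case: (schwartz_slice (cell_pt R c)).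
      by rewrite slice_pderivsr.
    apply: le_trans (cintegral_bound (C := E%:R / p'.+1%:R * jbracket y ^- N) _ _) _; last first.
    - by apply: eq_ler; ring.
    - move=> x; apply: le_trans (hE p' s x y hs) _.
      by rewrite mulrAC.
      have [h _] : dec (fun x => pderivs (map (@rshift m n) s) K (row_mx x y) -
       \sum_c @cell_fun R m p' c x * pderivs (map (@rshift m n) s) K (row_mx (cell_pt R c) y)).
        apply: decB; first exact: fiber_dec.
        apply: dec_sum => c; have := decZ (pderivs (map (@rshift m n) s) K
          (row_mx (cell_pt R c) y)) (cell_fun_dec R c).
        by congr dec; apply/funext => x; rewrite mulrC.
      exact: h.
  rewrite -mulrA; apply: cintegral_bound.
    have [h _] : dec (V p').
      apply: decB => //; apply: dec_sum => c.
      have := decZ (w (fun y => K (row_mx (cell_pt R c) y))) (cell_fun_dec R c).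
      by congr dec; apply/funext => x; rewrite mulrC.
    exact: h.
  move=> x.
  have -> : V p' x = w (fun y => K (row_mx x y) -
      \sum_c @cell_fun R m p' c x * K (row_mx (cell_pt R c) y)).
    rewrite (temperedB hw) ?(tempered_sum hw)//; [|exact: schwartz_slice|exact: schwartz_sum].
    congr (_ - _); apply: eq_bigr => c _.
    by rewrite (temperedZ hw)//; exact: schwartz_slice.
  rewrite -!mulrA; apply: hC.
  - by apply: schwartzB; [exact: schwartz_slice|exact: schwartz_sum].
  - by rewrite !mulr_ge0 ?jbVX_ge0// invr_ge0 ltW.
  move=> s hs y; rewrite pderivsB; [|by case: (schwartz_slice x)|].
    2: by apply: smooth_sum => c; case: (hcs p' c (cell_fun c x)).
  rewrite pderivs_sum; last by move=> c; case: (hcs p' c (cell_fun c x)).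
  rewrite slice_pderivsr (eq_bigr (fun c => @cell_fun R m p' c x *
    pderivs (map (@rshift m n) s) K (row_mx (cell_pt R c) y))).
    by rewrite mulrA; exact: hE.
  move=> c _; rewrite pderivsZ; last by case: (schwartz_slice (cell_pt R c)).
  by rewrite slice_pderivsr.
apply/eqP; rewrite -subr_eq0; apply/eqP/Normc.eq0_normc.
move: (_ - _) bnd => z bnd.
(* The modulus is at most [B / p'.+1] for every [p']; were it positive, a [p'] beyond [B / cabs z]
   would contradict this. *)
apply/eqP; rewrite eq_le cabs_ge0 andbT; apply/negPn/negP; rewrite -ltNge => z0.
have [q hq] := nat_ub (B / cabs z).
have := bnd q; rewrite leNgt => /negP; apply.
rewrite ltr_pdivrMr ?ltr0n// mulrC -ltr_pdivrMr//.
by apply: le_lt_trans hq _; rewrite ltr_nat.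
Qed.
End DistributionFubini.

(** * Regularisation of distributions *)

Section Smear.
Variables (R : realType) (n : nat).
Implicit Types (psi k : 'rV[R]_n -> R[i]) (e : eps_index R).

Definition smear psi (a : R) k (y : 'rV[R]_n) : R[i] :=
  cintegral (fun z => psi z * k (y + a *: z)).

Lemma jb_eps e (x : 'rV[R]_n) : jbracket (val e *: x) <= jbracket x.
Proof. by apply: jbZ; rewrite ger0_norm ?eps_le1// ltW// eps_gt0. Qed.

Lemma jbVX_smear e (t : R) (y z : 'rV[R]_n) K : 0 <= t <= 1 ->
  jbracket (y + t *: (val e *: z)) ^- K <= 2 ^+ K * jbracket z ^+ K * jbracket y ^- K.
Proof.
move=> /andP[t0 t1]; apply: le_trans (jbVX_shift _ _ _) _.
rewrite ler_wpM2r ?jbVX_ge0// ler_wpM2l ?exprn_ge0//.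
apply: lerXn2r; rewrite ?nnegrE ?jb_ge0//; apply: le_trans (jb_eps e z).
by apply: jbZ; rewrite ger0_norm.
Qed.

Lemma shift_dir e (y : 'rV[R]_n) (i : 'I_n) (t : R) (z : 'rV[R]_n) :
  y + val e *: (t *: delta_mx 0 i + z) = t *: (val e *: delta_mx 0 i) + (y + val e *: z).
Proof. by rewrite scalee_dir addrCA. Qed.

Lemma smear_integrand psi e k (y : 'rV[R]_n) : schwartz psi -> smooth k ->
  ccont (fun z => psi z * k (y + val e *: z)).
Proof.
move=> hp sk; apply: ccontM; first exact: smooth_ccont hp.1.
apply: (@ccont_comp R _ _ (fun z : 'rV[R]_n => y + val e *: z) k); last exact: smooth_ccont.
exact: (dirmap_continuous (shift_dir e y)).
Qed.

Lemma smear_bound psi e k (y : 'rV[R]_n) K (A B : R) : 0 <= A -> 0 <= B ->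
  (forall z, cabs (psi z) <= A * jbracket z ^- (n.*2 + K)) ->
  (forall z, cabs (k z) <= B * jbracket z ^- K) ->
  forall z, cabs (psi z * k (y + val e *: z)) <=
    A * B * 2 ^+ K * jbracket y ^- K * jbracket z ^- n.*2.
Proof.
move=> A0 B0 hA hB z; rewrite cabsM.
apply: (@le_trans _ _ (A * jbracket z ^- (n.*2 + K) *
    (B * (2 ^+ K * jbracket z ^+ K * jbracket y ^- K)))).
  apply: ler_pM; rewrite ?cabs_ge0//; apply: le_trans (hB _) _.
  rewrite ler_wpM2l//; have := @jbVX_smear e 1 y z K; rewrite scale1r; apply.
  by rewrite ler01 lexx.
have jz : jbracket z ^+ K != 0 by rewrite gt_eqF// jbX_gt0.
rewrite exprD invfM; apply: eq_ler.
move: (jbracket z ^- _) (jbracket y ^- _) (jbracket z ^+ K) jz (2 ^+ K) => u v x x0 c.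
by field.
Qed.

Lemma smear_param psi e k : schwartz psi -> schwartz k ->
  param_ok (fun y z => psi z * k (y + val e *: z)).
Proof.
move=> hp hk; have [sp _] := hp; have [sk _] := hk.
have st z : smooth (fun y => k (y + val e *: z)) := (schwartz_trans (val e *: z) hk).1.
have E s z : pderivs s (fun y => psi z * k (y + val e *: z)) =
    fun y => psi z * pderivs s k (y + val e *: z).
  by rewrite pderivsZ// pderivs_trans.
split=> [z|s y|s]; first exact: smoothZ.
  rewrite (_ : (fun z => _) = fun z => psi z * pderivs s k (y + val e *: z)).
    exact/ccont_cmble/smear_integrand/smooth_pderivs.
  by apply/funext => z; rewrite E.
have [a ha] := schwartz_unif 0 (n.*2 + 0) hp.
have [b hb] := schwartz_unif (size s) 0 hk.
exists (a * b)%N => y z; rewrite E.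
apply: le_trans (@smear_bound psi e (pderivs s k) y 0 a%:R b%:R
  (ler0n _ _) (ler0n _ _) (ha [::] isT)
  (hb s (leqnn _)) z) _.
rewrite !expr0 invr1 !mulr1 natrM ler_wpM2r ?jbVX_ge0// ler_peMr ?mulr_ge0//.
exact: jbX_ge1.
Qed.

Lemma smear_pderivs psi e k s : schwartz psi -> schwartz k ->
  pderivs s (smear psi (val e) k) = smear psi (val e) (pderivs s k).
Proof.
move=> hp hk.
rewrite [smear _ _ k](_ : _ = param_int (fun y z => psi z * k (y + val e *: z)))//.
rewrite (param_pderivs s (smear_param e hp hk)).
apply/funext => y; congr cintegral; apply/funext => z.
by rewrite pderivsZ ?pderivs_trans//; exact: (schwartz_trans _ hk).1.
Qed.

Lemma symb_smear g psi (k : eps_index R -> 'rV[R]_n -> R[i]) : schwartz psi ->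
  symb g (@wS R n) k -> symb g (@wS R n) (fun e => smear psi (val e) (k e)).
Proof.
move=> hp hk; have sk e : schwartz (k e) := symb_schwartz e hk.
split=> [e|s K]; first exact: (param_smooth (smear_param e hp (sk e))).
have [a ha] := schwartz_unif 0 (n.*2 + K) hp.
have [_ /(_ s K) [b hb]] := hk.
have [c hc] := nat_ub (2 * cn R n * (a%:R * 2 ^+ K)).
exists (c.+1 * b)%N => e y; rewrite smear_pderivs//.
have hbe := hb e; have g0 : 0 <= b%:R * g b e by rewrite mulr_ge0 ?gauge_ge0.
have cs := smooth_pderivs s (sk e).1.
apply: le_trans (cintegral_bound (ccont_cmble (smear_integrand e y hp cs))
  (@smear_bound psi e _ y K a%:R _ (ler0n _ _) g0 (ha [::] isT) hbe)) _.
have -> : 2 * cn R n * (a%:R * (b%:R * g b e) * 2 ^+ K * jbracket y ^- K) =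
  (2 * cn R n * (a%:R * 2 ^+ K)) * (b%:R * g b e * jbracket y ^- K) by ring.
apply: (@le_trans _ _ (c.+1%:R * (b%:R * g b e * jbracket y ^- K))).
  rewrite ler_wpM2r ?mulr_ge0 ?jbVX_ge0 ?gauge_ge0//.
  by apply: le_trans hc _; rewrite ler_nat.
rewrite mulrA mulrA -natrM /wS ler_wpM2r ?jbVX_ge0// ler_wpM2l//.
by apply: gauge_mono; rewrite leq_pmull.
Qed.

Variable phi : 'rV[R]_n -> R[i].
Hypothesis hphi : mollifier phi.

(** The iterates of [ddir] are homogeneous polynomials in z, so the moment conditions apply. The
    monomial [zpow z s] strengthens the induction: unfolding one derivative moves a coordinate of z
    into it. *)
Lemma moment_ddir m s (a : R) k (y : 'rV[R]_n) : smooth k ->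
  dec (fun z => (zpow z s)%:C * phi z * iter m (ddir (a *: z)) k y) /\
  ((0 < size s + m)%N ->
    cintegral (fun z => (zpow z s)%:C * phi z * iter m (ddir (a *: z)) k y) = 0).
Proof.
have sp := moll_schwartz hphi.
elim: m s k => [|m ih] s k sk.
  have dz : dec (fun z => (zpow z s)%:C * phi z) by exact/schwartz_dec/schwartz_zpow.
  have E : (fun z => (zpow z s)%:C * phi z * iter 0 (ddir (a *: z)) k y) =
      fun z => k y * ((zpow z s)%:C * phi z) by apply/funext => z; rewrite /= mulrC.
  rewrite E addn0; split; first exact: decZ.
  by move=> s0; rewrite cintegralZ// (moll_moment hphi s0) mulr0.
have E : (fun z => (zpow z s)%:C * phi z * iter m.+1 (ddir (a *: z)) k y) =
    fun z => \sum_i a%:C * ((zpow z (i :: s))%:C * phi z * iter m (ddir (a *: z)) (pderiv i k) y).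
  apply/funext => z; rewrite iter_ddirSr// mulr_sumr; apply: eq_bigr => i _.
  by rewrite mxE /zpow big_cons !RCM; ring.
have dI i := (ih (i :: s) _ (smooth_pderiv i sk)).1.
rewrite E; split; first by apply: dec_sum => i; apply: decZ; exact: dI.
move=> _; rewrite cintegral_sum; last by move=> i; apply: decZ; exact: dI.
rewrite big1// => i _; rewrite cintegralZ; last exact: dI.
by rewrite (ih (i :: s) _ (smooth_pderiv i sk)).2 ?mulr0.
Qed.

(** Of the Taylor polynomial of [k] at [y] in the increment epsilon z, only the constant term
    survives integration against [phi]. The decay asked of [phi] is [n.*2] for integrability, [K]
    for Peetre's inequality and [q.+1] for the remainder. *)
Lemma smear_taylor e k (y : 'rV[R]_n) q K (a b : nat) : smooth k ->
  (forall z, cabs (phi z) <= a%:R * jbracket z ^- (n.*2 + (K + q.+1))) ->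
  (forall s, (size s <= q.+1)%N -> forall z, cabs (pderivs s k z) <= b%:R * jbracket z ^- K) ->
  cabs (smear phi (val e) k y - k y) <=
    2 * cn R n * (a%:R * b%:R * 2 ^+ K * 2 * n%:R ^+ q.+1) * val e ^+ q.+1 * jbracket y ^- K.
Proof.
move=> sk ha hb; have sp := moll_schwartz hphi; have e0 := ltW (eps_gt0 e).
pose T z m := (m`!%:R^-1)%:C * iter m (ddir (val e *: z)) k y.
have dT m : dec (fun z => phi z * T z m).
  have := decZ (m`!%:R^-1)%:C (moment_ddir m [::] (val e) y sk).1.
  by congr dec; apply/funext => z; rewrite /zpow big_nil mul1r mulrCA.
have iT m : cintegral (fun z => phi z * T z m) = if m == 0%N then k y else 0.
  rewrite (_ : (fun z => _) = fun z =>
      (m`!%:R^-1)%:C * ((zpow z [::])%:C * phi z * iter m (ddir (val e *: z)) k y)); last first.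
    by apply/funext => z; rewrite /zpow big_nil mul1r mulrCA.
  rewrite cintegralZ; last exact: (moment_ddir m [::] (val e) y sk).1.
  case: m => [|m]; last by rewrite (moment_ddir m.+1 [::] (val e) y sk).2 ?mulr0.
  rewrite fact0 invr1 mul1r (_ : (fun z => _) = fun z => k y * phi z).
    by have [_ i1 _] := hphi; rewrite cintegralZ ?i1 ?mulr1//; exact: schwartz_dec.
  by apply/funext => z; rewrite /zpow big_nil mul1r /= mulrC.
have cs := smear_integrand e y sp sk.
have ds : dec (fun z => phi z * k (y + val e *: z)).
  apply: (dec_cont cs (C := a%:R * b%:R)) => z; rewrite cabsM -mulrA [b%:R * _]mulrC mulrA.
  apply: ler_pM; rewrite ?cabs_ge0//.
    by apply: le_trans (ha z) _; rewrite ler_wpM2l// jbVX_le// leq_addr.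
  by apply: le_trans (hb [::] isT _) _; rewrite -[leRHS]mulr1 ler_wpM2l// jbVX_le1.
have -> : smear phi (val e) k y - k y =
    cintegral (fun z => phi z * (k (y + val e *: z) - \sum_(m < q.+1) T z m)).
  rewrite (_ : (fun z => _) = fun z => phi z * k (y + val e *: z) -
      \sum_(m < q.+1) phi z * T z m); last first.
    by apply/funext => z; rewrite mulrBr mulr_sumr.
  rewrite cintegralB//; last by apply: dec_sum => m; exact: dT.
  rewrite cintegral_sum; last by move=> m; exact: dT.
  by congr (_ - _); rewrite big_ord_recl iT eqxx big1 ?addr0.
apply: le_trans (cintegral_bound (C := a%:R * b%:R * 2 ^+ K * 2 * n%:R ^+ q.+1 *
  val e ^+ q.+1 * jbracket y ^- K) _ _) _.
- have [h _] : dec (fun z => phi z * k (y + val e *: z) - \sum_(m < q.+1) phi z * T z m).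
    by apply: decB => //; apply: dec_sum => m; exact: dT.
  by move: h; congr cmble; apply/funext => z; rewrite mulrBr mulr_sumr.
- move=> z; rewrite cabsM.
  apply: (@le_trans _ _ (a%:R * jbracket z ^- (n.*2 + (K + q.+1)) *
    (2 * ((val e ^+ q.+1 * (n%:R ^+ q.+1 * jbracket z ^+ q.+1)) *
      (b%:R * (2 ^+ K * jbracket z ^+ K * jbracket y ^- K)))))).
    apply: ler_pM; rewrite ?cabs_ge0//.
    apply: le_trans (@taylor R n q.+1 k y (val e *: z)
      (b%:R * (2 ^+ K * jbracket z ^+ K * jbracket y ^- K)) sk _) _.
      move=> t t01 s hs; apply: le_trans (hb s _ _) _; first by rewrite hs.
      by rewrite ler_wpM2l// jbVX_smear.
    rewrite ler_wpM2l// ler_wpM2r ?mulr_ge0 ?exprn_ge0 ?jb_ge0// ?invr_ge0 ?exprn_ge0 ?jb_ge0//.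
    rewrite l1Z ger0_norm// exprMn ler_wpM2l ?exprn_ge0// -exprMn.
    by apply: lerXn2r; rewrite ?nnegrE ?l1_ge0 ?mulr_ge0 ?jb_ge0// l1_jb.
  have jK : jbracket z ^+ K != 0 by rewrite gt_eqF// jbX_gt0.
  have jq : jbracket z ^+ q.+1 != 0 by rewrite gt_eqF// jbX_gt0.
  rewrite 2!exprD !invfM; apply: eq_ler.
  move: (jbracket z ^- _) (jbracket y ^- _) (jbracket z ^+ K) (jbracket z ^+ q.+1) jK jq.
  move=> u v x y' x0 y0.
  by field; rewrite x0 y0.
by rewrite !mulrA.
Qed.

Lemma symb_smear_sub q (k : eps_index R -> 'rV[R]_n -> R[i]) :
  symb (gauge1 R (eps_index R)) (@wS R n) k ->
  symb (gaugeQ R q) (@wS R n) (fun e y => smear phi (val e) (k e) y - k e y).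
Proof.
move=> hk; have sp := moll_schwartz hphi; have sk e : schwartz (k e) := symb_schwartz e hk.
have hs := symb_smear sp hk.
split=> [e|s K]; first by apply: smoothB; [exact: hs.1|exact: (sk e).1].
have [a ha] := schwartz_unif 0 (n.*2 + (K + q.+1)) sp.
have [b hb] := symb_unif (q.+1 + size s) K (@wS_ge0 R n) hk.
have [c hc] := nat_ub (2 * cn R n * (a%:R * b%:R * 2 ^+ K * 2 * n%:R ^+ q.+1)).
exists c => e y; rewrite -[gaugeQ R q _ e]/(val e ^+ q) /wS.
rewrite pderivsB; [|exact: hs.1|exact: (sk e).1].
rewrite smear_pderivs//.
apply: le_trans (@smear_taylor e (pderivs s (k e)) y q K a b _ (ha [::] isT) _) _.
- exact: smooth_pderivs (sk e).1.
- move=> s' hs' z; rewrite -pderivs_cat.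
  have := hb (s' ++ s) _ e z; rewrite mulr1; apply.
  by rewrite size_cat leq_add2r.
rewrite ler_wpM2r ?jbVX_ge0//; apply: ler_pM => //.
- by rewrite !mulr_ge0 ?cn_ge0 ?exprn_ge0.
- by rewrite exprn_ge0// ltW// eps_gt0.
(* The expansion has [q.+1] terms so that the constant one is present even for [q = 0]; the spare
   power of epsilon is dropped here. *)
by rewrite ler_wiXn2l ?eps_le1// ltW// eps_gt0.
Qed.

(** The bracket of (x, y) is at most twice the squared bracket of x times the bracket of x - y.
    Decay of order [K] thus takes [K + K] powers from [k] and [K] from [psi]. *)
Lemma schwartz_shear (k psi : 'rV[R]_n -> R[i]) : schwartz k -> schwartz psi ->
  schwartz (fun z : 'rV[R]_(n + n) => k (lsubmx z) * psi (lsubmx z - rsubmx z)).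
Proof.
move=> hk hp.
pose w1 K (z : 'rV[R]_(n + n)) := jbracket (lsubmx z) ^- K.
pose w2 K (z : 'rV[R]_(n + n)) := jbracket (lsubmx z - rsubmx z) ^- K.
have w10 : nonneg_weight w1 by move=> K z; exact: jbVX_ge0.
have w20 : nonneg_weight w2 by move=> K z; exact: jbVX_ge0.
have h1 : symb (gauge1 R unit) w1 (fun _ z => k (lsubmx z)) by exact: symb_lsubmx.
have h2 : symb (gauge1 R unit) w2 (fun _ z => psi (lsubmx z - rsubmx z)).
  apply: (@symb_pullback R (n + n) n _ (fun i => lsubmx (delta_mx 0 i : 'rV[R]_(n + n)) -
    rsubmx (delta_mx 0 i : 'rV[R]_(n + n))) 2) => //.
  - move=> i t x; rewrite [lsubmx _]linearP [rsubmx (t *: _ + _)]linearP.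
    by rewrite opprD addrACA -scalerBr.
  - move=> i; apply: (@le_trans _ _ (l1 (lsubmx (delta_mx 0 i : 'rV[R]_(n + n))) +
      l1 (rsubmx (delta_mx 0 i : 'rV[R]_(n + n))))).
      by rewrite /l1 -big_split; apply: ler_sum => j _; rewrite !mxE; exact: ler_normB.
    rewrite -[2%:R]/(1 + 1); apply: lerD.
      by apply: le_trans (l1_lsubmx _) _; rewrite l1_delta.
    by apply: le_trans (l1_rsubmx _) _; rewrite l1_delta.
apply: (symb_schwartz tt (g := gauge1 R unit)
  (F := fun _ z => k (lsubmx z) * psi (lsubmx z - rsubmx z))).
apply: (symbM w10 w20 (@wS_ge0 R (n + n)) _ _ h1 h2).
- move=> K; exists (K + K)%N, K, (2 ^ K)%N => z; rewrite /w1 /w2 /wS natrX.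
  have jz : jbracket z <= 2 * (jbracket (lsubmx z) * jbracket (lsubmx z) *
      jbracket (lsubmx z - rsubmx z)).
    rewrite -{1}(hsubmxK z); apply: le_trans (jb_row _ _) _.
    have -> : 2 * (jbracket (lsubmx z) * jbracket (lsubmx z) * jbracket (lsubmx z - rsubmx z)) =
      jbracket (lsubmx z) * (2 * jbracket (lsubmx z) * jbracket (lsubmx z - rsubmx z)) by ring.
    rewrite ler_wpM2l ?jb_ge0// -[jbracket (lsubmx z - _)]jbN; apply: le_trans (jbD _ _).
    by rewrite opprB addrC subrK.
  rewrite -invfM exprD -!exprMn -ler_pdivrMl ?exprn_gt0// -exprVn -exprVn -exprMn -exprVn.
  apply: lerXn2r; rewrite ?nnegrE ?mulr_ge0 ?invr_ge0 ?mulr_ge0 ?jb_ge0//.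
  by rewrite -invfM lef_pV2 ?posrE ?mulr_gt0 ?jb_gt0.
- by move=> l; exists 1%N => t; rewrite !mul1r.
Qed.

(* Pairing the regularisation of [w] with a test function amounts to applying
   [w] to the smeared test function, by the Fubini theorem for [w]. *)
Lemma dconv_pairing w e k : tempered w -> schwartz k ->
  cintegral (fun x => dconv w (moll phi (val e)) x * k x) = w (smear phi (val e) k).
Proof.
move=> hw hk; have hm : schwartz (moll phi (val e)) := symb_schwartz e (moll_moderate hphi).
have e0 := eps_gt0 e; have ene0 := lt0r_neq0 e0.
have hK := schwartz_shear hk hm.
have E x : (fun y : 'rV[R]_n => (fun z : 'rV[R]_(n + n) =>
    k (lsubmx z) * moll phi (val e) (lsubmx z - rsubmx z)) (row_mx x y)) =
    fun y => k x * moll phi (val e) (x - y).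
  by apply/funext => y; rewrite row_mxKl row_mxKr.
have E2 : (fun x : 'rV[R]_n => w (fun y : 'rV[R]_n => (fun z : 'rV[R]_(n + n) =>
    k (lsubmx z) * moll phi (val e) (lsubmx z - rsubmx z)) (row_mx x y))) =
    fun x => dconv w (moll phi (val e)) x * k x.
  apply/funext => x; rewrite E (temperedZ hw); last exact: schwartz_refl.
  by rewrite mulrC.
have mK : cmble (fun x : 'rV[R]_n => w (fun y : 'rV[R]_n => (fun z : 'rV[R]_(n + n) =>
    k (lsubmx z) * moll phi (val e) (lsubmx z - rsubmx z)) (row_mx x y))).
  rewrite E2; apply/ccont_cmble/ccontM; last exact: smooth_ccont hk.1.
  exact/smooth_ccont/dconv_smooth.
rewrite -E2 -(tempered_fubini hw hK mK); congr w; apply/funext => y.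
have sK := (param_schwartz hK).
have cK : ccont (fun x : 'rV[R]_n => (fun z : 'rV[R]_(n + n) =>
    k (lsubmx z) * moll phi (val e) (lsubmx z - rsubmx z)) (row_mx x y)).
  by have [sKK _] := hK; exact/smooth_ccont/(smooth_slicel y sKK).
(* The substitution x = y + epsilon z undoes the scaling of [moll], whose factor epsilon^-n cancels
   the Jacobian. *)
rewrite /fiber_int (cintegral_affine y e0 cK (fiber_dec hK [::] y)).
rewrite (_ : (fun z : 'rV[R]_n => _) = fun z =>
    (val e ^- n)%:C * (phi z * k (y + val e *: z))).
  rewrite cintegralZ; last exact: (param_dec y (smear_param e (moll_schwartz hphi) hk)).
  by rewrite mulrA -RCM mulfV ?expf_neq0// mul1r.
apply/funext => z; rewrite row_mxKl row_mxKr /moll addrK scalerA mulVf// scale1r.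
by rewrite [y + _]addrC mulrCA [phi z * _]mulrC.
Qed.
End Smear.

(** * Pseudo-differential operators and duality *)

Section Amplitude.
Variables (R : realType) (n : nat).
Notation d := (n + n + n)%N.

(** For [m] nonnegative the upper bound on the weight is used; for [m] negative the lower bound,
    which keeps the weight away from 0 because brackets are at least 1. *)
Lemma powR_weight_bound k (L : 'rV[R]_k -> R) (m : R) : weight L ->
  (forall z, 0 < L z) /\
  exists (A M : nat), forall z, L z `^ m <= A%:R * jbracket z ^+ M.
Proof.
move=> [_ [mu mu0 [[c1 c10 h1] [c2 c20 h2] _]] _].
have j1 (z : 'rV[R]_k) : 1 <= jbracket z `^ mu.
  by rewrite -[leLHS](powRr0 (jbracket z)) ler_powR ?jb_ge1// ltW.
have low z : c1^-1 <= L z.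
  rewrite -(@ler_pM2l _ c1)// mulfV ?gt_eqF//; apply: le_trans (j1 z) _.
  by have := h1 z I.
have L0 z : 0 < L z by apply: lt_le_trans (low z); rewrite invr_gt0.
split=> //; have [m0|m0] := leP 0 m.
  have [M hM] := nat_ub m; have [A hA] := nat_ub (c2 `^ m).
  exists A, M => z; apply: (@le_trans _ _ ((c2 * jbracket z) `^ m)).
    apply: ge0_ler_powR => //; rewrite ?nnegrE ?mulr_ge0 ?jb_ge0 ?(ltW (L0 z)) ?(ltW c20)//.
    exact: h2.
  rewrite powRM ?jb_ge0 ?(ltW c20)//; apply: ler_pM; rewrite ?powR_ge0//.
  by rewrite -powR_mulrn ?jb_ge0// ler_powR ?jb_ge1.
have [A hA] := nat_ub ((c1^-1 `^ (- m))^-1).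
exists A, 0%N => z; rewrite expr0 mulr1; apply: le_trans hA.
rewrite (_ : L z `^ m = (L z `^ (- m))^-1); last by rewrite -powRN opprK.
rewrite lef_pV2 ?posrE ?powR_gt0 ?invr_gt0//.
apply: ge0_ler_powR; rewrite ?nnegrE ?invr_ge0 ?oppr_ge0 ?(ltW c10) ?(ltW m0) ?(ltW (L0 z))//.
Qed.

Lemma amplitude_symb (a : 'rV[R]_d -> R[i]) : classical_amplitude a ->
  exists M, symb (gauge1 R unit) (@wP R n M) (fun _ => a).
Proof.
move=> [sa [L [m [rho [m' [wL /andP[rho0 _] ha]]]]]].
have [L0 [A [M1 hA]]] := powR_weight_bound m wL.
have [M2 hM2] := nat_ub m'.
exists (M1 + M2)%N; split=> // s K.
have : forall alpha beta gamma : 'rV[nat]_n, exists k : nat, forall x y xi : 'rV[R]_n,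
    cabs (mderiv (cat3 beta gamma alpha) a (cat3 x y xi)) <=
    k%:R * (jbracket x * jbracket y * jbracket xi) ^+ (M1 + M2).
  move=> alpha beta gamma; have [c c0 hc] := ha alpha beta gamma.
  have [k hk] := nat_ub (c * A%:R * 2 ^+ M2).
  exists k => x y xi; apply: le_trans (hc x y xi) _.
  set E := (rho * _); have E0 : 0 <= E by rewrite mulr_ge0// ltW.
  (* The base is at least 1 and the exponent at most 0, so the gain from differentiation is
     majorised by 1. *)
  have f3 : (1 + L (row_mx x xi) * jbracket (x - y) `^ (- m')) `^ (- E) <= 1.
    rewrite -[leRHS](powRr0 (1 + L (row_mx x xi) * jbracket (x - y) `^ (- m'))).
    apply: ler_powR; first by rewrite lerDl mulr_ge0 ?powR_ge0// ltW.
    by rewrite oppr_le0.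
  have f2 : jbracket (x - y) `^ m' <= (2 * jbracket x * jbracket y) ^+ M2.
    apply: (@le_trans _ _ (jbracket (x - y) `^ M2%:R)).
      by rewrite ler_powR ?jb_ge1.
    rewrite powR_mulrn ?jb_ge0//; apply: lerXn2r; rewrite ?nnegrE ?mulr_ge0 ?jb_ge0//.
    by rewrite -(jbN y); exact: jbD.
  have f1 : L (row_mx x xi) `^ m <= A%:R * (jbracket x * jbracket xi) ^+ M1.
    apply: le_trans (hA _) _; rewrite ler_wpM2l//.
    by apply: lerXn2r; rewrite ?nnegrE ?mulr_ge0 ?jb_ge0// jb_row.
  apply: (@le_trans _ _ (c * (A%:R * (jbracket x * jbracket xi) ^+ M1) *
     (2 * jbracket x * jbracket y) ^+ M2 * 1)).
    apply: ler_pM; rewrite ?powR_ge0//.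
      by rewrite !mulr_ge0 ?powR_ge0// ltW.
    apply: ler_pM; rewrite ?powR_ge0//; first by rewrite mulr_ge0 ?powR_ge0// ltW.
    by rewrite ler_wpM2l// ltW.
  rewrite mulr1; apply: (@le_trans _ _ ((c * A%:R * 2 ^+ M2) *
    (jbracket x * jbracket y * jbracket xi) ^+ (M1 + M2))); last first.
    by rewrite ler_wpM2r// exprn_ge0// !mulr_ge0 ?jb_ge0.
  have := jb_ge1 x; have := jb_ge1 y; have := jb_ge1 xi.
  move: (jbracket x) (jbracket y) (jbracket xi) => u v t t1 v1 u1.
  have u0 := le_trans ler01 u1; have v0 := le_trans ler01 v1; have t0 := le_trans ler01 t1.
  have -> : c * (A%:R * (u * t) ^+ M1) * (2 * u * v) ^+ M2 =
    (c * A%:R * 2 ^+ M2) * ((u * t) ^+ M1 * (u * v) ^+ M2) by rewrite -!mulrA !exprMn; ring.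
  rewrite ler_wpM2l ?mulr_ge0 ?exprn_ge0 ?(ltW c0)// exprD.
  apply: ler_pM; rewrite ?exprn_ge0 ?mulr_ge0//; apply: lerXn2r; rewrite ?nnegrE ?mulr_ge0//.
    by rewrite ler_wpM2r// ler_peMr.
  by rewrite ler_peMr ?mulr_ge0.
move=> key; have [k hk] := key (rsubmx (mindex s)) (lsubmx (lsubmx (mindex s)))
  (rsubmx (lsubmx (mindex s))).
exists k => t z; rewrite mulr1 mderiv_mindex//.
have := hk (lsubmx (lsubmx z)) (rsubmx (lsubmx z)) (rsubmx z).
by rewrite /cat3 !hsubmxK.
Qed.

(** Amplitudes take (x, y, xi), whereas [Top] works at (p, xi, q). For the operator, p is x and q is
    y; for its transpose, in [amp2], p is y and q is x. *)
Definition amp1 (a : 'rV[R]_d -> R[i]) (z : 'rV[R]_d) : R[i] :=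
  a (cat3 (lsubmx (lsubmx z)) (rsubmx z) (rsubmx (lsubmx z))).
Definition amp2 (a : 'rV[R]_d -> R[i]) (z : 'rV[R]_d) : R[i] :=
  a (cat3 (rsubmx z) (lsubmx (lsubmx z)) (rsubmx (lsubmx z))).

Lemma l1_cat3 (x y z : 'rV[R]_n) : l1 (cat3 x y z) = l1 x + l1 y + l1 z.
Proof. by rewrite /cat3 !l1_row. Qed.

Lemma l1_parts (z : 'rV[R]_d) :
  l1 (lsubmx (lsubmx z)) + l1 (rsubmx (lsubmx z)) + l1 (rsubmx z) = l1 z.
Proof. by rewrite -l1_cat3 /cat3 !hsubmxK. Qed.

Lemma cat3_lin (x x' y y' z z' : 'rV[R]_n) (t : R) :
  cat3 (t *: x + x') (t *: y + y') (t *: z + z') = t *: cat3 x y z + cat3 x' y' z' :> 'rV[R]_d.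
Proof. by rewrite /cat3 !scale_row_mx !add_row_mx. Qed.

Lemma symb_amp1 a M : symb (gauge1 R unit) (@wP R n M) (fun _ => a) ->
  symb (gauge1 R unit) (@wP R n M) (fun _ => amp1 a).
Proof.
pose L (z : 'rV[R]_d) : 'rV[R]_d := cat3 (lsubmx (lsubmx z)) (rsubmx z) (rsubmx (lsubmx z)).
move=> ha; apply: (@symb_comp R unit d d (fun _ => L) (fun _ i => L (delta_mx 0 i)) 1
  (gauge1 R unit) (@wP R n M) (@wP R n M) (fun _ => a)) => //.
- by move=> th i t x; rewrite /L !linearP /= cat3_lin.
- by move=> th i; rewrite l1_cat3 addrAC l1_parts l1_delta.
- exact: wP_ge0.
- exact: wP_ge0.
move=> K; exists K, 1%N => th z; rewrite mul1r /wP /L /cat3 !row_mxKl !row_mxKr.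
by rewrite mulrAC.
Qed.

Lemma symb_amp2 a M : symb (gauge1 R unit) (@wP R n M) (fun _ => a) ->
  symb (gauge1 R unit) (@wP R n M) (fun _ => amp2 a).
Proof.
pose L (z : 'rV[R]_d) : 'rV[R]_d := cat3 (rsubmx z) (lsubmx (lsubmx z)) (rsubmx (lsubmx z)).
move=> ha; apply: (@symb_comp R unit d d (fun _ => L) (fun _ i => L (delta_mx 0 i)) 1
  (gauge1 R unit) (@wP R n M) (@wP R n M) (fun _ => a)) => //.
- by move=> th i t x; rewrite /L !linearP /= cat3_lin.
- by move=> th i; rewrite l1_cat3 -addrA addrC l1_parts l1_delta.
- exact: wP_ge0.
- exact: wP_ge0.
move=> K; exists K, 1%N => th z; rewrite mul1r /wP /L /cat3 !row_mxKl !row_mxKr.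
by rewrite -mulrA mulrC.
Qed.

Lemma symb_kernel T (g : gauge R T) a M U :
  symb (gauge1 R unit) (@wP R n M) (fun _ => a) -> symb g (@wS R n) U ->
  symb g (@wB R n M) (fun t z => a z * liftq (U t) z).
Proof.
move=> ha hU.
have ha' : symb (gauge1 R T) (@wP R n M) (fun _ => a).
  exact: (@symb_reindex R unit T (fun=> tt) _ (gauge1 R unit)).
apply: (symbM (@wP_ge0 R n M) (@wB_ge0 R n 0) (@wB_ge0 R n M) _ _ ha' (symb_liftq 0 hU)).
- by move=> K; have := @wPB R n M 0 K; rewrite addn0.
- exact: gauge1M.
Qed.
End Amplitude.

(** * Duality between the operator and its transpose *)

Section Duality.
Variables (R : realType) (n : nat).
Notation d := (n + n + n)%N.

(** Once q is integrated out, [Gop] decays in xi, and [g] absorbs the growth in x; this makes Fubini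
    available for the pair (x, xi). *)
Lemma Top_pairing (sg : R) (b : 'rV[R]_d -> R[i]) M (g : 'rV[R]_n -> R[i]) : sg * sg = 1 ->
  symb (gauge1 R unit) (@wB R n M) (fun _ => b) -> schwartz g ->
  cintegral (fun x => Top sg b x * g x) =
  cintegral (fun xi => cintegral (fun x => Gop sg b (row_mx x xi) * g x)).
Proof.
move=> sg2 hb hg; have jG := jok_Gop sg2 tt hb.
have [k hk] := Gop_decay sg2 n.*2 hb.
have [l hl] := schwartz_unif 0 (n.*2 + M) hg.
rewrite -(@cintegral_swap _ _ _ (fun x xi => Gop sg b (row_mx x xi) * g x) (k%:R * l%:R)).
- congr cintegral; apply/funext => x; rewrite mulrC /Top /Jint -cintegralZ.
    by congr cintegral; apply/funext => xi; rewrite mulrC.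
  exact: (jok_dec x jG).
- move=> xi; apply: ccontM; last exact: smooth_ccont hg.1.
  exact/smooth_ccont/(smooth_slicel xi jG.1).
- move=> x; apply: ccontM; last exact: ccont_cst.
  exact/smooth_ccont/(smooth_slicer x jG.1).
move=> x xi; rewrite cabsM.
apply: (@le_trans _ _ (k%:R * (jbracket x ^+ M * jbracket xi ^- n.*2) *
  (l%:R * jbracket x ^- (n.*2 + M)))).
  apply: ler_pM; rewrite ?cabs_ge0//; last exact: (hl [::]).
  by have := hk tt x xi; rewrite mulr1.
have jz : jbracket x ^+ M != 0 by rewrite gt_eqF// jbX_gt0.
rewrite exprD invfM; apply: eq_ler.
move: (jbracket x ^- _) (jbracket xi ^- _) (jbracket x ^+ M) jz => u v y y0.
by field.
Qed.

(** For fixed xi both sides are the same absolutely convergent double integral over x and y: the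
    exchange of p and q is compensated by the sign of the phase. *)
Lemma Gop_duality (a : 'rV[R]_d -> R[i]) M (U g : 'rV[R]_n -> R[i]) (xi : 'rV[R]_n) :
  symb (gauge1 R unit) (@wP R n M) (fun _ => a) -> schwartz U -> schwartz g ->
  cintegral (fun x => Gop 1 (fun z => amp1 a z * liftq U z) (row_mx x xi) * g x) =
  cintegral (fun y => Gop (-1) (fun z => amp2 a z * liftq g z) (row_mx y xi) * U y).
Proof.
move=> ha hU hg.
have hb1 := symb_kernel (symb_amp1 ha) (@schwartz_symb R unit n _ hU).
have hb2 := symb_kernel (symb_amp2 ha) (@schwartz_symb R unit n _ hg).
set b1 := (fun z => amp1 a z * _); set b2 := (fun z => amp2 a z * _).
have j1 := jok_bosc 1 tt hb1; have j2 := jok_bosc (-1) tt hb2.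
pose F x y := b1 (cat3 x xi y) * osc 1 (cat3 x xi y) * g x.
have E x y : b2 (cat3 y xi x) * osc (-1) (cat3 y xi x) * U y = F x y.
  rewrite /F /b1 /b2 /amp1 /amp2 /liftq /cat3 !row_mxKl !row_mxKr.
  rewrite -[row_mx (row_mx y xi) x]/(cat3 y xi x) -[row_mx (row_mx x xi) y]/(cat3 x xi y).
  rewrite /osc !phase_cat3 (_ : -1 * dot (y - x) xi = 1 * dot (x - y) xi); last first.
    by rewrite mul1r mulN1r /dot -sumrN; apply: eq_bigr => i _; rewrite !mxE; ring.
  by rewrite -!mulrA; congr (_ * _); ring.
have [_ /(_ [::] n.*2) [k hk]] := hb1.
have [l hl] := schwartz_unif 0 (n.*2 + M) hg.
transitivity (cintegral (fun x => cintegral (F x))).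
  congr cintegral; apply/funext => x; rewrite mulrC /Gop /Jint -cintegralZ.
    by congr cintegral; apply/funext => y; rewrite mulrC.
  exact: (jok_dec (row_mx x xi) j1).
rewrite (@cintegral_swap _ _ _ F (k%:R * jbracket xi ^+ M * l%:R)).
- congr cintegral; apply/funext => y; rewrite mulrC /Gop /Jint -cintegralZ.
    by congr cintegral; apply/funext => x; rewrite -E mulrC.
  exact: (jok_dec (row_mx y xi) j2).
- move=> y; apply: ccontM; last exact: smooth_ccont hg.1.
  apply: (@ccont_comp R _ _ (fun x : 'rV[R]_n => row_mx x xi)
    (fun z => b1 (row_mx z y) * osc 1 (row_mx z y))).
    exact: continuous_row_mxl.
  exact/smooth_ccont/(smooth_slicel y j1.1).
- move=> x; apply: ccontM; last exact: ccont_cst.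
  exact/smooth_ccont/(smooth_slicer (row_mx x xi) j1.1).
move=> x y; rewrite /F cabsM cabsM cabs_osc mulr1.
apply: (@le_trans _ _ (k%:R * 1 * (jbracket x ^+ M * jbracket xi ^+ M * jbracket y ^- n.*2) *
  (l%:R * jbracket x ^- (n.*2 + M)))).
  apply: ler_pM; rewrite ?cabs_ge0//; last exact: (hl [::]).
  by have := hk tt (cat3 x xi y); rewrite wB_cat3.
have jz : jbracket x ^+ M != 0 by rewrite gt_eqF// jbX_gt0.
rewrite exprD invfM; apply: eq_ler.
move: (jbracket x ^- _) (jbracket y ^- _) (jbracket xi ^+ M) (jbracket x ^+ M) jz => u v t y' y0.
by field.
Qed.

Definition cpi : R[i] := ((2 * pi) ^- n)%:C.

Definition Aop (a : 'rV[R]_d -> R[i]) (U : 'rV[R]_n -> R[i]) (x : 'rV[R]_n) : R[i] :=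
  cpi * Top 1 (fun z => amp1 a z * liftq U z) x.

Definition tAop (a : 'rV[R]_d -> R[i]) (g : 'rV[R]_n -> R[i]) (y : 'rV[R]_n) : R[i] :=
  cpi * Top (-1) (fun z => amp2 a z * liftq g z) y.

Variables (a : 'rV[R]_d -> R[i]) (M : nat).
Hypothesis ha : symb (gauge1 R unit) (@wP R n M) (fun _ => a).
Let sg1 : (1 : R) * 1 = 1. Proof. by rewrite mul1r. Qed.
Let sgN : (-1 : R) * -1 = 1. Proof. by rewrite mulrNN mul1r. Qed.

Lemma symb_Aop T (g : gauge R T) U : symb g (@wS R n) U ->
  symb g (@wS R n) (fun t => Aop a (U t)).
Proof.
move=> hU; apply: symbZ; first exact: wS_ge0.
exact: (symb_Top sg1 (symb_kernel (symb_amp1 ha) hU)).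
Qed.

Lemma symb_tAop T (g : gauge R T) U : symb g (@wS R n) U ->
  symb g (@wS R n) (fun t => tAop a (U t)).
Proof.
move=> hU; apply: symbZ; first exact: wS_ge0.
exact: (symb_Top sgN (symb_kernel (symb_amp2 ha) hU)).
Qed.

Lemma schwartz_tAop U : schwartz U -> schwartz (tAop a U).
Proof. by move=> /(@schwartz_symb R unit) /symb_tAop /(symb_schwartz tt). Qed.

Lemma tAop_lin (c : R[i]) f g : schwartz f -> schwartz g ->
  tAop a (fun x => c * f x + g x) = fun x => c * tAop a f x + tAop a g x.
Proof.
move=> /(@schwartz_symb R unit) hf /(@schwartz_symb R unit) hg.
have bf := symb_kernel (symb_amp2 ha) hf; have bg := symb_kernel (symb_amp2 ha) hg.
apply/funext => x; rewrite /tAop.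
rewrite (_ : (fun z => amp2 a z * liftq (fun x => c * f x + g x) z) =
  fun z => c * (amp2 a z * liftq f z) + amp2 a z * liftq g z); last first.
  by apply/funext => z; rewrite /liftq; ring.
rewrite (@TopD _ _ _ sgN _ _ _ _ _ _ tt (symbZ c (@wB_ge0 R n M) bf) bg).
rewrite (@TopZ _ _ _ sgN _ _ _ _ tt c bf).
by move: (Top _ _ _) (Top _ _ _) => u v; rewrite mulrDr mulrCA.
Qed.

Lemma Aop_duality U g : schwartz U -> schwartz g ->
  cintegral (fun x => Aop a U x * g x) = cintegral (fun y => U y * tAop a g y).
Proof.
move=> hU hg.
have b1 := symb_kernel (symb_amp1 ha) (@schwartz_symb R unit n _ hU).
have b2 := symb_kernel (symb_amp2 ha) (@schwartz_symb R unit n _ hg).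
have t1 := symb_schwartz tt (symb_Top sg1 b1).
have t2 := symb_schwartz tt (symb_Top sgN b2).
rewrite (_ : (fun x => _) = fun x =>
    cpi * (Top 1 (fun z => amp1 a z * liftq U z) x * g x)); last first.
  by apply/funext => x; rewrite mulrA.
rewrite [in RHS](_ : (fun x => _) = fun x =>
    cpi * (Top (-1) (fun z => amp2 a z * liftq g z) x * U x)); last first.
  by apply/funext => x; rewrite /tAop; ring.
rewrite !cintegralZ; [|exact: schwartz_mul_dec|exact: schwartz_mul_dec].
rewrite (Top_pairing sg1 b1 hg) (Top_pairing sgN b2 hU); congr (_ * cintegral _).
by apply/funext => xi; exact: (Gop_duality xi ha hU hg).
Qed.
End Duality.

(** * Moderate and negligible nets *)

Section Nets.
Variables (R : realType) (n : nat).
Implicit Types (u v : net R n) (e : eps_index R).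

Definition moderate u : Prop := (forall e, smooth (u e)) /\
  forall s, exists k : nat, forall e x,
    cabs (pderivs s (u e) x) <= k%:R * val e ^- k * jbracket x ^+ k.

Definition null_net u : Prop := forall q, symb (gaugeQ R q) (@wS R n) u.

Definition small (h : eps_index R -> R[i]) : Prop :=
  forall q, exists c : nat, forall e, cabs (h e) <= c%:R * val e ^+ q.

Lemma epsX_gt0 e k : 0 < val e ^+ k.
Proof. by rewrite exprn_gt0// eps_gt0. Qed.

Lemma epsVX_ge0 e k : 0 <= val e ^- k.
Proof. by rewrite invr_ge0 ltW// epsX_gt0. Qed.

Lemma epsVX_le e k l : (k <= l)%N -> val e ^- k <= val e ^- l.
Proof. exact: (gauge_mono (gaugeE R)). Qed.

Lemma E_tauP u : E_tau u <-> moderate u.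
Proof.
split=> -[su hu]; split=> //.
- move=> s; have [N [C hC]] := hu (mindex s); have [c hc] := nat_ub C.
  exists (maxn c N) => e x; rewrite mderiv_mindex//.
  have := hC e x; rewrite -ler_pdivlMl ?epsX_gt0// -ler_pdivlMl ?jbVX_gt0// invrK.
  have C0 : 0 <= C.
    apply: le_trans (hC e x); rewrite mulr_ge0 ?(ltW (epsX_gt0 e N))//.
    by rewrite mulr_ge0 ?jbVX_ge0 ?cabs_ge0.
  move=> /le_trans; apply; rewrite mulrC [_ * C]mulrC.
  apply: ler_pM; rewrite ?jbX_ge0 ?mulr_ge0 ?epsVX_ge0//; last by rewrite jbX_le// leq_maxr.
  apply: ler_pM; rewrite ?epsVX_ge0//; last by rewrite epsVX_le// leq_maxr.
  by apply: le_trans hc _; rewrite ler_nat leq_maxl.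
- move=> alpha; have [k hk] := hu (mseq alpha); exists k, k%:R => e x.
  rewrite -ler_pdivlMl ?epsX_gt0// -ler_pdivlMl ?jbVX_gt0// invrK.
  by rewrite mulrC [_ * k%:R]mulrC; exact: hk.
Qed.

Lemma N_SP u : N_S u <-> null_net u.
Proof.
split=> [[su hu] q|hu].
  split=> // s K.
  have key (l : seq 'I_n) : exists k : nat, forall e x,
      `|zpow x l| * cabs (pderivs s (u e) x) <= k%:R * val e ^+ q.
    have [C hC] := hu (mindex l) (mindex s) q; have [k hk] := nat_ub C.
    exists k => e x; rewrite mderiv_mindex// zpow_mpow -ler_pdivrMr ?epsX_gt0//.
    by rewrite mulrC; apply: le_trans (hC e x) _.
  have [k0 h0] := key [::].
  have [k1 h1] := @fin_unif _ (fun (i : 'I_n) k => forall e x,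
      `|zpow x (nseq K i)| * cabs (pderivs s (u e) x) <= k%:R * val e ^+ q)
    (fun i k k' kk h e x => le_trans (h e x)
      (ler_wpM2r (ltW (epsX_gt0 e q)) (eq_ind_r is_true kk (ler_nat R k k'))))
    (fun i => key (nseq K i)).
  exists (n.+1 ^ K.+1 * (k0 + k1))%N => e x.
  rewrite -[gaugeQ R q _ e]/(val e ^+ q) natrM natrX -[_ * _ * val e ^+ q]mulrA.
  apply: coords_jb; first exact: cabs_ge0.
    have := h0 e x; rewrite /zpow big_nil normr1 mul1r => /le_trans; apply.
    by rewrite ler_wpM2r ?(ltW (epsX_gt0 e q))// ler_nat leq_addr.
  move=> i; have := h1 i e x; rewrite /zpow big_nseq iter_mulr_1 normrX mulrC => /le_trans; apply.
  by rewrite ler_wpM2r ?(ltW (epsX_gt0 e q))// ler_nat leq_addl.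
split=> [e|alpha beta q]; first by have [h _] := hu 0%N; exact: h.
have [_ /(_ (mseq beta) (mlength alpha)) [k hk]] := hu q.
exists k%:R => e x; rewrite mulrC ler_pdivrMr ?epsX_gt0//.
apply: (@le_trans _ _ (jbracket x ^+ mlength alpha *
    (k%:R * val e ^+ q * jbracket x ^- mlength alpha))).
  by apply: ler_pM; rewrite ?cabs_ge0//; [exact: mpow_le|exact: hk].
by rewrite mulrCA mulfV ?mulr1// gt_eqF// jbX_gt0.
Qed.

Lemma symb_moderate u : symb (gaugeE R) (@wS R n) u -> moderate u.
Proof.
move=> [su hu]; split=> // s; have [k hk] := hu s 0%N; exists k => e x.
apply: le_trans (hk e x) _; rewrite ler_wpM2l ?mulr_ge0 ?gauge_ge0//.
by rewrite /wS expr0 invr1 jbX_ge1.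
Qed.

Lemma gauge1E u : symb (gauge1 R (eps_index R)) (@wS R n) u -> symb (gaugeE R) (@wS R n) u.
Proof.
apply: symb_gauge; first exact: wS_ge0.
move=> k; exists 1%N => e; rewrite mul1r.
by rewrite -[leLHS](_ : val e ^- 0 = 1) ?epsVX_le// expr0 invr1.
Qed.

Lemma moderate_unif u N : moderate u -> exists k : nat, forall s, (size s <= N)%N ->
  forall e x, cabs (pderivs s (u e) x) <= k%:R * val e ^- k * jbracket x ^+ k.
Proof.
move=> [_ hu]; apply: (@list_unif n (fun s k => forall e x,
  cabs (pderivs s (u e) x) <= k%:R * val e ^- k * jbracket x ^+ k)) => // s k l kl h e x.
apply: le_trans (h e x) _; apply: ler_pM; rewrite ?jbX_ge0 ?mulr_ge0 ?epsVX_ge0//.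
  by apply: ler_pM; rewrite ?epsVX_ge0 ?ler_nat ?epsVX_le.
exact: jbX_le.
Qed.

Lemma moderateB u v : moderate u -> moderate v -> moderate (fun e x => u e x - v e x).
Proof.
move=> hu hv; have [su _] := hu; have [sv _] := hv.
split=> [e|s]; first exact: smoothB.
have [k hk] := moderate_unif (size s) hu; have [l hl] := moderate_unif (size s) hv.
exists (k + l)%N => e x; rewrite pderivsB//; apply: le_trans (cabsB _ _) _.
rewrite [(k + l)%:R]natrD !mulrDl; apply: lerD.
- apply: le_trans (hk s (leqnn _) e x) _.
  apply: ler_pM; rewrite ?jbX_ge0 ?mulr_ge0 ?epsVX_ge0//; last by rewrite jbX_le// leq_addr.
  by rewrite ler_wpM2l// epsVX_le// leq_addr.
- apply: le_trans (hl s (leqnn _) e x) _.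
  apply: ler_pM; rewrite ?jbX_ge0 ?mulr_ge0 ?epsVX_ge0//; last by rewrite jbX_le// leq_addl.
  by rewrite ler_wpM2l// epsVX_le// leq_addl.
Qed.

Lemma moderateM u v : moderate u -> moderate v -> moderate (fun e x => u e x * v e x).
Proof.
move=> hu hv; have [su _] := hu; have [sv _] := hv.
split=> [e|s]; first exact: smoothM.
have [k hk] := moderate_unif (size s) hu; have [l hl] := moderate_unif (size s) hv.
exists (maxn (2 ^ size s * k * l) (k + l))%N => e x.
apply: le_trans (@pderivsM_bound _ _ s (u e) (v e) x _ _ (su e) (sv e)
  (fun s' hs' => hk s' hs' e x) (fun s' hs' => hl s' hs' e x)) _.
have -> : 2 ^+ size s * (k%:R * val e ^- k * jbracket x ^+ k *
    (l%:R * val e ^- l * jbracket x ^+ l)) =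
    (2 ^ size s * k * l)%N%:R * val e ^- (k + l) * jbracket x ^+ (k + l).
  by rewrite !natrM natrX !exprD invfM; ring.
apply: ler_pM; rewrite ?jbX_ge0 ?mulr_ge0 ?epsVX_ge0//; last by rewrite jbX_le// leq_maxr.
by apply: ler_pM; rewrite ?epsVX_ge0// ?ler_nat ?leq_maxl// epsVX_le// leq_maxr.
Qed.

Lemma moderate_symb u v : moderate u -> symb (gaugeE R) (@wS R n) v ->
  symb (gaugeE R) (@wS R n) (fun e x => u e x * v e x).
Proof.
move=> hu hv; have [su _] := hu; have [sv _] := hv.
split=> [e|s K]; first exact: smoothM.
have [k hk] := moderate_unif (size s) hu.
have [l hl] := symb_unif (size s) (K + k) (@wS_ge0 R n) hv.
exists (maxn (2 ^ size s * k * l) (k + l))%N => e x.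
apply: le_trans (@pderivsM_bound _ _ s (u e) (v e) x _ _ (su e) (sv e)
  (fun s' hs' => hk s' hs' e x) (fun s' hs' => hl s' hs' e x)) _.
rewrite -[gaugeE R _ e]/(val e ^- l) -[gaugeE R _ e]/(val e ^- _) /wS.
have -> : 2 ^+ size s * (k%:R * val e ^- k * jbracket x ^+ k *
    (l%:R * val e ^- l * jbracket x ^- (K + k))) =
    (2 ^ size s * k * l)%N%:R * val e ^- (k + l) * jbracket x ^- K.
  have jz : jbracket x ^+ k != 0 by rewrite gt_eqF// jbX_gt0.
  rewrite !natrM natrX !exprD !invfM.
  move: (val e ^- k) (val e ^- l) (jbracket x ^- K).
  by move: (jbracket x ^+ k) jz => a ha b c d0; field.
rewrite ler_wpM2r ?jbVX_ge0//.
by apply: ler_pM; rewrite ?epsVX_ge0// ?ler_nat ?leq_maxl// epsVX_le// leq_maxr.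
Qed.

Lemma moderate_null_net u v : moderate u -> null_net v ->
  null_net (fun e x => u e x * v e x).
Proof.
move=> hu hv q; have [su _] := hu; have [sv _] := hv 0%N.
split=> [e|s K]; first exact: smoothM.
have [k hk] := moderate_unif (size s) hu.
(* [k] extra powers of epsilon and of the bracket pay for the moderate factor. *)
have [l hl] := symb_unif (size s) (K + k) (@wS_ge0 R n) (hv (q + k)%N).
exists (2 ^ size s * k * l)%N => e x.
apply: le_trans (@pderivsM_bound _ _ s (u e) (v e) x _ _ (su e) (sv e)
  (fun s' hs' => hk s' hs' e x) (fun s' hs' => hl s' hs' e x)) _.
rewrite -[gaugeQ R (q + k) _ e]/(val e ^+ (q + k)) -[gaugeQ R q _ e]/(val e ^+ q) /wS.
have jz : jbracket x ^+ k != 0 by rewrite gt_eqF// jbX_gt0.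
have ez : val e ^+ k != 0 by rewrite gt_eqF// epsX_gt0.
rewrite !natrM natrX !exprD !invfM; apply: eq_ler.
move: (val e ^+ k) (val e ^+ q) (jbracket x ^- K) (jbracket x ^+ k) jz ez => a b c d0 hd ha.
by field; rewrite ha hd.
Qed.

Lemma null_netD u v : null_net u -> null_net v -> null_net (fun e x => u e x + v e x).
Proof. by move=> hu hv q; apply: symbD; [exact: wS_ge0|exact: hu|exact: hv]. Qed.

Lemma null_netN u : null_net u -> null_net (fun e x => - u e x).
Proof.
move=> hu q; have := symbZ (-1) (@wS_ge0 R n) (hu q); congr symb.
by apply/funext => e; apply/funext => x; rewrite mulN1r.
Qed.

Lemma N_oP h : N_o h <-> small h.
Proof.
split=> hh q; have [C hC] := hh q.
  have [c hc] := nat_ub C; exists c => e.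
  by rewrite -ler_pdivrMr ?epsX_gt0// mulrC; apply: le_trans (hC e) _.
by exists C%:R => e; rewrite mulrC ler_pdivrMr ?epsX_gt0.
Qed.

Lemma smallD h1 h2 : small h1 -> small h2 -> small (fun e => h1 e + h2 e).
Proof.
move=> s1 s2 q; have [c1 hc1] := s1 q; have [c2 hc2] := s2 q; exists (c1 + c2)%N => e.
by rewrite natrD mulrDl; apply: le_trans (cabsD _ _) _; exact: lerD.
Qed.

Lemma smallN h : small h -> small (fun e => - h e).
Proof. by move=> hh q; have [c hc] := hh q; exists c => e; rewrite cabsN. Qed.

Lemma small_integral u : null_net u -> small (fun e => cintegral (u e)).
Proof.
move=> hu q; have [su /(_ [::] n.*2) [k hk]] := hu q.
have [c hc] := nat_ub (2 * cn R n * k%:R); exists c => e.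
apply: le_trans (cintegral_bound (ccont_cmble (smooth_ccont (su e))) (hk e)) _.
rewrite -[gaugeQ R q _ e]/(val e ^+ q) mulrA ler_wpM2r// ltW//; exact: epsX_gt0.
Qed.

Lemma small_tempered w u : tempered w -> null_net u -> small (fun e => w (u e)).
Proof.
move=> hw hu q; have [N [C hC]] := tempered_le hw.
have [k hk] := symb_unif N N (@wS_ge0 R n) (hu q).
exists (C * k)%N => e; rewrite natrM -mulrA; apply: hC.
- exact: symb_schwartz e (hu q).
- by rewrite mulr_ge0// ltW//; exact: epsX_gt0.
- by move=> s hs y; apply: hk.
Qed.
End Nets.

(** * The generalized operator extends the classical one *)

Section SeminormFamily.
Variables (R : realType) (n : nat).

(* Indexing a family by these pairs, with the bounds as gauge, turns the
   continuity of an operator on S into a uniform bound. *)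
Record bounded_schwartz := BoundedSchwartz {
  bs_fun : 'rV[R]_n -> R[i];
  bs_bound : nat -> R;
  bs_schwartz : schwartz bs_fun;
  bs_ge0 : forall N, 0 <= bs_bound N;
  bs_mono : forall N N', (N <= N')%N -> bs_bound N <= bs_bound N';
  bs_le : forall N (alpha beta : 'rV[nat]_n),
    (mlength alpha <= N)%N -> (mlength beta <= N)%N ->
    forall x, `|mpow x alpha| * cabs (mderiv beta bs_fun x) <= bs_bound N }.

Definition bs_gauge : gauge R bounded_schwartz :=
  Gauge (fun N p => bs_ge0 p N) (fun N N' p h => bs_mono p h).

Lemma symb_bs : symb bs_gauge (@wS R n) bs_fun.
Proof.
split=> [p|s K]; first by case: (bs_schwartz p).
pose N := maxn (size s) K.
exists (maxn (n.+1 ^ K.+1) N) => p x.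
have [sp _] := bs_schwartz p.
apply: le_trans (@seminorm_jb R n (bs_fun p) (bs_bound p N) N s K x sp (leq_maxl _ _)
  (leq_maxr _ _) (fun al be ha hb => bs_le p ha hb x)) _.
rewrite ler_wpM2r ?jbVX_ge0// -natrX; apply: ler_pM; rewrite ?bs_ge0//.
  by rewrite ler_nat leq_maxl.
by apply: bs_mono; exact: leq_maxr.
Qed.

Lemma bs_exists (f : 'rV[R]_n -> R[i]) (k : nat) (B : R) : schwartz f ->
  (forall alpha beta : 'rV[nat]_n, (mlength alpha <= k)%N -> (mlength beta <= k)%N ->
     forall x, `|mpow x alpha| * cabs (mderiv beta f x) <= B) ->
  exists p, bs_fun p = f /\ bs_bound p k = B.
Proof.
move=> hf hB.
have B0 : 0 <= B.
  apply: le_trans (hB 0 0 _ _ 0); first by rewrite mulr_ge0 ?cabs_ge0.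
    by rewrite /mlength big1// => i _; rewrite mxE.
  by rewrite /mlength big1// => i _; rewrite mxE.
have [b hb] := choice (fun N => schwartz_unif N N hf).
(* The sum is empty for [N] at most [k], so the bound of order [k] is exactly [B], as [tempered]
   demands an estimate linear in [B]. Beyond [k] enough constants are added for validity and
   monotonicity. *)
pose bd N : R := B + \sum_(i < N.+1 | (k < i)%N) (b i)%:R.
have bd0 N : 0 <= bd N by rewrite addr_ge0// sumr_ge0.
have bdM N N' : (N <= N')%N -> bd N <= bd N'.
  move=> h; rewrite lerD2l -(big_mkord (fun i => k < i)%N (fun i => (b i)%:R)).
  rewrite -(big_mkord (fun i => k < i)%N (fun i => (b i)%:R)).
  by rewrite [leRHS](big_cat_nat (n := N.+1))//= lerDl sumr_ge0.
have bdk : bd k = B.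
  by rewrite /bd big_pred0 ?addr0// => i; apply/negbTE; rewrite -leqNgt -ltnS.
have bdle N (alpha beta : 'rV[nat]_n) : (mlength alpha <= N)%N -> (mlength beta <= N)%N ->
    forall x, `|mpow x alpha| * cabs (mderiv beta f x) <= bd N.
  move=> ha hbe x; have [Nk|kN] := leqP N k.
    apply: (@le_trans _ _ B); last by rewrite lerDl sumr_ge0.
    by apply: hB; [exact: leq_trans ha Nk|exact: leq_trans hbe Nk].
  apply: (@le_trans _ _ (b N)%:R).
    apply: (@le_trans _ _ (jbracket x ^+ N * ((b N)%:R * jbracket x ^- N))).
      apply: ler_pM; rewrite ?cabs_ge0//.
        by apply: le_trans (mpow_le x alpha) _; exact: jbX_le.
      by apply: (hb N (mseq beta)); rewrite size_mseq.
    by rewrite mulrCA mulfV ?mulr1// gt_eqF// jbX_gt0.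
  rewrite /bd (bigD1 ord_max)//= addrCA lerDl addr_ge0// sumr_ge0//.
by exists (BoundedSchwartz hf bd0 bdM bdle).
Qed.
End SeminormFamily.

Section Operators.
Variables (R : realType) (n : nat) (phi : 'rV[R]_n -> R[i]).
Hypothesis hphi : mollifier phi.
Notation d := (n + n + n)%N.
Variables (a : 'rV[R]_d -> R[i]) (M : nat).
Hypothesis ha : symb (gauge1 R unit) (@wP R n M) (fun _ => a).
Notation phat := (fourier phi).
Implicit Types (e : eps_index R) (f g : 'rV[R]_n -> R[i]).

(** The Fourier transform of [phi] is 1 at 0 because [phi] has integral 1, so its tensor square is a
    cut-off. *)
Lemma cutoff_exists : exists2 psi : 'rV[R]_(n + n) -> R[i], schwartz psi & psi 0 = 1.
Proof.
exists (fun z => phat (lsubmx z) * phat (rsubmx z)).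
  by apply: schwartz_tensor; exact: phat_schwartz.
have [_ i1 _] := hphi.
by rewrite !linear0 fourier0 i1 mulr1.
Qed.

Lemma psido_netE (u : net R n) e x : schwartz (fun y => u e y * phat (val e *: y)) ->
  psido_net phi a u e x = Aop a (fun y => u e y * phat (val e *: y)) x.
Proof.
move=> hU; have [psi hpsi psi0] := cutoff_exists.
have sg1 : (1 : R) * 1 = 1 by rewrite mul1r.
have hb := symb_kernel (symb_amp1 ha) (@schwartz_symb R unit n _ hU).
rewrite /psido_net /Aop -(oscillatoryE sg1 hb x hpsi psi0); congr (_ * oscillatory _).
apply/funext => z /=; rewrite (fourier_moll hphi).
rewrite /pqx /amp1 /liftq /osc phase_cat3 mul1r /cat3 !row_mxKl !row_mxKr.
by ring.
Qed.

Lemma psido_transposeE f : schwartz f -> psido_transpose a f = tAop a f.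
Proof.
move=> hf; have [psi hpsi psi0] := cutoff_exists.
have sgN : (-1 : R) * -1 = 1 by rewrite mulrNN mul1r.
have hb := symb_kernel (symb_amp2 ha) (@schwartz_symb R unit n _ hf).
apply/funext => y.
rewrite /psido_transpose /tAop -(oscillatoryE sgN hb y hpsi psi0); congr (_ * oscillatory _).
apply/funext => z /=.
rewrite /pqx /amp2 /liftq /osc phase_cat3 /cat3 !row_mxKl !row_mxKr.
rewrite (_ : -1 * dot (y - lsubmx z) (rsubmx z) = dot (lsubmx z - y) (rsubmx z)).
  by rewrite -mulrA mulrC.
by rewrite mulN1r /dot -sumrN; apply: eq_bigr => i _; rewrite !mxE; ring.
Qed.

Lemma tempered_psido_distr w : tempered w -> tempered (psido_distr a w).
Proof.
move=> hw; split=> [c f g hf hg|].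
  have [lw _] := hw; rewrite /psido_distr.
  rewrite !psido_transposeE//; last exact: schwartz_lin.
  by rewrite (tAop_lin ha)// lw//; exact: schwartz_tAop ha _ _.
have [N [C hC]] := tempered_le hw.
have hT := symb_tAop ha (@symb_bs R n).
have [k hk] := symb_unif N N (@wS_ge0 R n) hT.
(* [bs_gauge] at index [k] bounds the seminorms of order at most [k], so the gauge index of the
   estimate becomes the order of the functional. *)
exists k, (C%:R * k%:R) => f B hf hB.
have [p [pf pB]] := bs_exists hf hB.
rewrite /psido_distr psido_transposeE// -mulrA -pB -pf; apply: hC.
- exact: symb_schwartz p hT.
- by rewrite mulr_ge0// bs_ge0.
- by move=> s hs y; exact: hk.
Qed.

Lemma tempered_distr_of f : schwartz f -> tempered (distr_of f).
Proof.
move=> hf; split=> [c g h hg hh|].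
  rewrite /distr_of (_ : (fun x => _) = fun x => c * (f x * g x) + f x * h x).
    by rewrite cintegralD ?cintegralZ//; [exact: schwartz_mul_dec|
      exact/decZ/schwartz_mul_dec|exact: schwartz_mul_dec].
  by apply/funext => x; ring.
have [k hk] := schwartz_unif 0 n.*2 hf.
exists 0%N, (2 * cn R n * k%:R) => g B hg hB.
rewrite /distr_of -mulrA; apply: cintegral_bound; first exact: (schwartz_mul_dec hf hg).1.
move=> y; rewrite cabsM mulrAC; apply: ler_pM; rewrite ?cabs_ge0//; first exact: (hk [::]).
have := hB 0 0; rewrite /mlength big1 => [|i _]; last by rewrite mxE.
move=> /(_ isT isT y); rewrite /mpow big1 ?normr1 ?mul1r => [|i _]; last by rewrite mxE.
have -> : mderiv 0 g = g.
  rewrite /mderiv (_ : flatten _ = [::])//; elim: (enum _) => //= i s ->.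
  by rewrite mxE.
by [].
Qed.

Definition embed_net w : net R n := fun e => dconv w (moll phi (val e)).

Lemma embed_moderate w : tempered w -> moderate (embed_net w).
Proof.
move=> hw; split=> [e|s].
  exact/(dconv_smooth hw)/(symb_schwartz e (moll_moderate hphi)).
exact: (dconv_moderate hw s (moll_moderate hphi)).
Qed.

(** Regularising a Schwartz function is smearing it with the reflected mollifier, which keeps it
    bounded uniformly in epsilon, whereas [dconv_moderate] yields only moderateness. *)
Lemma embed_schwartz_bounded f : schwartz f ->
  symb (gauge1 R (eps_index R)) (@wS R n) (embed_net (distr_of f)).
Proof.
move=> hf; pose psi (x : 'rV[R]_n) := phi (0 - x).
have hpsi : schwartz psi := schwartz_refl 0 (moll_schwartz hphi).
have hs : symb (gauge1 R (eps_index R)) (@wS R n) (fun e => smear psi (val e) f).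
  by apply: symb_smear => //; exact: schwartz_symb.
move: hs; congr symb; apply/funext => e; apply/funext => x.
have e0 := eps_gt0 e; have ene0 := lt0r_neq0 e0.
have hm : schwartz (moll phi (val e)) := symb_schwartz e (moll_moderate hphi).
have hx := schwartz_refl x hm.
rewrite /embed_net /dconv /distr_of.
rewrite (cintegral_affine x e0 (smooth_ccont (smoothM hf.1 hx.1)) (schwartz_mul_dec hf hx)).
rewrite [in RHS](_ : (fun z : 'rV[R]_n => _) = fun z =>
    (val e ^- n)%:C * (psi z * f (x + val e *: z))).
  rewrite cintegralZ; last exact: (param_dec x (smear_param e hpsi hf)).
  by rewrite mulrA -RCM mulfV ?expf_neq0// mul1r.
apply/funext => z; rewrite /moll /psi opprD addrCA subrr addr0 scalerN scalerA mulVf// scale1r.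
by rewrite sub0r [_ + x]addrC; ring.
Qed.

Lemma phat_mul_moderate (u : net R n) : moderate u ->
  symb (gaugeE R) (@wS R n) (fun e x => u e x * phat (val e *: x)).
Proof. by move=> hu; apply: moderate_symb => //; exact: phat_scale_moderate. Qed.

Lemma phat_mul_bounded (u : net R n) : symb (gauge1 R (eps_index R)) (@wS R n) u ->
  symb (gauge1 R (eps_index R)) (@wS R n) (fun e x => u e x * phat (val e *: x)).
Proof.
move=> hu; apply: (symbM (@wS_ge0 R n) (@w1_ge0 R n) (@wS_ge0 R n) _ _ hu
  (phat_scale_bounded hphi)).
- by move=> K; exists K, 0%N, 1%N => z; rewrite mulr1 mul1r.
- by move=> k; exists 1%N => t; rewrite !mul1r.
Qed.

Lemma phat_mul_null_net (u : net R n) : null_net u ->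
  null_net (fun e x => u e x * phat (val e *: x)).
Proof.
move=> hu; have := moderate_null_net (symb_moderate (phat_scale_moderate hphi)) hu.
by congr null_net; apply/funext => e; apply/funext => x; rewrite mulrC.
Qed.

Lemma phat_cut_null_net (k : net R n) : symb (gauge1 R (eps_index R)) (@wS R n) k ->
  null_net (fun e x => (phat (val e *: x) - 1) * k e x).
Proof.
move=> hk q; apply: (symbM (@wQ_ge0 R n q) (@wS_ge0 R n) (@wS_ge0 R n) _ _ (phat_cut hphi q) hk).
- move=> K; exists 0%N, (K + q)%N, 1%N => z; rewrite mul1r /wQ /wS exprD invfM.
  by rewrite mulrCA mulfV ?mulr1// gt_eqF// jbX_gt0.
- by move=> k'; exists 1%N => t; rewrite mulr1 mul1r.
Qed.

Lemma psido_net_symb (u : net R n) : moderate u ->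
  symb (gaugeE R) (@wS R n) (psido_net phi a u).
Proof.
move=> hu; have hU := phat_mul_moderate hu.
have := symb_Aop ha hU; congr symb; apply/funext => e; apply/funext => x.
by rewrite psido_netE//; exact: symb_schwartz e hU.
Qed.

(* Both pairings are regularised values of [w] at nearby test functions, by
   duality and by the definition of the transposed operator. *)
Lemma psido_pairing w (u g0 : net R n) : tempered w -> moderate u ->
  null_net (fun e x => u e x - embed_net w e x) ->
  symb (gauge1 R (eps_index R)) (@wS R n) g0 ->
  small (fun e => cintegral (fun x => psido_net phi a u e x * g0 e x) -
    cintegral (fun x => embed_net (psido_distr a w) e x * g0 e x)).
Proof.
move=> hw hu hn hg.
have hw' := tempered_psido_distr hw.
have hU := phat_mul_moderate hu.
have hk := symb_tAop ha hg.
set k := fun e => tAop a (g0 e) in hk.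
have hpk : symb (gauge1 R (eps_index R)) (@wS R n) (fun e x => k e x * phat (val e *: x)).
  exact: phat_mul_bounded.
set pk := fun e x => k e x * phat (val e *: x) in hpk.
have sg e : schwartz (g0 e) := symb_schwartz e hg.
have sk e : schwartz (k e) := symb_schwartz e hk.
have spk e : schwartz (pk e) := symb_schwartz e hpk.
have hnk : null_net (fun e x => pk e x * (u e x - embed_net w e x)).
  apply: moderate_null_net => //; exact/symb_moderate/gauge1E.
have hpc : null_net (fun e x => smear phi (val e) (pk e) x - pk e x).
  by move=> q; exact: (symb_smear_sub hphi q hpk).
have hgc : null_net (fun e x => smear phi (val e) (g0 e) x - g0 e x).
  by move=> q; exact: (symb_smear_sub hphi q hg).
have hkc := phat_cut_null_net hk.
(* Four errors appear: [u] against the regularisation of [w], the smearing of [pk], the factor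
   [phat], and the smearing of [g0]. The main terms [w (k e)] and [psido_distr a w (g0 e)] coincide
   by transposition. *)
have E e : cintegral (fun x => psido_net phi a u e x * g0 e x) -
    cintegral (fun x => embed_net (psido_distr a w) e x * g0 e x) =
  cintegral (fun x => pk e x * (u e x - embed_net w e x)) +
  (w (fun x => smear phi (val e) (pk e) x - pk e x) +
   (w (fun x => (phat (val e *: x) - 1) * k e x) +
    - psido_distr a w (fun x => smear phi (val e) (g0 e) x - g0 e x))).
  have sm f : schwartz f -> schwartz (smear phi (val e) f).
    move=> hf; exact: (symb_schwartz e (symb_smear (moll_schwartz hphi)
      (@schwartz_symb R (eps_index R) n f hf))).
  rewrite (dconv_pairing hphi e hw' (sg e)).
  rewrite (_ : (fun x => psido_net phi a u e x * g0 e x) =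
    fun x => Aop a (fun y => u e y * phat (val e *: y)) x * g0 e x); last first.
    by apply/funext => x; rewrite psido_netE//; exact: symb_schwartz e hU.
  rewrite (Aop_duality ha (symb_schwartz e hU) (sg e)).
  rewrite (_ : (fun y => _) = fun y => pk e y * (u e y - embed_net w e y) +
     embed_net w e y * pk e y); last first.
    by apply/funext => y; rewrite /pk /k; ring.
  have dW : dec (fun y => embed_net w e y * pk e y).
    have h := moderate_symb (embed_moderate hw) (gauge1E hpk).
    exact/schwartz_dec/(symb_schwartz e h).
  rewrite cintegralD//; last exact/schwartz_dec/(symb_schwartz e (hnk 0%N)).
  rewrite (dconv_pairing hphi e hw (spk e)) -addrA; congr (_ + _).
  rewrite (temperedB hw (sm _ (spk e)) (spk e)).
  rewrite (temperedB hw' (sm _ (sg e)) (sg e)).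
  rewrite (_ : (fun x => (phat (val e *: x) - 1) * k e x) = fun x => pk e x - k e x); last first.
    by apply/funext => x; rewrite /pk; ring.
  have wk : psido_distr a w (g0 e) = w (k e) by rewrite /psido_distr psido_transposeE.
  rewrite (temperedB hw (spk e) (sk e)) wk.
  move: (w _) (w _) (w _) (psido_distr _ _ _) => b1 b2 b3 b4.
  by ring.
rewrite (_ : (fun e => _) = fun e =>
  cintegral (fun x => pk e x * (u e x - embed_net w e x)) +
  (w (fun x => smear phi (val e) (pk e) x - pk e x) +
   (w (fun x => (phat (val e *: x) - 1) * k e x) +
    - psido_distr a w (fun x => smear phi (val e) (g0 e) x - g0 e x)))); last exact/funext.
apply: smallD; first exact: small_integral hnk.
apply: smallD; first exact: (small_tempered hw hpc).
apply: smallD; first exact: (small_tempered hw hkc).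
exact/smallN/(small_tempered hw' hgc).
Qed.

Lemma gintegral_net_small w (u : net R n) f : tempered w -> moderate u ->
  null_net (fun e x => u e x - embed_net w e x) -> schwartz f ->
  small (fun e => cintegral (fun x =>
    (psido_net phi a u e x - embed_net (psido_distr a w) e x) * embed_net (distr_of f) e x *
    fourier (moll phi (val e)) x)).
Proof.
move=> hw hu hn hf.
have hg := phat_mul_bounded (embed_schwartz_bounded hf).
have h := psido_pairing hw hu hn hg.
move: h; congr small; apply/funext => e; rewrite -cintegralB.
- congr cintegral; apply/funext => x; rewrite (fourier_moll hphi) -mulrBl mulrA.
  by [].
- have h := moderate_symb (symb_moderate (psido_net_symb hu)) (gauge1E hg).
  exact/schwartz_dec/(symb_schwartz e h).
- have h := moderate_symb (embed_moderate (tempered_psido_distr hw)) (gauge1E hg).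
  exact/schwartz_dec/(symb_schwartz e h).
Qed.
End Operators.

Theorem corollary6p2 (R : realType) (n : nat) (hn : (0 < n)%N)
    (phi : 'rV[R]_n -> R[i]) (hphi : mollifier phi)
    (a : 'rV[R]_(n + n + n) -> R[i]) (ha : classical_amplitude a)
    (w : ('rV[R]_n -> R[i]) -> R[i]) (hw : tempered w) :
  gtd_eq phi (psido_gen phi a (embed phi w)) (embed phi (psido_distr a w)).
Proof.
have [M {}ha] := amplitude_symb ha.
move=> f hf.
set w' := psido_distr a w; have hw' : tempered w' := tempered_psido_distr hphi ha hw.
pose W := embed_net phi w; pose W' := embed_net phi w'; pose Fn := embed_net phi (distr_of f).
have mW : moderate W := embed_moderate hphi hw.
have mW' : moderate W' := embed_moderate hphi hw'.
have mF : moderate Fn := embed_moderate hphi (tempered_distr_of hf).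
(* Stated for an arbitrary representative [u], since the lifted operations take unions over all
   representatives. *)
have key (u : net R n) : moderate u -> null_net (fun e x => u e x - W e x) ->
    moderate (psido_net phi a u) /\ small (fun e => cintegral (fun x =>
      (psido_net phi a u e x - W' e x) * Fn e x * fourier (moll phi (val e)) x)).
  move=> hu hn'; split; first exact/symb_moderate/(psido_net_symb hphi ha hu).
  exact: (gintegral_net_small hphi ha hw hu hn' hf).
have neg0 (u : net R n) : @N_S R n (u - u).
  rewrite subrr; apply/N_SP => q; split=> [e|s K]; first exact: smooth_cst.
  by exists 0%N => e x; rewrite (@pderivs0 R n s) cabs0 !mul0r.
apply/seteqP; split=> h.
(* One representative per lift: [u] for the embedding of [w], [u1] for its image under the operator,
   [u2] for the right-hand side, [v] for the difference, [u3] for the test function and [t] for the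
   product. *)
- move=> [t [v [u3 [[u1 [u2 [[u uW [mu1 nu1]] [mu2 nu2] [mv nv]]]] [mu3 nu3] [mt nt]]]] [mh nh]].
  split=> //; rewrite subr0.
  have [mu nu] := uW; move/E_tauP in mu; move/N_SP in nu.
  move/E_tauP in mu1; move/N_SP in nu1; move/E_tauP in mu2; move/N_SP in nu2.
  move/E_tauP in mv; move/N_SP in nv; move/E_tauP in mu3; move/N_SP in nu3.
  move/E_tauP in mt; move/N_SP in nt; move/N_oP in nh.
  have [mX sX] := key u mu nu.
  set X := psido_net phi a u in mX sX nu1.
  (* The effect of all these choices: [r] telescopes into five coset errors, four of them multiplied
     by a moderate net, and so is a null net. *)
  pose r e x := t e x - (X e x - W' e x) * Fn e x.
  have hr : null_net r.
    have := null_netD nt (null_netD (moderate_null_net mv nu3)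
      (null_netD (moderate_null_net mF nv)
      (null_netD (moderate_null_net mF nu1) (null_netN (moderate_null_net mF nu2))))).
    congr null_net; apply/funext => e; apply/funext => x; rewrite /r.
    rewrite -[(t - _) e x]/(t e x - v e x * u3 e x) -[(u3 - _) e x]/(u3 e x - Fn e x).
    rewrite -[(v - _) e x]/(v e x - (u1 e x - u2 e x)) -[(u1 - _) e x]/(u1 e x - X e x).
    rewrite -[(u2 - _) e x]/(u2 e x - W' e x).
    move: (t e x) (v e x) (u1 e x) (u2 e x) (u3 e x) (Fn e x) (X e x) (W' e x).
    by move=> x1 x2 x3 x4 x5 x6 x7 x8; ring.
  have mP : moderate (fun e x => (X e x - W' e x) * Fn e x).
    exact/moderateM/mF/moderateB.
  apply/N_oP; have := smallD nh (smallD (small_integral (phat_mul_null_net hphi hr)) sX).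
  congr small; apply/funext => e.
  have d1 := schwartz_dec (symb_schwartz e (phat_mul_null_net hphi hr 0%N)).
  have d2 := schwartz_dec (symb_schwartz e (phat_mul_moderate hphi mP)).
  have -> : cintegral (fun x => (X e x - W' e x) * Fn e x * fourier (moll phi (val e)) x) =
      cintegral (fun x => (X e x - W' e x) * Fn e x * fourier phi (val e *: x)).
    by congr cintegral; apply/funext => x; rewrite (fourier_moll hphi).
  rewrite -(cintegralD d1 d2).
  rewrite -[(h - _) e]/(h e - cintegral (fun x => t e x * fourier (moll phi (val e)) x)).
  rewrite [X in _ + X](_ : _ = cintegral (fun x => t e x * fourier (moll phi (val e)) x)).
    by rewrite subrK.
  by congr cintegral; apply/funext => x; rewrite (fourier_moll hphi) /r; ring.
(* Conversely, every negligible number must belong to the left-hand class, so representatives have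
   to be exhibited; the canonical ones serve. *)
- move=> [mh nh]; rewrite subr0 in nh.
  have nuW : null_net (fun e x => W e x - W e x) by apply/N_SP; exact: neg0.
  have [mX sX] := key W mW nuW.
  set X := psido_net phi a W in mX sX.
  have mv := moderateB mX mW'.
  have mt := moderateM mv mF.
  have cosetE (u : net R n) : moderate u -> coset (@E_tau R n) (@N_S R n) u u.
    by move=> mu; split; [exact/E_tauP|exact: neg0].
  exists (fun e x => (X e x - W' e x) * Fn e x).
    exists (fun e x => X e x - W' e x), Fn; split; [|exact: cosetE|exact: cosetE].
    exists X, W'; split; [|exact: cosetE|exact: cosetE].
    by exists W; exact: cosetE.
  split=> //; apply/N_oP; move/N_oP in nh.
  exact: (smallD nh (smallN sX)).
Qed.
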